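(* Let $\alpha\in(0,1)$, let $\{U(t):t\in\mathbb R\}$ be the unitary group on $L^2(\mathbb R)$ given by $U(t)v_0=(e^{it\xi^3}\widehat v_0)^{\vee}$, and for a function $f$ on $\mathbb R$ let $$\Phi_{t,\alpha}(f)(\xi)=\lim_{\epsilon\to0}\frac1{c_\alpha}\int_{|\eta|\ge\epsilon}\frac{e^{it((\xi+\eta)^3-\xi^3)}-1}{|\eta|^{1+\alpha}}\,f(\xi+\eta)\,d\eta,\qquad c_\alpha=\frac{\pi^{1/2}\,2^{-\alpha}\,\Gamma(-\alpha/2)}{\Gamma((1+\alpha)/2)}.$$ (i) There is a constant $c$ (independent of $t$ and $u_0$) such that if $$u_0\in Z_{2\alpha,\alpha}=H^{2\alpha}(\mathbb R)\cap L^2(|x|^{2\alpha}dx),$$ then for all $t\in\mathbb R$ and for almost every $x\in\mathbb R$ $$|x|^{\alpha}\,U(t)u_0(x)=U(t)(|x|^{\alpha}u_0)(x)+U(t)\{\Phi_{t,\alpha}(\widehat u_0)(\xi)\}^{\vee}(x),$$ with $$\|\{\Phi_{t,\alpha}(\widehat u_0)(\xi)\}^{\vee}\|_2\le c(1+|t|)\big(\|u_0\|_2+\|D^{2\alpha}u_0\|_2\big).$$ (ii) Let moreover $\beta\in(0,\alpha)$. There is a constant $c$ (independent of $t$ and $u_0$) such that if, in addition to $u_0\in Z_{2\alpha,\alpha}$, one has $$D^{\beta}(|x|^{\alpha}u_0)\in L^2(\mathbb R)\quad\text{and}\quad u_0\in H^{\beta+2\alpha}(\mathbb R),$$ then for all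 $t\in\mathbb R$ and for almost every $x\in\mathbb R$ $$D^{\beta}(|x|^{\alpha}U(t)u_0)(x)=U(t)(D^{\beta}|x|^{\alpha}u_0)(x)+U(t)\big(D^{\beta}(\{\Phi_{t,\alpha}(\widehat u_0)(\xi)\}^{\vee})\big)(x),$$ with $$\|D^{\beta}(\{\Phi_{t,\alpha}(\widehat u_0)(\xi)\}^{\vee})\|_2\le c(1+|t|)\big(\|u_0\|_2+\|D^{\beta+2\alpha}u_0\|_2\big).$$
   Context: The Fourier transform is normalized so that $\partial_x$ corresponds to multiplication by $i\xi$, i.e. with kernel $e^{-ix\xi}$; $^{\vee}$ denotes the inverse Fourier transform. Thus $v(x,t)=U(t)v_0(x)$ solves $\partial_tv+\partial_x^3v=0$, $v(x,0)=v_0(x)$. For $s\ge0$, $D^s=(-\partial_x^2)^{s/2}$ is the homogeneous derivative, $\widehat{D^sf}(\xi)=|\xi|^s\widehat f(\xi)$. $H^s(\mathbb R)$ is the usual $L^2$-based Sobolev space, $L^2(|x|^{2r}dx)$ is the space of $f$ with $|x|^rf\in L^2(\mathbb R)$, and $\|\cdot\|_2$ is the $L^2(\mathbb R)$ norm. *)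

(* Defs.v *)
From HB Require Import structures.
From mathcomp Require Import all_boot all_order all_algebra.
From mathcomp Require Import complex.
From mathcomp Require Import all_classical all_reals all_analysis.
Import Order.TTheory GRing.Theory Num.Theory.
Import numFieldNormedType.Exports.

Set Implicit Arguments.
Unset Strict Implicit.
Unset Printing Implicit Defensive.

Local Open Scope classical_set_scope.
Local Open Scope complex_scope.
Local Open Scope ring_scope.

(* The pointwise operations below act on Borel functions R -> R[i], not on
   a.e.-classes.  A Fourier transform is one representative of its class,
   picked by xget, so identities between transforms are meant a.e. *)

Section Complex_valued_functions.
Context {R : realType}.
Implicit Types (f g : R -> R[i]) (r s t : R).

Definition cis r : R[i] := cos r +i* sin r.

Definition cmod (z : R[i]) : R := ComplexField.Normc.normc z.

Definition cintegral (A : set R) f : R[i] :=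
  Rintegral (@lebesgue_measure R) A (fun x => complex.Re (f x))
  +i* Rintegral (@lebesgue_measure R) A (fun x => complex.Im (f x)).

Definition L2norm f : \bar R :=
  Lnorm (@lebesgue_measure R) 2%:E (fun x => (cmod (f x))%:E).

Definition inL2 f : Prop :=
  [/\ measurable_fun [set: R] (fun x => complex.Re (f x)),
      measurable_fun [set: R] (fun x => complex.Im (f x)) &
      (L2norm f < +oo)%E].

Definition abs_weight r f : R -> R[i] := fun x => (`|x| `^ r)%:C * f x.

(* r is the power of |x| against f itself, i.e. half the exponent of the
   weight |x|^(2r) dx. *)
Definition in_weightedL2 r f : Prop := inL2 (abs_weight r f).

End Complex_valued_functions.

(* The Plancherel transform on L^2: limit in the L^2 norm, as n -> oo, of the
   integrals over [-n, n].  It takes the junk value 0 outside L^2. *)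
Section Fourier.
Context {R : realType}.
Implicit Types (f g : R -> R[i]).

Definition fourier_trunc (n : nat) f (xi : R) : R[i] :=
  cintegral `[- n%:R, n%:R] (fun x => cis (- (x * xi)) * f x).

Definition ifourier_trunc (n : nat) g (x : R) : R[i] :=
  ((2 * pi)^-1)%:C * cintegral `[- n%:R, n%:R] (fun xi => cis (x * xi) * g xi).

Definition is_fourier f g : Prop :=
  [/\ inL2 f, inL2 g &
      (L2norm (fun xi => (g xi - fourier_trunc n f xi)%R)
         @[n --> \oo] --> 0)%E].

Definition is_ifourier g f : Prop :=
  [/\ inL2 g, inL2 f &
      (L2norm (fun x => (f x - ifourier_trunc n g x)%R)
         @[n --> \oo] --> 0)%E].

Definition fourier f : R -> R[i] := xget (cst 0) [set g | is_fourier f g].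

Definition ifourier g : R -> R[i] := xget (cst 0) [set f | is_ifourier g f].

End Fourier.

Section Operators.
Context {R : realType}.
Implicit Types (f : R -> R[i]) (s t : R).

Definition airy_group t f : R -> R[i] :=
  ifourier (fun xi => cis (t * xi ^+ 3) * fourier f xi).

Definition frac_deriv s f : R -> R[i] :=
  ifourier (abs_weight s (fourier f)).

(* "f is in L^2 and D^s f is in L^2"; frac_deriv s f is meaningful exactly
   under this condition. *)
Definition frac_deriv_inL2 s f : Prop :=
  inL2 f /\ inL2 (abs_weight s (fourier f)).

Definition inH s f : Prop :=
  inL2 f /\
  inL2 (fun xi => ((1 + xi ^+ 2) `^ (s / 2))%:C * fourier f xi).

Definition inZ s r f : Prop := inH s f /\ in_weightedL2 r f.

End Operators.

Section Phi.
Context {R : realType}.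
Implicit Types (f : R -> R[i]) (t alpha eps xi : R).

(* Euler's integral for x > 0, extended to non-integral x < 0 by
   Gamma (x + 1) = x * Gamma x. *)
Definition Gamma_integral (x : R) : R :=
  Rintegral (@lebesgue_measure R) `]0, +oo[ (fun y => y `^ (x - 1) * expR (- y)).

Definition Gamma (x : R) : R :=
  if 0 < x then Gamma_integral x
  else let n := (Num.truncn (- x)).+1 in
       Gamma_integral (x + n%:R) / \prod_(k < n) (x + k%:R).

Definition c_ (alpha : R) : R :=
  pi `^ (2^-1) * 2 `^ (- alpha) * Gamma (- alpha / 2)
  / Gamma ((1 + alpha) / 2).

Definition Phi_trunc t alpha f eps xi : R[i] :=
  ((c_ alpha)^-1)%:C *
  cintegral [set eta | eps <= `|eta|]
    (fun eta => (cis (t * ((xi + eta) ^+ 3 - xi ^+ 3)) - 1)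
                / (`|eta| `^ (1 + alpha))%:C * f (xi + eta)).

Definition is_Phi t alpha f xi (l : R[i]) : Prop :=
  cmod (Phi_trunc t alpha f eps xi - l) @[eps --> 0^'+] --> 0.

Definition Phi t alpha f xi : R[i] := xget 0 [set l | is_Phi t alpha f xi l].

(* The limit exists for a.e. xi and defines an L^2 function, so that the
   inverse transform of Phi t alpha f makes sense. *)
Definition Phi_defined t alpha f : Prop :=
  {ae @lebesgue_measure R, forall xi, exists l, is_Phi t alpha f xi l} /\
  inL2 (Phi t alpha f).

End Phi.

(* Main.v *)
(** Since c_alpha < 0 is minus the integral of (1 - cos eta) |eta|^(-1-alpha), the weight
    |x|^alpha is the increasing limit, as eps -> 0, of the multipliers
      c_alpha^-1 int_{|eta| >= eps} (e^(-i x eta) - 1) |eta|^(-1-alpha) d eta,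
    which act on the Fourier side as
      T_eps h (xi) = c_alpha^-1 int_{|eta| >= eps} (h (xi + eta) - h xi) |eta|^(-1-alpha) d eta.
    Replacing h by e^(i t xi^3) h gives T_eps (e h) = e (T_eps h + Phi_eps h), where Phi_eps is
    the truncation in the definition of Phi, and the identities follow by letting eps -> 0 in L^2.

    The estimates are Schur's test.  With zeta = xi + eta the kernel of Phi is at most
      C (1 + |t|) min (1, (1 + zeta^2) |eta|) |eta|^(-1-alpha),
    and int min (1, a |eta|) |eta|^(-1-m) d eta = C_m a^m for 0 < m < 1, so that the weight
    (1 + zeta^2)^(alpha + beta/2) makes both marginals of |xi|^beta times the kernel bounded;
    m = alpha - beta appears because |eta|^beta is absorbed in the kernel, whence beta < alpha.

    Plancherel's theorem is obtained by Gaussian regularisation of Parseval's identity, and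
    c_alpha by integrating a multiplier identity against a Gaussian. *)

(* The function |x|^alpha U(t) u0 is not known beforehand to be square integrable, so its Fourier
   transform cannot be taken at the start. The truncated multipliers, however, are bounded for each
   eps: they act on U(t) u0 inside L^2, their transforms converge in norm on the Fourier side, the
   multipliers themselves converge pointwise on the physical side, and Fatou's lemma matches the two
   limits a.e. Square integrability of |x|^alpha U(t) u0, and in part (ii) of its derivative of
   order beta, is then a consequence.

   In Schur's test the phase difference is t eta (zeta^2 + zeta xi + xi^2), to be controlled by zeta
   alone, since only zeta carries the Sobolev weight. The obstacle is the region |xi| >= 2 |zeta|:
   there |eta| >= |xi| / 2, so as soon as |eta| <= 1 both frequencies are bounded, and min (1,
   |eta|) suffices without a growing factor.

   Transforms are representatives chosen by [xget]. Arguments that agree a.e. have the same set of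
   candidates, hence literally the same transform; this is what allows transforms to be composed. *)
Require Import Defs.
From HB Require Import structures.
From mathcomp Require Import all_boot all_order all_algebra.
From mathcomp Require Import complex.
From mathcomp Require Import all_classical all_reals all_analysis measurable_realfun.
From mathcomp Require Import ring lra.
Import Order.TTheory GRing.Theory Num.Theory.
Import numFieldNormedType.Exports.

Local Open Scope classical_set_scope.
Local Open Scope complex_scope.
Local Open Scope ring_scope.

Set Implicit Arguments.
Unset Strict Implicit.
Unset Printing Implicit Defensive.

(** * Complex numbers and complex-valued integrals *)
Section complex_numbers.
Context {R : realType}.
Implicit Types (z w : R[i]) (r s : R).

Lemma ReD z w : complex.Re (z + w) = complex.Re z + complex.Re w.
Proof. by case: z; case: w. Qed.

Lemma ImD z w : complex.Im (z + w) = complex.Im z + complex.Im w.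
Proof. by case: z; case: w. Qed.

Lemma ReN z : complex.Re (- z) = - complex.Re z.
Proof. by case: z. Qed.

Lemma ImN z : complex.Im (- z) = - complex.Im z.
Proof. by case: z. Qed.

Lemma ReM z w :
  complex.Re (z * w) = complex.Re z * complex.Re w - complex.Im z * complex.Im w.
Proof. by case: z; case: w. Qed.

Lemma ImM z w :
  complex.Im (z * w) = complex.Re z * complex.Im w + complex.Im z * complex.Re w.
Proof. by case: z; case: w => a b c d /=; rewrite addrC. Qed.

Lemma ReJ z : complex.Re (z^*) = complex.Re z.
Proof. by case: z. Qed.

Lemma ImJ z : complex.Im (z^*) = - complex.Im z.
Proof. by case: z. Qed.

Lemma complexP z w :
  complex.Re z = complex.Re w -> complex.Im z = complex.Im w -> z = w.
Proof. by case: z; case: w => a b c d /= -> ->. Qed.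

Lemma sqr_cmod z : cmod z ^+ 2 = complex.Re z ^+ 2 + complex.Im z ^+ 2.
Proof. by case: z => a b /=; rewrite sqr_sqrtr// addr_ge0// sqr_ge0. Qed.

Lemma cmodE z : cmod z = Num.sqrt (complex.Re z ^+ 2 + complex.Im z ^+ 2).
Proof. by case: z. Qed.

Lemma cmod_ge0 z : 0 <= cmod z.
Proof. by rewrite cmodE sqrtr_ge0. Qed.

Lemma cmodM z w : cmod (z * w) = cmod z * cmod w.
Proof. exact: ComplexField.Normc.normcM. Qed.

Lemma cmodD z w : cmod (z + w) <= cmod z + cmod w.
Proof. exact: le_normcD. Qed.

Lemma cmodN z : cmod (- z) = cmod z.
Proof. exact: normcN. Qed.

Lemma cmodBC z w : cmod (z - w) = cmod (w - z).
Proof. by rewrite -cmodN opprB. Qed.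

Lemma cmodB z w : cmod (z - w) <= cmod z + cmod w.
Proof. by rewrite -(cmodN w) cmodD. Qed.

Lemma cmod0 : cmod (0 : R[i]) = 0.
Proof. exact: ComplexField.Normc.normc0. Qed.

Lemma cmod_eq0 z : cmod z = 0 -> z = 0.
Proof. exact: ComplexField.Normc.eq0_normc. Qed.

Lemma cmod_real r : cmod r%:C = `|r|.
Proof. by rewrite cmodE /= expr0n/= addr0 sqrtr_sqr. Qed.

Lemma cmodJ z : cmod (z^*) = cmod z.
Proof. by rewrite !cmodE ReJ ImJ sqrrN. Qed.

Lemma cmod_Re z : `|complex.Re z| <= cmod z.
Proof.
by rewrite cmodE -sqrtr_sqr ler_sqrt ?lerDl ?sqr_ge0// addr_ge0 ?sqr_ge0.
Qed.

Lemma cmod_Im z : `|complex.Im z| <= cmod z.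
Proof.
by rewrite cmodE -sqrtr_sqr ler_sqrt ?lerDr ?sqr_ge0// addr_ge0 ?sqr_ge0.
Qed.

Lemma cmod_le_ReIm z : cmod z <= `|complex.Re z| + `|complex.Im z|.
Proof.
rewrite -(@ler_pXn2r _ 2) ?nnegrE ?cmod_ge0 ?addr_ge0//.
rewrite sqr_cmod sqrrD !real_normK ?num_real//.
have := mulr_ge0 (normr_ge0 (complex.Re z)) (normr_ge0 (complex.Im z)); lra.
Qed.

Lemma cisD r s : cis (r + s) = cis r * cis s.
Proof. by rewrite /cis cosD sinD; apply: complexP; rewrite ?ReM ?ImM/= 1?addrC// addrC. Qed.

Lemma cisN r : cis (- r) = (cis r)^*.
Proof. by rewrite /cis cosN sinN. Qed.

Lemma cmod_cis r : cmod (cis r) = 1.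
Proof. by rewrite cmodE /= cos2Dsin2 sqrtr1. Qed.

Lemma mulcJ z : z * z^* = (cmod z ^+ 2)%:C.
Proof.
by apply: complexP; rewrite ?ReM ?ImM ReJ ImJ /= ?sqr_cmod; ring.
Qed.

Lemma cmod_mul_le z w : cmod z * cmod w <= (cmod z ^+ 2 + cmod w ^+ 2) / 2.
Proof. by have := sqr_ge0 (cmod z - cmod w); nra. Qed.

End complex_numbers.

Section complex_measurable.
Context d {T : measurableType d} {R : realType}.
Implicit Types (f g : T -> R[i]).

(** Exactly the two measurability clauses of [inL2], over an arbitrary measurable space so that
    kernels on [R * R] are covered as well. *)
Definition cmeas f :=
  measurable_fun [set: T] (fun x => complex.Re (f x)) /\
  measurable_fun [set: T] (fun x => complex.Im (f x)).

Lemma cmeasD f g : cmeas f -> cmeas g -> cmeas (fun x => f x + g x).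
Proof.
move=> [fr fi] [gr gi]; split.
  by under eq_fun do rewrite ReD; exact: measurable_funD.
by under eq_fun do rewrite ImD; exact: measurable_funD.
Qed.

Lemma cmeasN f : cmeas f -> cmeas (fun x => - f x).
Proof.
move=> [fr fi]; split.
  by under eq_fun do rewrite ReN; exact: measurableT_comp.
by under eq_fun do rewrite ImN; exact: measurableT_comp.
Qed.

Lemma cmeasB f g : cmeas f -> cmeas g -> cmeas (fun x => f x - g x).
Proof. by move=> mf mg; apply: cmeasD => //; exact: cmeasN. Qed.

Lemma cmeasM f g : cmeas f -> cmeas g -> cmeas (fun x => f x * g x).
Proof.
move=> [fr fi] [gr gi]; split.
  by under eq_fun do rewrite ReM; apply: measurable_funB; exact: measurable_funM.
by under eq_fun do rewrite ImM; apply: measurable_funD; exact: measurable_funM.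
Qed.

Lemma cmeasJ f : cmeas f -> cmeas (fun x => (f x)^*).
Proof.
move=> [fr fi]; split.
  by under eq_fun do rewrite ReJ.
by under eq_fun do rewrite ImJ; exact: measurableT_comp.
Qed.

Lemma cmeas_real (r : T -> R) :
  measurable_fun [set: T] r -> cmeas (fun x => (r x)%:C).
Proof. by move=> mr; split => /=. Qed.

Lemma cmeas_cst (z : R[i]) : cmeas (fun=> z).
Proof. by split => /=. Qed.

Lemma cmeas_cis (r : T -> R) :
  measurable_fun [set: T] r -> cmeas (fun x => cis (r x)).
Proof.
move=> mr; split => /=; apply: measurableT_comp => //.
  by apply: continuous_measurable_fun; exact: continuous_cos.
by apply: continuous_measurable_fun; exact: continuous_sin.
Qed.

Lemma measurable_cmod f : cmeas f -> measurable_fun [set: T] (fun x => cmod (f x)).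
Proof.
move=> [fr fi]; under eq_fun do rewrite cmodE.
apply: (@measurableT_comp _ _ _ _ _ _ (@Num.sqrt R)).
  by apply: continuous_measurable_fun; exact: sqrt_continuous.
by apply: measurable_funD; exact: measurable_funX.
Qed.

End complex_measurable.

Lemma cmeas_comp d d' (T : measurableType d) (T' : measurableType d') (R : realType)
    (f : T' -> R[i]) (h : T -> T') :
  cmeas f -> measurable_fun [set: T] h -> cmeas (fun x => f (h x)).
Proof. by move=> [fr fi] mh; split; [exact: (measurableT_comp fr)|exact: (measurableT_comp fi)]. Qed.

Section almost_everywhere.
Context {R : realType}.
Local Notation mu := (@lebesgue_measure R).
Implicit Types P Q S : R -> Prop.

Lemma ae_imply P Q : (forall x, P x -> Q x) ->
  {ae mu, forall x, P x} -> {ae mu, forall x, Q x}.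
Proof. by move=> PQ; exact: (@filterS _ _ (ae_filter_ringOfSetsType mu) _ _ PQ). Qed.

Lemma ae_imply2 P Q S : (forall x, P x -> Q x -> S x) ->
  {ae mu, forall x, P x} -> {ae mu, forall x, Q x} -> {ae mu, forall x, S x}.
Proof. by move=> PQ; exact: (@filterS2 _ _ (ae_filter_ringOfSetsType mu) _ _ _ PQ). Qed.

Lemma ae_everywhere P : (forall x, P x) -> {ae mu, forall x, P x}.
Proof. by move=> h; exact: (@nearW _ _ _ (ae_filter_ringOfSetsType mu) h). Qed.

Lemma ae_all (P : nat -> R -> Prop) :
  (forall n, {ae mu, forall x, P n x}) -> {ae mu, forall x, forall n, P n x}.
Proof.
move=> h; apply: negligibleS (negligible_bigcup h) => x /= /existsNP[n nP].
by exists n.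
Qed.

End almost_everywhere.

Section extended_limits.
Context {R : realType} {I : Type} {F : set_system I} {FF : Filter F}.

Lemma cvg_EFinE (u : I -> R) (l : R) :
  (u x)%:E @[x --> F] --> l%:E <-> u x @[x --> F] --> l.
Proof.
split=> [/fine_cvg//|ul].
by apply: cvg_EFin => //; apply: nearW => x; rewrite fin_numE.
Qed.

Lemma squeeze_cvg0 (u : I -> R) (v : I -> \bar R) :
  (forall x, 0 <= u x) -> (forall x, ((u x)%:E <= v x)%E) ->
  v x @[x --> F] --> 0%E -> u x @[x --> F] --> (0 : R).
Proof.
move=> u0 uv v0; apply/cvg_EFinE.
apply: (@squeeze_cvge _ _ _ _ (cst 0%E) _ v) => //; last exact: cvg_cst.
by apply: nearW => x; rewrite lee_fin u0 uv.
Qed.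

Lemma squeeze_cvge0 (u v : I -> \bar R) :
  (forall x, (0 <= u x)%E) -> (forall x, (u x <= v x)%E) ->
  v x @[x --> F] --> 0%E -> u x @[x --> F] --> (0%E : \bar R).
Proof.
move=> u0 uv v0; apply: (@squeeze_cvge _ _ _ _ (cst 0%E) _ v) => //; last exact: cvg_cst.
by apply: nearW => x; rewrite u0 uv.
Qed.

End extended_limits.

(** * Integrals of complex-valued functions on the line *)

Section complex_integral.
Context {R : realType}.
Local Notation mu := (@lebesgue_measure R).
Implicit Types (f g : R -> R[i]) (z : R[i]).

Definition nint f : \bar R := (\int[mu]_x (cmod (f x))%:E)%E.

Definition cintegrable f := cmeas f /\ (nint f < +oo)%E.

Lemma ge0_integral_le (f g : R -> R) :
  measurable_fun [set: R] f -> measurable_fun [set: R] g ->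
  (forall x, 0 <= f x) -> (forall x, f x <= g x) ->
  (\int[mu]_x (f x)%:E <= \int[mu]_x (g x)%:E)%E.
Proof.
move=> mf mg f0 fg; apply: ge0_le_integral => //.
- by move=> x _; rewrite lee_fin.
- exact/measurable_EFinP.
- exact/measurable_EFinP.
- by move=> x _; rewrite lee_fin.
Qed.

Lemma nint_ge0 f : (0 <= nint f)%E.
Proof. by apply: integral_ge0 => x _; rewrite lee_fin cmod_ge0. Qed.

Lemma integrable_of_le (f g : R -> R) :
  measurable_fun [set: R] f -> measurable_fun [set: R] g ->
  (forall x, `|f x| <= g x) -> (\int[mu]_x (g x)%:E < +oo)%E ->
  mu.-integrable [set: R] (EFin \o f).
Proof.
move=> mf mg fg goo; apply/integrableP; split; first exact/measurable_EFinP.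
apply: le_lt_trans goo; apply: ge0_integral_le => //.
exact: measurableT_comp.
Qed.

Lemma cintegrable_Re f : cintegrable f ->
  mu.-integrable [set: R] (EFin \o (fun x => complex.Re (f x))).
Proof.
move=> [mf foo]; apply: integrable_of_le foo; [by case: mf|exact: measurable_cmod|].
by move=> x; exact: cmod_Re.
Qed.

Lemma cintegrable_Im f : cintegrable f ->
  mu.-integrable [set: R] (EFin \o (fun x => complex.Im (f x))).
Proof.
move=> [mf foo]; apply: integrable_of_le foo; [by case: mf|exact: measurable_cmod|].
by move=> x; exact: cmod_Im.
Qed.

Lemma cintegrable_cmod f : cintegrable f ->
  mu.-integrable [set: R] (EFin \o (fun x => cmod (f x))).
Proof.
move=> [mf foo]; apply: integrable_of_le foo; [exact: measurable_cmod|exact: measurable_cmod|].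
by move=> x; rewrite ger0_norm ?cmod_ge0.
Qed.

Lemma cintegrable_le f (g : R -> R) : cmeas f -> measurable_fun [set: R] g ->
  (forall x, cmod (f x) <= g x) -> (\int[mu]_x (g x)%:E < +oo)%E -> cintegrable f.
Proof.
move=> mf mg fg goo; split => //; apply: le_lt_trans goo.
apply: ge0_integral_le => //; first exact: measurable_cmod.
by move=> x; exact: cmod_ge0.
Qed.

Lemma cintegrableD f g : cintegrable f -> cintegrable g ->
  cintegrable (fun x => f x + g x).
Proof.
move=> [mf foo] [mg goo].
apply: (@cintegrable_le _ (fun x => cmod (f x) + cmod (g x))).
- exact: cmeasD.
- by apply: measurable_funD; exact: measurable_cmod.
- by move=> x; exact: cmodD.
- under eq_integral do rewrite EFinD.
  rewrite ge0_integralD//.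
  + exact: lte_add_pinfty.
  + by move=> x _; rewrite lee_fin cmod_ge0.
  + by apply/measurable_EFinP; exact: measurable_cmod.
  + by move=> x _; rewrite lee_fin cmod_ge0.
  + by apply/measurable_EFinP; exact: measurable_cmod.
Qed.

Lemma nintZ z f : cmeas f -> nint (fun x => z * f x) = ((cmod z)%:E * nint f)%E.
Proof.
move=> mf; rewrite /nint; under eq_integral do rewrite cmodM EFinM.
rewrite ge0_integralZl//.
- by apply/measurable_EFinP; exact: measurable_cmod.
- by move=> x _; rewrite lee_fin cmod_ge0.
- by rewrite lee_fin cmod_ge0.
Qed.

Lemma cintegrableZ z f : cintegrable f -> cintegrable (fun x => z * f x).
Proof.
move=> [mf foo]; split; first by apply: cmeasM => //; exact: cmeas_cst.
by rewrite nintZ// lte_mul_pinfty// ?lee_fin ?cmod_ge0.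
Qed.

Lemma cintegrable_bounded (b : R -> R[i]) (B : R) f : cmeas b ->
  (forall x, cmod (b x) <= B) -> cintegrable f -> cintegrable (fun x => b x * f x).
Proof.
move=> mb bB [mf foo].
apply: (@cintegrable_le _ (fun x => B * cmod (f x))).
- exact: cmeasM.
- by apply: measurable_funM => //; exact: measurable_cmod.
- by move=> x; rewrite cmodM ler_wpM2r ?cmod_ge0.
- have B0 : 0 <= B by apply: le_trans (bB 0); exact: cmod_ge0.
  under eq_integral do rewrite EFinM.
  rewrite ge0_integralZl//.
  + by rewrite lte_mul_pinfty// ?lee_fin.
  + by apply/measurable_EFinP; exact: measurable_cmod.
  + by move=> x _; rewrite lee_fin cmod_ge0.
Qed.

Lemma cintegrableN f : cintegrable f -> cintegrable (fun x => - f x).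
Proof.
move=> [mf foo]; split; first exact: cmeasN.
by rewrite /nint; under eq_integral do rewrite cmodN.
Qed.

Lemma cintegrableB f g : cintegrable f -> cintegrable g ->
  cintegrable (fun x => f x - g x).
Proof. by move=> *; apply: cintegrableD => //; exact: cintegrableN. Qed.

Lemma cintegrableJ f : cintegrable f -> cintegrable (fun x => (f x)^*).
Proof.
move=> [mf foo]; split; first exact: cmeasJ.
by rewrite /nint; under eq_integral do rewrite cmodJ.
Qed.

Local Notation cint := (cintegral [set: R]).

Lemma eq_cint f g : f =1 g -> cint f = cint g.
Proof. by move=> /funext ->. Qed.

Lemma cintD f g : cintegrable f -> cintegrable g ->
  cint (fun x => f x + g x) = cint f + cint g.
Proof.
move=> fi gi; apply: complexP; rewrite ?ReD ?ImD /=.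
  rewrite -RintegralD//; last 2 first.
    exact: cintegrable_Re.
    exact: cintegrable_Re.
  by apply: eq_Rintegral => x _; rewrite ReD.
rewrite -RintegralD//; last 2 first.
  exact: cintegrable_Im.
  exact: cintegrable_Im.
by apply: eq_Rintegral => x _; rewrite ImD.
Qed.

Lemma cintZ z f : cintegrable f -> cint (fun x => z * f x) = z * cint f.
Proof.
move=> fi; have [ri ii] := (cintegrable_Re fi, cintegrable_Im fi).
have sc (a : R) (h : R -> R) : mu.-integrable [set: R] (EFin \o h) ->
    mu.-integrable [set: R] (EFin \o (fun x => a * h x)).
  by move=> hi; have := @integrableZl _ _ _ mu _ measurableT a _ hi.
apply: complexP; rewrite ?ReM ?ImM /=.
  rewrite -!RintegralZl// -RintegralB//; [|exact: sc..].
  by apply: eq_Rintegral => x _; rewrite ReM.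
rewrite -!RintegralZl// -RintegralD//; [|exact: sc..].
by apply: eq_Rintegral => x _; rewrite ImM.
Qed.

Lemma cintN f : cintegrable f -> cint (fun x => - f x) = - cint f.
Proof.
move=> fi; rewrite -[RHS]mulN1r -cintZ//; apply: eq_cint => x.
by rewrite mulN1r.
Qed.

Lemma cintB f g : cintegrable f -> cintegrable g ->
  cint (fun x => f x - g x) = cint f - cint g.
Proof. by move=> fi gi; rewrite cintD ?cintN//; exact: cintegrableN. Qed.

Lemma cintJ f : cintegrable f -> cint (fun x => (f x)^*) = (cint f)^*.
Proof.
move=> fi; apply: complexP; rewrite ?ReJ ?ImJ /=.
  by apply: eq_Rintegral => x _; rewrite ReJ.
rewrite -mulN1r -RintegralZl//; last exact: cintegrable_Im.
by apply: eq_Rintegral => x _; rewrite ImJ mulN1r.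
Qed.

(* Pair the integral z with z itself: |z|^2 is the integral of Re z Re f + Im z Im f. *)
Lemma cmod_cint f : cintegrable f -> ((cmod (cint f))%:E <= nint f)%E.
Proof.
move=> fi; have [ri ii] := (cintegrable_Re fi, cintegrable_Im fi).
set z := cint f.
have [z0|z0] := eqVneq (cmod z) 0; first by rewrite z0 nint_ge0.
have zp : 0 < cmod z by rewrite lt0r z0 cmod_ge0.
have ni : nint f = (Rintegral mu [set: R] (fun x => cmod (f x)))%:E.
  rewrite /Rintegral fineK// ge0_fin_numE; last exact: nint_ge0.
  by case: fi.
have sc (a : R) (h : R -> R) : mu.-integrable [set: R] (EFin \o h) ->
    mu.-integrable [set: R] (EFin \o (fun x => a * h x)).
  by move=> hi; have := @integrableZl _ _ _ mu _ measurableT a _ hi.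
rewrite ni lee_fin -(ler_pM2l zp) -expr2 sqr_cmod !expr2.
set a := complex.Re z; set b := complex.Im z.
have -> : a * a + b * b =
    Rintegral mu [set: R] (fun x => a * complex.Re (f x) + b * complex.Im (f x)).
  rewrite RintegralD//; [|exact: (sc a _ ri)|exact: (sc b _ ii)].
  by rewrite !RintegralZl.
have ci := cintegrable_cmod fi.
rewrite -RintegralZl//.
apply: le_Rintegral => //.
- exact: (@integrableD _ _ _ mu _ measurableT _ _ (sc a _ ri) (sc b _ ii)).
- exact: (sc (cmod z) _ ci).
move=> x _; rewrite -cmodJ -cmodM; apply: le_trans (cmod_Re _).
by apply: le_trans (ler_norm _); rewrite ReM ReJ ImJ -/a -/b mulNr opprK.
Qed.

Lemma cmod_cint_le f (g : R -> R) (M : R) : cmeas f -> measurable_fun [set: R] g ->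
  (forall x, cmod (f x) <= g x) -> (\int[mu]_x (g x)%:E <= M%:E)%E ->
  cmod (cint f) <= M.
Proof.
move=> mf mg fg gM.
have fi : cintegrable f.
  by apply: (cintegrable_le mf mg fg); apply: le_lt_trans gM _; rewrite ltry.
rewrite -lee_fin; apply: le_trans (cmod_cint fi) _; apply: le_trans gM.
apply: ge0_integral_le => //; first exact: measurable_cmod.
by move=> x; exact: cmod_ge0.
Qed.

Lemma ae_eq_cint f g : cmeas f -> cmeas g ->
  {ae mu, forall x, f x = g x} -> cint f = cint g.
Proof.
move=> [fr fi] [gr gi] fg; rewrite /cintegral /Rintegral.
congr (fine _ +i* fine _).
  apply: ae_eq_integral => //; [exact/measurable_EFinP..|].
  by apply: ae_imply fg => x ->.
apply: ae_eq_integral => //; [exact/measurable_EFinP..|].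
by apply: ae_imply fg => x ->.
Qed.

(** Truncated integrals become integrals over the whole line with an indicator factor, the form in
    which linearity, Fubini and dominated convergence are available here. *)
Lemma cintegral_indic (A : set R) f : measurable A ->
  cintegral A f = cint (fun x => (\1_A x)%:C * f x).
Proof.
move=> mA; rewrite /cintegral; congr (_ +i* _).
  rewrite Rintegral_mkcond; apply: eq_Rintegral => x _.
  rewrite ReM /= mul0r subr0 patchE indicE.
  by case: ifP; rewrite ?mul1r ?mul0r.
rewrite Rintegral_mkcond; apply: eq_Rintegral => x _.
rewrite ImM /= mul0r addr0 patchE indicE.
by case: ifP; rewrite ?mul1r ?mul0r.
Qed.

Lemma cdominated_cvg (F : nat -> R -> R[i]) f (g : R -> R) :
  (forall n, cmeas (F n)) -> cmeas f -> measurable_fun [set: R] g ->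
  (\int[mu]_x (g x)%:E < +oo)%E ->
  (forall n x, cmod (F n x) <= g x) ->
  {ae mu, forall x, cmod (F n x - f x) @[n --> \oo] --> (0 : R)} ->
  cintegrable f ->
  cmod (cint (F n) - cint f) @[n --> \oo] --> (0 : R).
Proof.
move=> mF mf mg goo Fg cF fi.
have Fi n : cintegrable (F n) by exact: (cintegrable_le (mF n) mg).
have dle n : ((cmod (cint (F n) - cint f)%R)%:E <= nint (fun x => F n x - f x)%R)%E.
  by rewrite -cintB//; apply: cmod_cint; exact: cintegrableB.
suff h : nint (fun x => F n x - f x) @[n --> \oo] --> 0%E.
  by apply: squeeze_cvg0 dle h => n; exact: cmod_ge0.
(* Real dominated convergence is applied to the modulus of the difference, with this majorant, so
   that real and imaginary parts need not be treated apart. *)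
have gfi : mu.-integrable [set: R] (EFin \o (fun x => g x + cmod (f x))).
  have := @integrableD _ _ _ mu _ measurableT (EFin \o g) _ _ (cintegrable_cmod fi).
  apply; apply: (integrable_of_le mg mg) => // x.
  by rewrite ger0_norm//; apply: le_trans (Fg 0%N x); exact: cmod_ge0.
have H1 n : measurable_fun [set: R] (fun x => (cmod (F n x - f x))%:E).
  by apply/measurable_EFinP/measurable_cmod; exact: cmeasB.
have H2 : measurable_fun [set: R] (cst 0%E : R -> \bar R) by [].
have H3 : {ae mu, forall x, [set: R] x ->
    (cmod (F n x - f x))%:E @[n --> \oo] --> (cst 0%E : R -> \bar R) x}.
  by apply: ae_imply cF => x h _; apply/cvg_EFinE.
have H4 : {ae mu, forall x (n : nat), [set: R] x ->
    (`|(cmod (F n x - f x)%R)%:E| <= (EFin \o (fun x => g x + cmod (f x))%R) x)%E}.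
  apply: ae_everywhere => x n _ /=; rewrite lee_fin ger0_norm ?cmod_ge0//.
  by rewrite (le_trans (cmodB _ _))// lerD2r.
have [_ _] := @dominated_convergence _ _ _ mu _ measurableT _ _ _ H1 H2 H3 gfi H4.
by rewrite integral0.
Qed.

End complex_integral.

Notation cint := (cintegral setT).

(** * Tonelli and Fubini for real and complex kernels *)

Section product_integrals.
Context {R : realType}.
Local Notation mu := (@lebesgue_measure R).

Lemma measurable_section1 (k : R * R -> R) x :
  measurable_fun [set: R * R] k -> measurable_fun [set: R] (fun y => k (x, y)).
Proof. by move=> mk; exact: (measurableT_comp mk (pair1_measurable x)). Qed.

Lemma measurable_section2 (k : R * R -> R) y :
  measurable_fun [set: R * R] k -> measurable_fun [set: R] (fun x => k (x, y)).
Proof. by move=> mk; exact: (measurableT_comp mk (pair2_measurable y)). Qed.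

Lemma measurable_integral2 (k : R * R -> R) :
  measurable_fun [set: R * R] k -> (forall z, 0 <= k z) ->
  measurable_fun [set: R] (fun x => (\int[mu]_y (k (x, y))%:E)%E).
Proof.
move=> mk k0.
have := @measurable_fun_fubini_tonelli_F _ _ (measurableTypeR R) (measurableTypeR R) R mu (EFin \o k).
by apply; [exact/measurable_EFinP|move=> z; rewrite lee_fin].
Qed.

Lemma tonelli (k : R * R -> R) :
  measurable_fun [set: R * R] k -> (forall z, 0 <= k z) ->
  (\int[mu]_x \int[mu]_y (k (x, y))%:E = \int[mu]_y \int[mu]_x (k (x, y))%:E)%E.
Proof.
move=> mk k0.
have := @fubini_tonelli _ _ (measurableTypeR R) (measurableTypeR R) R mu mu (EFin \o k).
by apply; [exact/measurable_EFinP|move=> z; rewrite lee_fin].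
Qed.

(** The integrals of the positive and negative parts are measurable with values in [\bar R],
    infinite values included, and [fine] preserves measurability. Transforms and convolutions are
    thus measurable before any bound on them is known. *)
Lemma measurable_Rintegral2 (k : R * R -> R) :
  measurable_fun [set: R * R] k ->
  measurable_fun [set: R] (fun x => Rintegral mu [set: R] (fun y => k (x, y))).
Proof.
move=> mk; apply: measurableT_comp; first exact: fine_measurable.
have mk' : measurable_fun [set: R * R] (EFin \o k) by exact/measurable_EFinP.
have P := @measurable_fun_fubini_tonelli_F _ _ (measurableTypeR R) (measurableTypeR R) R mu
  _ (measurable_funepos mk') (fun z => funepos_ge0 _ z).
have N := @measurable_fun_fubini_tonelli_F _ _ (measurableTypeR R) (measurableTypeR R) R mu
  _ (measurable_funeneg mk') (fun z => funeneg_ge0 _ z).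
apply: eq_measurable_fun (emeasurable_funB P N) => x _.
rewrite [RHS]integralE /fubini_F; congr (_ - _)%E.
  by apply: eq_integral => y _; rewrite !funeposE.
by apply: eq_integral => y _; rewrite !funenegE.
Qed.

Lemma cmeas_cint (K : R * R -> R[i]) : cmeas K ->
  cmeas (fun x => cint (fun y => K (x, y))).
Proof.
move=> [Kr Ki]; split => /=.
  exact: (measurable_Rintegral2 Kr).
exact: (measurable_Rintegral2 Ki).
Qed.

Lemma Rfubini (k : R * R -> R) : measurable_fun [set: R * R] k ->
  (\int[mu]_x \int[mu]_y `|k (x, y)|%:E < +oo)%E ->
  Rintegral mu [set: R] (fun x => Rintegral mu [set: R] (fun y => k (x, y))) =
  Rintegral mu [set: R] (fun y => Rintegral mu [set: R] (fun x => k (x, y))).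
Proof.
move=> mk koo.
have ik : (mu \x mu)%E.-integrable [set: R * R] (EFin \o k).
  by apply/(integrable12ltyP mu mu) => //; exact/measurable_EFinP.
rewrite /Rintegral; congr fine.
(* [Rintegral] takes [fine] of the inner integral, which is finite only almost everywhere; [fF]
   restores the extended value under the outer integral. *)
have fF (h : R -> \bar R) : mu.-integrable [set: R] h ->
    (\int[mu]_x (fine (h x))%:E = \int[mu]_x h x)%E.
  move=> ih; have mh : measurable_fun [set: R] h := measurable_int _ ih.
  apply: ae_eq_integral => //.
    apply/measurable_EFinP.
    exact: (measurableT_comp (fine_measurable measurableT) mh).
  have := integrable_ae measurableT ih.
  by apply: ae_imply => x hx _; rewrite fineK// hx.
have msw : measurable_fun [set: R * R] (fun z => k (z.2, z.1)).
  exact: (measurableT_comp mk (measurable_fun_pair measurable_snd measurable_fst)).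
have ik' : (mu \x mu)%E.-integrable [set: R * R] (EFin \o (fun z => k (z.2, z.1))).
  apply/(integrable12ltyP mu mu); first exact/measurable_EFinP.
  have := @tonelli (fun z => `|k z|) (measurableT_comp (@normr_measurable R setT) mk)
    (fun z => normr_ge0 _).
  by move=> <-.
have F1 := integrable_fubini_F ik; have G1 := integrable_fubini_F ik'.
rewrite (fF _ F1) (fF _ G1).
exact: (Fubini ik).
Qed.

Lemma cfubini (K : R * R -> R[i]) : cmeas K ->
  (\int[mu]_x \int[mu]_y (cmod (K (x, y)))%:E < +oo)%E ->
  cint (fun x => cint (fun y => K (x, y))) = cint (fun y => cint (fun x => K (x, y))).
Proof.
move=> mK Koo; have mcK := measurable_cmod mK; case: mK => Kr Ki.
have le2 (k : R * R -> R) : measurable_fun [set: R * R] k ->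
    (forall z, `|k z| <= cmod (K z)) ->
    (\int[mu]_x \int[mu]_y `|k (x, y)|%:E < +oo)%E.
  move=> mk kK; apply: le_lt_trans Koo.
  have mnk : measurable_fun [set: R * R] (fun z => `|k z|) by exact: measurableT_comp.
  apply: ge0_le_integral => //.
  - by move=> x _; apply: integral_ge0 => y _; rewrite lee_fin.
  - exact: (measurable_integral2 mnk (fun z => normr_ge0 _)).
  - exact: (measurable_integral2 mcK (fun z => cmod_ge0 _)).
  move=> x _; apply: ge0_integral_le => //.
  - exact: (measurable_section1 x mnk).
  - exact: (measurable_section1 x mcK).
apply: complexP => /=.
  exact: (Rfubini Kr (le2 _ Kr (fun z => cmod_Re (K z)))).
exact: (Rfubini Ki (le2 _ Ki (fun z => cmod_Im (K z)))).
Qed.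

End product_integrals.

(** * Translation, reflection and dilation of Lebesgue measure *)

Section invariance.
Context {R : realType}.
Local Notation mu := (@lebesgue_measure R).

(** The pushforward by a translation agrees with Lebesgue measure on half-open intervals, which
    determine it. *)
Lemma integral_shift (f : R -> \bar R) (a : R) :
  measurable_fun [set: R] f -> (forall x, 0 <= f x)%E ->
  (\int[mu]_x f (x + a)%R = \int[mu]_x f x)%E.
Proof.
move=> mf f0.
have mphi : measurable_fun [set: R] (fun x : R => x + a : measurableTypeR R).
  exact: measurable_funD.
have E A : measurable A -> pushforward mu (fun x : R => x + a : measurableTypeR R) A = mu A.
  move=> mA; apply/esym/lebesgue_measure_unique => //= _ [[b c]] _ <-.
  rewrite /pushforward (_ : _ @^-1` _ = `]b - a, c - a]%classic).
    rewrite !lebesgue_measure_itv/= !lte_fin ltrD2r.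
    by case: ifP => // _; rewrite -!EFinB; congr EFin; ring.
  apply/seteqP; split => x /=; rewrite !in_itv/= ltrBlDr lerBrDr//.
have := @ge0_integral_pushforward _ _ (measurableTypeR R) (measurableTypeR R) R _ mphi mu setT f measurableT mf
  (fun x _ => f0 x).
rewrite preimage_setT => <-; apply: eq_measure_integral => A mA _; exact: E.
Qed.

Lemma integral_opp (f : R -> \bar R) :
  measurable_fun [set: R] f -> (forall x, 0 <= f x)%E ->
  (\int[mu]_x f (- x)%R = \int[mu]_x f x)%E.
Proof.
move=> mf f0.
have mphi : measurable_fun [set: R] (fun x : R => - x : measurableTypeR R).
  exact: measurable_funN.
have := @ge0_integral_pushforward _ _ (measurableTypeR R) (measurableTypeR R) R _ mphi mu setT f measurableT mf
  (fun x _ => f0 x).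
rewrite preimage_setT => <-; apply: eq_measure_integral => A mA _.
exact: lebesgue_measureN.
Qed.

Lemma integral_scale (f : R -> \bar R) (a : R) : 0 < a ->
  measurable_fun [set: R] f -> (forall x, 0 <= f x)%E ->
  (\int[mu]_x f (a * x)%R = a^-1%:E * \int[mu]_x f x)%E.
Proof.
move=> a0 mf f0.
have mphi : measurable_fun [set: R] (fun x : R => a * x : measurableTypeR R).
  exact: measurable_funM.
have a0' : 0 <= a^-1 by rewrite invr_ge0 ltW.
pose nu := pushforward mu (fun x : R => a * x : measurableTypeR R).
have E A : measurable A -> nu A = mscale (NngNum a0') mu A.
  (* Uniqueness characterises Lebesgue measure itself, so it is applied to [a] times the pushforward
     and the factor is inverted afterwards. *)
  move=> mA; have : mu A = (a%:E * nu A)%E.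
    have aa : 0 <= a by exact: ltW.
    pose nu' : {measure set (measurableTypeR R) -> \bar R} :=
      measure_function_pushforward__canonical__measure_function_Measure mu mphi.
    change (mu A = mscale (NngNum aa) nu' A).
    apply: lebesgue_measure_unique => //= _ [[b c]] _ <-.
    transitivity (a%:E * mu [set` `](b / a)%R, (c / a)%R]])%E.
      rewrite !lebesgue_measure_itv/= !lte_fin ltr_pM2r ?invr_gt0//.
      case: ifP => _; last by rewrite mule0.
      by rewrite -!EFinB -EFinM -mulrBl mulrC divfK// gt_eqF.
    congr (_ * mu _)%E; apply/seteqP.
    by split => x /=; rewrite !in_itv/= ltr_pdivrMr// ler_pdivlMr// mulrC.
  move=> H; change (nu A = (a^-1)%:E * mu A)%E.
  by rewrite H muleA -EFinM mulVf ?gt_eqF// mul1e.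
have := @ge0_integral_pushforward _ _ (measurableTypeR R) (measurableTypeR R) R _ mphi mu setT f measurableT mf
  (fun x _ => f0 x).
rewrite preimage_setT => <-.
rewrite -(ge0_integral_mscale mu measurableT (NngNum a0') mf); last by move=> x _.
by apply: eq_measure_integral => A mA _; exact: E.
Qed.

End invariance.

(** * The space L^2 *)

Section L2_norm.
Context {R : realType}.
Local Notation mu := (@lebesgue_measure R).
Implicit Types (f g : R -> R[i]) (z : R[i]).

Definition L2sq f : \bar R := (\int[mu]_x (cmod (f x) ^+ 2)%:E)%E.

Lemma L2sq_ge0 f : (0 <= L2sq f)%E.
Proof. by apply: integral_ge0 => x _; rewrite lee_fin sqr_ge0. Qed.

Lemma measurable_cmod2 f : cmeas f ->
  measurable_fun [set: R] (fun x => cmod (f x) ^+ 2).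
Proof. by move=> mf; apply: measurable_funX; exact: measurable_cmod. Qed.

Lemma Lnorm2E (r : R -> R) :
  Lnorm mu 2%:E (EFin \o r) = poweR (\int[mu]_x ((r x) ^+ 2)%:E)%E 2^-1.
Proof.
rewrite unlock /Lnorm; congr poweR; apply: eq_integral => x _ /=.
by rewrite ?poweR_EFin powR_mulrn// real_normK ?num_real.
Qed.

Lemma L2normE f : L2norm f = poweR (L2sq f) 2^-1.
Proof. exact: (@Lnorm2E (fun x => cmod (f x))). Qed.

Lemma L2norm_ge0 f : (0 <= L2norm f)%E.
Proof. by rewrite L2normE poweR_ge0. Qed.

Lemma L2norm_lty f : (L2norm f < +oo)%E <-> (L2sq f < +oo)%E.
Proof.
rewrite L2normE; split; last exact: poweR_lty.
by apply: lty_poweRy; rewrite invr_neq0.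
Qed.

Lemma ge0_poweR_le (x y : \bar R) : (0 <= x)%E -> (x <= y)%E ->
  (poweR x 2^-1 <= poweR y 2^-1)%E.
Proof.
move=> x0 xy; apply: gt0_ler_poweR => //.
  by rewrite in_itv/= x0 leey.
by rewrite in_itv/= (le_trans x0 xy) leey.
Qed.

Lemma poweR_sqr (C : R) : 0 <= C -> poweR (C ^+ 2)%:E 2^-1 = C%:E.
Proof. by move=> C0; rewrite poweR_EFin powR12_sqrt ?sqr_ge0// sqrtr_sqr ger0_norm. Qed.

Lemma L2norm_le (C : R) f g : 0 <= C ->
  (L2sq f <= (C ^+ 2)%:E * L2sq g)%E -> (L2norm f <= C%:E * L2norm g)%E.
Proof.
move=> C0 h; rewrite !L2normE -(poweR_sqr C0) -poweRM ?L2sq_ge0//.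
  by apply: ge0_poweR_le => //; exact: L2sq_ge0.
by rewrite lee_fin sqr_ge0.
Qed.

Lemma L2sq_norm f : L2sq f = (L2norm f * L2norm f)%E.
Proof.
rewrite L2normE; have := L2sq_ge0 f; case: (L2sq f) => [r| |]//=.
- rewrite lee_fin => r0; rewrite -EFinM powR12_sqrt// -expr2 sqr_sqrtr//.
- by move=> _; rewrite invr_eq0 (negbTE (_ : 2 != 0))//= mulyy.
Qed.

Lemma L2norm_mono f g : cmeas f -> cmeas g ->
  (forall x, cmod (f x) <= cmod (g x)) -> (L2norm f <= L2norm g)%E.
Proof.
move=> mf mg fg; rewrite !L2normE; apply: ge0_poweR_le; first exact: L2sq_ge0.
apply: ge0_integral_le.
- exact: measurable_cmod2.
- exact: measurable_cmod2.
- by move=> x; exact: sqr_ge0.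
- by move=> x; rewrite ler_pXn2r ?nnegrE ?cmod_ge0.
Qed.

Lemma L2normD f g : cmeas f -> cmeas g ->
  (L2norm (fun x => f x + g x)%R <= L2norm f + L2norm g)%E.
Proof.
move=> mf mg.
have mfg := measurable_funD (measurable_cmod mf) (measurable_cmod mg).
apply: (@le_trans _ _ (Lnorm mu 2%:E (EFin \o ((fun x => cmod (f x)) \+ (fun x => cmod (g x)))%R))%E).
  rewrite L2normE Lnorm2E; apply: ge0_poweR_le; first exact: L2sq_ge0.
  apply: ge0_integral_le.
  - by apply: measurable_cmod2; exact: cmeasD.
  - exact: measurable_funX.
  - by move=> x; exact: sqr_ge0.
  - by move=> x; rewrite ler_pXn2r ?nnegrE ?addr_ge0 ?cmod_ge0// cmodD.
by apply: minkowski_EFin; [exact: measurable_cmod..|rewrite ler1n].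
Qed.

Lemma eq_L2norm f g : (forall x, cmod (f x) = cmod (g x)) -> L2norm f = L2norm g.
Proof. by move=> h; rewrite /L2norm; congr Lnorm; apply/funext => x; rewrite h. Qed.

Lemma L2normN f : L2norm (fun x => - f x) = L2norm f.
Proof. by apply: eq_L2norm => x; rewrite cmodN. Qed.

Lemma L2normBC f g : L2norm (fun x => f x - g x) = L2norm (fun x => g x - f x).
Proof. by apply: eq_L2norm => x; rewrite cmodBC. Qed.

Lemma L2norm_dist f g h : cmeas f -> cmeas g -> cmeas h ->
  (L2norm (fun x => f x - h x)%R <=
   L2norm (fun x => f x - g x)%R + L2norm (fun x => g x - h x)%R)%E.
Proof.
move=> mf mg mh; apply: le_trans (L2normD (cmeasB mf mg) (cmeasB mg mh)).
by rewrite le_eqVlt; apply/orP; left; apply/eqP/eq_L2norm => x; rewrite subrKA.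
Qed.

Lemma L2normZ z f : cmeas f -> L2norm (fun x => z * f x) = ((cmod z)%:E * L2norm f)%E.
Proof.
move=> mf; rewrite !L2normE -(poweR_sqr (cmod_ge0 z)) -poweRM ?L2sq_ge0 ?lee_fin ?sqr_ge0//.
congr poweR; rewrite /L2sq -ge0_integralZl ?lee_fin ?sqr_ge0//.
- by apply: eq_integral => x _; rewrite cmodM exprMn.
- by apply/measurable_EFinP; exact: measurable_cmod2.
- by move=> x _; rewrite lee_fin sqr_ge0.
Qed.

Lemma L2norm0 : L2norm (fun=> 0 : R[i]) = 0%E.
Proof.
rewrite L2normE /L2sq; under eq_integral do rewrite cmod0 expr0n/=.
by rewrite integral0 poweR0r// invr_neq0.
Qed.

Lemma ae_eq_L2norm f g : cmeas f -> cmeas g -> {ae mu, forall x, f x = g x} ->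
  L2norm f = L2norm g.
Proof.
move=> mf mg fg; rewrite !L2normE; congr poweR.
apply: ge0_ae_eq_integral => //.
- by apply/measurable_EFinP; exact: measurable_cmod2.
- by apply/measurable_EFinP; exact: measurable_cmod2.
- by move=> x _; rewrite lee_fin sqr_ge0.
- by move=> x _; rewrite lee_fin sqr_ge0.
- by apply: ae_imply fg => x ->.
Qed.

Lemma L2norm_eq0 f : cmeas f -> L2norm f = 0%E -> {ae mu, forall x, f x = 0}.
Proof.
move=> mf f0.
have : (\int[mu]_(x in setT) `|(cmod (f x) ^+ 2)%:E| = 0)%E.
  rewrite -[RHS](_ : L2sq f = 0%E); last by rewrite L2sq_norm f0 mul0e.
  by apply: eq_integral => x _; rewrite /= ger0_norm ?sqr_ge0.
move/(ae_eq_integral_abs mu measurableT).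
have m2 : measurable_fun [set: R] (fun x => (cmod (f x) ^+ 2)%:E).
  by apply/measurable_EFinP; exact: measurable_cmod2.
move=> /(_ m2); apply: ae_imply => x /(_ I)/= [] /eqP.
by rewrite expf_eq0/= => /eqP/cmod_eq0.
Qed.

Lemma inL2P f : inL2 f <-> cmeas f /\ (L2norm f < +oo)%E.
Proof. by split=> [[? ? ?]|[[? ?] ?]]. Qed.

Lemma inL2_cmeas f : inL2 f -> cmeas f.
Proof. by case/inL2P. Qed.

Lemma inL2_lty f : inL2 f -> (L2norm f < +oo)%E.
Proof. by case/inL2P. Qed.

Lemma inL2D f g : inL2 f -> inL2 g -> inL2 (fun x => f x + g x).
Proof.
move=> /inL2P[mf foo] /inL2P[mg goo]; apply/inL2P; split; first exact: cmeasD.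
by apply: le_lt_trans (L2normD mf mg) _; rewrite lte_add_pinfty.
Qed.

Lemma inL2Z z f : inL2 f -> inL2 (fun x => z * f x).
Proof.
move=> /inL2P[mf foo]; apply/inL2P; split.
  by apply: cmeasM => //; exact: cmeas_cst.
by rewrite L2normZ// lte_mul_pinfty// ?lee_fin ?cmod_ge0.
Qed.

Lemma inL2N f : inL2 f -> inL2 (fun x => - f x).
Proof.
move=> /inL2P[mf foo]; apply/inL2P; split; first exact: cmeasN.
by rewrite L2normN.
Qed.

Lemma inL2B f g : inL2 f -> inL2 g -> inL2 (fun x => f x - g x).
Proof. by move=> *; apply: inL2D => //; exact: inL2N. Qed.

Lemma inL2_0 : inL2 (fun=> 0 : R[i]).
Proof.
apply/inL2P; split; first exact: cmeas_cst.
by rewrite L2norm0.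
Qed.

Lemma inL2_le f g : cmeas f -> inL2 g -> (forall x, cmod (f x) <= cmod (g x)) ->
  inL2 f.
Proof.
move=> mf /inL2P[mg goo] fg; apply/inL2P; split => //.
by apply: le_lt_trans goo; exact: L2norm_mono.
Qed.

Lemma L2_bounded (b : R -> R[i]) (B : R) f : cmeas b ->
  (forall x, cmod (b x) <= B) -> cmeas f ->
  (L2norm (fun x => b x * f x)%R <= B%:E * L2norm f)%E.
Proof.
move=> mb bB mf; have B0 : 0 <= B by apply: le_trans (bB 0); exact: cmod_ge0.
rewrite -[B in (B%:E)%E]ger0_norm// -cmod_real -L2normZ//.
apply: L2norm_mono; first exact: cmeasM.
  by apply: cmeasM => //; exact: cmeas_cst.
by move=> x; rewrite !cmodM cmod_real ger0_norm// ler_wpM2r ?cmod_ge0.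
Qed.

Lemma inL2_bounded (b : R -> R[i]) (B : R) f : cmeas b ->
  (forall x, cmod (b x) <= B) -> inL2 f -> inL2 (fun x => b x * f x).
Proof.
move=> mb bB /inL2P[mf foo]; apply/inL2P; split; first exact: cmeasM.
apply: le_lt_trans (L2_bounded mb bB mf) _; rewrite lte_mul_pinfty// ?lee_fin.
by apply: le_trans (bB 0); exact: cmod_ge0.
Qed.

Lemma cauchy_schwarz f g : cmeas f -> cmeas g ->
  (nint (fun x => f x * g x)%R <= L2norm f * L2norm g)%E.
Proof.
move=> mf mg.
have := @hoelder _ _ _ mu (fun x => cmod (f x)) (fun x => cmod (g x)) 2 2
  (measurable_cmod mf) (measurable_cmod mg).
rewrite -/(L2norm f) -/(L2norm g) => h; apply: le_trans (h _ _ _) => //; last by field.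
rewrite Lnorm1 le_eqVlt; apply/orP; left; apply/eqP.
by apply: eq_integral => x _ /=; rewrite cmodM ger0_norm// mulr_ge0 ?cmod_ge0.
Qed.

Lemma inL2_mul_cintegrable f g : inL2 f -> inL2 g -> cintegrable (fun x => f x * g x).
Proof.
move=> /inL2P[mf foo] /inL2P[mg goo]; split; first exact: cmeasM.
apply: le_lt_trans (cauchy_schwarz mf mg) _.
by rewrite lte_mul_pinfty// ?L2norm_ge0// ge0_fin_numE ?L2norm_ge0.
Qed.

Lemma L2_pairing_cvg (F : nat -> R -> R[i]) f g :
  (forall n, inL2 (F n)) -> inL2 f -> inL2 g ->
  L2norm (fun x => F n x - f x) @[n --> \oo] --> (0%E : \bar R) ->
  cmod (cint (fun x => F n x * g x) - cint (fun x => f x * g x)) @[n --> \oo] --> (0 : R).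
Proof.
move=> LF Lf Lg Ff.
apply: (@squeeze_cvg0 _ _ _ _ _ (fun n => L2norm (fun x => F n x - f x)%R * L2norm g)%E).
- by move=> n; exact: cmod_ge0.
- move=> n; rewrite -cintB; [|exact: inL2_mul_cintegrable..].
  have LFf := inL2B (LF n) Lf.
  under [in leLHS]eq_cint do rewrite -mulrBl.
  apply: le_trans (cmod_cint (inL2_mul_cintegrable LFf Lg)) _.
  by apply: cauchy_schwarz; exact: inL2_cmeas.
- have gfin : L2norm g \is a fin_num by rewrite ge0_fin_numE ?L2norm_ge0// inL2_lty.
  by rewrite -(mul0e (L2norm g)); apply: cvgeZr.
Qed.

End L2_norm.

(** * Passing to the limit in L^2 *)

Section L2_convergence.
Context {R : realType}.
Local Notation mu := (@lebesgue_measure R).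
Implicit Types (f g : R -> R[i]).

Lemma limn_einf_le (u : nat -> \bar R) (C : \bar R) :
  (forall n, (u n <= C)%E) -> (limn_einf u <= C)%E.
Proof.
move=> uC; rewrite limn_einf_lim; apply: lime_le; first exact: is_cvg_einfs.
apply: nearW => n; apply: le_trans (uC n).
by apply: ereal_inf_lbound; exists n => //=.
Qed.

Lemma cmod_cvg (u : nat -> R[i]) l : cmod (u n - l) @[n --> \oo] --> (0 : R) ->
  cmod (u n) @[n --> \oo] --> cmod l.
Proof.
move=> ul; apply/cvgrPdist_le => e e0.
move/cvgrPdist_le : ul => /(_ e e0); apply: filterS => n.
rewrite sub0r normrN ger0_norm ?cmod_ge0// => une.
rewrite ler_norml; apply/andP; split.
  have := cmodD (u n - l) l; rewrite subrK; lra.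
have := cmodB (u n) (u n - l); rewrite opprB addrC subrK; lra.
Qed.

(** Fatou's lemma for the squares. It serves where the limit is not yet known to be square
    integrable: completeness, Bessel's inequality, and the comparison of norm limits with pointwise
    limits. *)
Lemma L2_fatou (F : nat -> R -> R[i]) f (C : \bar R) :
  (forall n, cmeas (F n)) -> cmeas f ->
  {ae mu, forall x, cmod (F n x - f x) @[n --> \oo] --> (0 : R)} ->
  (forall n, (L2norm (F n) <= C)%E) -> (L2norm f <= C)%E.
Proof.
move=> mF mf Ff FC.
have C0 : (0 <= C)%E by apply: le_trans (FC 0%N); exact: L2norm_ge0.
have mF2 n : measurable_fun [set: R] (fun x => (cmod (F n x) ^+ 2)%:E).
  by apply/measurable_EFinP; exact: measurable_cmod2.
have F20 n x : [set: R] x -> (0 <= (cmod (F n x) ^+ 2)%:E)%E.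
  by rewrite lee_fin sqr_ge0.
have := @fatou _ _ _ mu _ measurableT (fun n x => (cmod (F n x) ^+ 2)%:E) mF2 F20.
have -> : (\int[mu]_x limn_einf (fun n => (cmod (F n x) ^+ 2)%:E) = L2sq f)%E.
  apply: ae_eq_integral => //.
  (* The liminf is written as minus the limsup of the negatives to obtain its measurability. *)
  - rewrite (_ : (fun x => _) = (fun x => - limn_esup (fun n => - (cmod (F n x) ^+ 2)%:E))%E).
      apply: measurableT_comp => //.
      apply: measurable_fun_limn_esup => n.
      by apply: measurableT_comp (mF2 n).
    by apply/funext => x; rewrite limn_esupN oppeK.
  - by apply/measurable_EFinP; exact: measurable_cmod2.
  - apply: ae_imply Ff => x /cmod_cvg h _.
    rewrite (@cvg_limn_einf_sup _ _ (cmod (f x) ^+ 2)%:E)//.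
    by apply/cvg_EFinE; rewrite expr2; under eq_fun do rewrite expr2; exact: cvgM.
move=> h; rewrite L2normE.
have -> : C = poweR (C * C)%E 2^-1.
  move: C0; case: {FC} C => [r| |]//=.
    by rewrite lee_fin => r0; rewrite -expr2 -poweR_EFin poweR_sqr.
  by rewrite ?mulyy /= invr_eq0 (negbTE (_ : 2 != 0)).
apply: ge0_poweR_le; first exact: L2sq_ge0.
apply: le_trans h _; apply: limn_einf_le => n.
rewrite -[leLHS]/(L2sq (F n)) L2sq_norm.
by apply: lee_pmul; rewrite ?L2norm_ge0.
Qed.

Lemma L2_dominated_ae (F : nat -> R -> R[i]) f (g : R -> R[i]) :
  (forall n, cmeas (F n)) -> cmeas f -> inL2 g ->
  {ae mu, forall x, forall n, cmod (F n x) <= cmod (g x)} ->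
  {ae mu, forall x, cmod (F n x - f x) @[n --> \oo] --> (0 : R)} ->
  L2norm (fun x => F n x - f x) @[n --> \oo] --> (0%E : \bar R).
Proof.
move=> mF mf Lg Fg Ff; have mg := inL2_cmeas Lg.
suff h : L2sq (fun x => F n x - f x) @[n --> \oo] --> (0%E : \bar R).
  have [hfin hcvg] := (@fine_cvgP _ _ _ _ _ 0).1 h.
  apply/(@fine_cvgP _ _ _ _ _ 0); split.
    by apply: filterS hfin => n hn; rewrite L2normE; exact: fin_num_poweR.
  rewrite -(@sqrtr0 R); move/(continuous_cvg _ (@sqrt_continuous R 0)) : hcvg.
  apply: cvg_trans; apply: near_eq_cvg; apply: nearW => n /=.
  by rewrite L2normE fine_poweR powR12_sqrt// fine_ge0// L2sq_ge0.
have fg : {ae mu, forall x, cmod (f x) <= cmod (g x)}.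
  apply: ae_imply2 Ff Fg => x /cmod_cvg h Fgx.
  by apply: (cvgr_to_le h); apply: nearW => n; exact: Fgx.
have m2 n : measurable_fun [set: R] (fun x => (cmod (F n x - f x) ^+ 2)%:E).
  by apply/measurable_EFinP; apply: measurable_cmod2; exact: cmeasB.
(* The limit inherits the bound by [g] ([fg]), so the difference is at most 2 |g| and its square at
   most 4 |g|^2. *)
have ig : mu.-integrable [set: R] (fun x => (4 * cmod (g x) ^+ 2)%:E).
  have ig : mu.-integrable [set: R] (EFin \o (fun x => cmod (g x) ^+ 2)).
    apply: (integrable_of_le (measurable_cmod2 mg) (measurable_cmod2 mg)).
      by move=> x; rewrite ger0_norm ?sqr_ge0.
    by apply/L2norm_lty; exact: inL2_lty.
  exact: (@integrableZl _ _ _ mu _ measurableT 4 _ ig).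
have H3 : {ae mu, forall x, [set: R] x ->
    (cmod (F n x - f x) ^+ 2)%:E @[n --> \oo] --> (cst 0%E : R -> \bar R) x}.
  apply: ae_imply Ff => x h _; apply/cvg_EFinE.
  under eq_fun do rewrite expr2.
  by rewrite -(mulr0 0); exact: cvgM.
have H4 : {ae mu, forall x (n : nat), [set: R] x ->
    (`|(cmod (F n x - f x)%R ^+ 2)%:E| <= (4 * cmod (g x) ^+ 2)%:E)%E}.
  apply: ae_imply2 fg Fg => x fgx Fgx n _ /=; rewrite lee_fin ger0_norm ?sqr_ge0//.
  have := cmodB (F n x) (f x); have := Fgx n.
  have := cmod_ge0 (F n x - f x); nra.
have [_ _] := @dominated_convergence _ _ _ mu _ measurableT _ _ _ m2
  (measurable_cst _) H3 ig H4.
by rewrite integral0.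
Qed.

Lemma L2_dominated (F : nat -> R -> R[i]) f (g : R -> R[i]) :
  (forall n, cmeas (F n)) -> cmeas f -> inL2 g ->
  (forall n x, cmod (F n x) <= cmod (g x)) ->
  {ae mu, forall x, cmod (F n x - f x) @[n --> \oo] --> (0 : R)} ->
  L2norm (fun x => F n x - f x) @[n --> \oo] --> (0%E : \bar R).
Proof. by move=> mF mf Lg Fg; apply: L2_dominated_ae Lg _ => //; apply: ae_everywhere. Qed.

Lemma L2_lim_unique (F : nat -> R -> R[i]) f g :
  (forall n, cmeas (F n)) -> cmeas f -> cmeas g ->
  L2norm (fun x => F n x - f x) @[n --> \oo] --> (0%E : \bar R) ->
  L2norm (fun x => F n x - g x) @[n --> \oo] --> (0%E : \bar R) ->
  {ae mu, forall x, f x = g x}.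
Proof.
move=> mF mf mg Ff Fg.
have mfg := cmeasB mf mg.
suff : L2norm (fun x => f x - g x) = 0%E.
  by move=> /(L2norm_eq0 mfg); apply: ae_imply => x /subr0_eq.
apply/eqP; rewrite eq_le L2norm_ge0 andbT.
have h : (L2norm (fun x => F n x - f x)%R + L2norm (fun x => F n x - g x)%R)%E
    @[n --> \oo] --> (0%E : \bar R).
  by rewrite -(adde0 0%E); exact: cvgeD.
apply: (cvge_to_ge h); apply: nearW => n.
by rewrite (L2normBC (F n) f); exact: L2norm_dist.
Qed.

(** Here [g] may a priori fail to be square integrable: Fatou's lemma, applied to [f - F n] along a
    tail of the sequence, bounds the norm of [f - g] by every positive e. In the main argument [g]
    is |x|^alpha U(t) u0. *)
Lemma L2_lim_ae (F : nat -> R -> R[i]) f g :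
  (forall n, cmeas (F n)) -> cmeas f -> cmeas g ->
  L2norm (fun x => F n x - f x) @[n --> \oo] --> (0%E : \bar R) ->
  {ae mu, forall x, cmod (F n x - g x) @[n --> \oo] --> (0 : R)} ->
  {ae mu, forall x, f x = g x}.
Proof.
move=> mF mf mg Ff Fg; have mfg := cmeasB mf mg.
suff : L2norm (fun x => f x - g x) = 0%E.
  by move=> /(L2norm_eq0 mfg); apply: ae_imply => x /subr0_eq.
apply/eqP; rewrite eq_le L2norm_ge0 andbT.
apply/lee_addgt0Pr => e e0; rewrite add0e.
have /fine_cvgP[[N1 _ hN1] /cvgrPdist_le/(_ _ e0)[N2 _ hN2]] := Ff.
(* Beyond [N1] the norms are finite, beyond [N2] their real values are at most e. *)
pose N := maxn N1 N2.
apply: (@L2_fatou (fun n x => f x - F (n + N)%N x)).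
- by move=> n; exact: cmeasB.
- exact: mfg.
- apply: ae_imply Fg => x Fg.
  move: Fg; rewrite -(@cvg_shiftn N); apply: cvg_trans.
  by apply: near_eq_cvg; apply: nearW => n /=; rewrite cmodBC; congr cmod; ring.
- move=> n; rewrite L2normBC.
  have fin := hN1 (n + N)%N (leq_trans (leq_maxl _ _) (leq_addl _ _)).
  rewrite -(fineK fin) lee_fin.
  have := hN2 (n + N)%N (leq_trans (leq_maxr _ _) (leq_addl _ _)).
  by rewrite /= sub0r normrN ger0_norm ?fine_ge0 ?L2norm_ge0.
Qed.

End L2_convergence.

(** * Completeness of L^2 *)

Section L2_completeness.
Context {R : realType}.
Local Notation mu := (@lebesgue_measure R).

Lemma geometric_cvgn (v : nat -> R) (C q : R) : 0 <= C -> 0 <= q < 1 ->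
  (forall k, `|v k.+1 - v k| <= C * q ^+ k) -> cvgn v.
Proof.
move=> C0 /andP[q0 q1] h.
have cs : cvgn (series (telescope v)).
  apply: normed_cvg; apply: (@series_le_cvg _ _ (geometric C q)).
  - by move=> n; exact: normr_ge0.
  - by move=> n; rewrite /geometric/= mulr_ge0// exprn_ge0.
  - by move=> n; exact: h.
  - by apply: is_cvg_geometric_series; rewrite ger0_norm.
have -> : v = (fun n => v 0%N + series (telescope v) n).
  by apply/funext => n; exact: eq_sum_telescope.
by apply: is_cvgD => //; exact: is_cvg_cst.
Qed.

(** The squared increments have integral at most 4^-(k+1). Weighted by 2^(k+1) they still have a
    summable sequence of integrals, so their sum is finite, say equal to M, at almost every x. There
    the k-th increment is at most sqrt M times (1 / sqrt 2)^k, and the sequence converges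
    geometrically. *)
Lemma summable_increments_cvg (u : nat -> R -> R[i]) :
  (forall k, inL2 (u k)) ->
  (forall k, (L2norm (fun x => u k.+1 x - u k x)%R <= (2^-1 ^+ k.+1)%:E)%E) ->
  {ae mu, forall x, cvgn (fun k => complex.Re (u k x)) /\
                    cvgn (fun k => complex.Im (u k x))}.
Proof.
move=> Lu du.
pose D k x := 2 ^+ k.+1 * cmod (u k.+1 x - u k x) ^+ 2.
have D0 k x : 0 <= D k x.
  by apply: mulr_ge0; [exact: exprn_ge0|exact: sqr_ge0].
have mdu k : cmeas (fun x => u k.+1 x - u k x) by apply: cmeasB; exact: inL2_cmeas.
have mD k : measurable_fun [set: R] (fun x => (D k x)%:E).
  apply/measurable_EFinP; apply: measurable_funM => //.
  exact: (measurable_cmod2 (mdu k)).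
have intD k : (\int[mu]_x (D k x)%:E <= (1 / (2 ^ (k + 0.+1))%:R)%:E)%E.
  have m2k : measurable_fun [set: R] (fun x => (cmod (u k.+1 x - u k x) ^+ 2)%:E).
    by apply/measurable_EFinP; exact: (measurable_cmod2 (mdu k)).
  under eq_integral do rewrite EFinM.
  rewrite (@ge0_integralZl _ _ _ mu _ measurableT _ m2k (2 ^+ k.+1)%:E); last 2 first.
  - by move=> x _; rewrite lee_fin sqr_ge0.
  - by rewrite lee_fin exprn_ge0.
  rewrite -[X in (_ * X)%E]/(L2sq (fun x => u k.+1 x - u k x)) L2sq_norm.
  apply: (@le_trans _ _ ((2 ^+ k.+1)%:E * ((2^-1 ^+ k.+1)%:E * (2^-1 ^+ k.+1)%:E))%E).
    by rewrite lee_wpmul2l ?lee_fin ?exprn_ge0// lee_pmul ?L2norm_ge0.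
  rewrite -!EFinM lee_fin mulrA -exprMn divff//.
  by rewrite expr1n !mul1r exprVn natrX addn1.
have sumD : (\int[mu]_x (\sum_(0 <= k <oo) (D k x)%:E) < +oo)%E.
  rewrite integral_nneseries//; last by move=> k x _; rewrite lee_fin.
  apply: (@le_lt_trans _ _ (\sum_(0 <= k <oo) (1 / (2 ^ (k + 0.+1))%:R)%:E)%E).
    by apply: lee_nneseries => // k _ _; apply: integral_ge0 => x _; rewrite lee_fin.
  have /cvg_lim := @cvg_geometric_eseries_half R 1 0.
  by move=> -> //; rewrite ltry.
have iD : mu.-integrable [set: R] (fun x => \sum_(0 <= k <oo) (D k x)%:E)%E.
  apply/integrableP; split.
    exact: (@ge0_emeasurable_sum _ _ _ setT (fun k x => (D k x)%:E) xpredT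
      (fun k x _ _ => D0 k x) (fun k _ => mD k)).
  apply: le_lt_trans sumD; rewrite le_eqVlt; apply/orP; left; apply/eqP.
  apply: eq_integral => x _; rewrite gee0_abs//; apply: nneseries_ge0 => k _ _.
  by rewrite lee_fin.
have := integrable_ae measurableT iD.
apply: ae_imply => x /(_ I) fin.
set M := fine (\sum_(0 <= k <oo) (D k x)%:E)%E.
have DM k : D k x <= M.
  rewrite -lee_fin /M fineK//.
  apply: (@le_trans _ _ (\sum_(0 <= i < k.+1) (D i x)%:E)%E).
    rewrite big_nat_recr//= leeDr// sume_ge0// => i _.
    by rewrite lee_fin.
  by apply: nneseries_lim_ge => n _ _; rewrite lee_fin.
have M0 : 0 <= M by apply: le_trans (DM 0%N).
have q01 : 0 <= Num.sqrt (2^-1 : R) < 1.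
  rewrite sqrtr_ge0/= -[ltRHS]sqrtr1 ltr_sqrt// invf_lt1//; lra.
have cd k : cmod (u k.+1 x - u k x) <= Num.sqrt M * Num.sqrt (2^-1) ^+ k.
  rewrite -(@ler_pXn2r _ 2) ?nnegrE ?cmod_ge0 ?mulr_ge0 ?exprn_ge0 ?sqrtr_ge0//.
  rewrite exprMn sqr_sqrtr// exprAC sqr_sqrtr ?invr_ge0// exprVn ler_pdivlMr ?exprn_gt0//.
  apply: le_trans (DM k); rewrite /D mulrC ler_wpM2r ?sqr_ge0//.
  by rewrite exprS ler_peMl ?exprn_ge0// ler1n.
split; apply: (geometric_cvgn (sqrtr_ge0 M) q01) => k; apply: le_trans (cd k).
  by rewrite -ReN -ReD; exact: cmod_Re.
by rewrite -ImN -ImD; exact: cmod_Im.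
Qed.

(** The limsup of the components, made real by [fine], is measurable everywhere and equals the limit
    wherever there is one. It is used again to show that [Phi] is measurable. *)
Lemma cmeas_ae_lim (u : nat -> R -> R[i]) : (forall k, cmeas (u k)) ->
  exists2 g : R -> R[i], cmeas g & forall x,
    cvgn (fun k => complex.Re (u k x)) /\ cvgn (fun k => complex.Im (u k x)) ->
    cmod (u k x - g x) @[k --> \oo] --> (0 : R).
Proof.
move=> mu_.
pose L (v : nat -> R -> R) x := fine (limn_esup (fun k => (v k x)%:E)).
have mL v : (forall k, measurable_fun [set: R] (v k)) -> measurable_fun [set: R] (L v).
  move=> mv; apply: measurableT_comp; first exact: fine_measurable.
  by apply: measurable_fun_limn_esup => k; exact/measurable_EFinP.
have LE (v : nat -> R -> R) x : cvgn (v^~ x) -> v k x @[k --> \oo] --> L v x.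
  move=> cv; have h : (v k x)%:E @[k --> \oo] --> (limn (v ^~ x))%:E by exact/cvg_EFinE.
  by rewrite /L (cvg_limn_einf_sup h).2.
exists (fun x => L (fun k x => complex.Re (u k x)) x +i* L (fun k x => complex.Im (u k x)) x).
  by split => /=; apply: mL => k; case: (mu_ k).
move=> x [cr ci]; have /= hr := LE (fun k x => complex.Re (u k x)) x cr.
have /= hi := LE (fun k x => complex.Im (u k x)) x ci.
set a := L _ x in hr *; set b := L _ x in hi *.
apply: (@squeeze_cvg0 _ _ _ _ _
  (fun k => (`|complex.Re (u k x) - a| + `|complex.Im (u k x) - b|)%:E)).
- by move=> k; exact: cmod_ge0.
- by move=> k; rewrite lee_fin; apply: le_trans (cmod_le_ReIm _) _; rewrite ReD ImD ReN ImN.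
apply/cvg_EFinE; rewrite -(addr0 0); apply: cvgD.
  by apply/norm_cvg0P; apply/subr_cvg0.
by apply/norm_cvg0P; apply/subr_cvg0.
Qed.

Lemma L2_complete (F : nat -> R -> R[i]) : (forall n, inL2 (F n)) ->
  (forall e, 0 < e -> exists N, forall m n, (N <= m)%N -> (N <= n)%N ->
    (L2norm (fun x => F m x - F n x)%R <= e%:E)%E) ->
  exists2 g, inL2 g & L2norm (fun x => F n x - g x) @[n --> \oo] --> (0%E : \bar R).
Proof.
move=> LF CF; have mF n := inL2_cmeas (LF n).
have /choice[N hN] : forall k, exists N, forall m n, (N <= m)%N -> (N <= n)%N ->
    (L2norm (fun x => F m x - F n x)%R <= (2^-1 ^+ k.+1)%:E)%E.
  by move=> k; apply: CF; rewrite exprn_gt0.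
(* Summing the successors makes [phi] nondecreasing and at least both [N k] and [k] at once,
   whatever the order of the thresholds. *)
pose phi k := (\sum_(j < k.+1) (N j).+1)%N.
have phiN k : (N k <= phi k)%N.
  by rewrite /phi big_ord_recr/=; apply: leq_trans (leq_addl _ _).
have phi_ge k : (k <= phi k)%N.
  rewrite /phi; elim: k => // k IH; rewrite big_ord_recr/= addnS ltnS.
  exact: leq_trans IH (leq_addr _ _).
have phiS k : (phi k <= phi k.+1)%N by rewrite /phi [X in (_ <= X)%N]big_ord_recr/= leq_addr.
have phi_mono k l : (k <= l)%N -> (phi k <= phi l)%N.
  move=> /subnK <-; elim: (l - k)%N => [|j IH]; first by rewrite add0n.
  by rewrite addSn; exact: leq_trans (phiS _).
pose u k := F (phi k).
have [g mg hg] := cmeas_ae_lim (fun k => mF (phi k)).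
have aeg : {ae mu, forall x, cmod (u k x - g x) @[k --> \oo] --> (0 : R)}.
  apply: (ae_imply hg); apply: (@summable_increments_cvg u (fun k => LF _)) => k.
  by apply: hN => //; apply: leq_trans (phiN k) _; exact: phi_mono.
have dist e : 0 < e -> exists N, forall n, (N <= n)%N ->
    (L2norm (fun x => F n x - g x)%R <= e%:E)%E.
  move=> e0; have [N0 hN0] := CF e e0.
  (* The subsequence is started at index N0, so that all its terms lie in the range where the Cauchy
     bound by e holds; Fatou's lemma carries that bound to the limit. *)
  have hK k : (N0 <= phi (k + N0))%N by apply: leq_trans (phi_ge _); exact: leq_addl.
  exists N0 => n Nn; apply: (@L2_fatou _ (fun k x => F n x - u (k + N0)%N x)).
  - by move=> k; apply: cmeasB; exact: mF.
  - by apply: cmeasB.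
  - apply: ae_imply aeg => x; rewrite -(@cvg_shiftn N0); apply: cvg_trans.
    by apply: near_eq_cvg; apply: nearW => k /=; rewrite cmodBC; congr cmod; ring.
  - by move=> k; apply: hN0.
have Lg : inL2 g.
  have [n hn] := dist 1 ltr01.
  have : inL2 (fun x => F n x - (F n x - g x)).
    apply: inL2B => //; apply/inL2P; split; first exact: cmeasB.
    by apply: le_lt_trans (hn n (leqnn n)) _; rewrite ltry.
  by congr inL2; apply/funext => x; ring.
exists g => //; apply/(@fine_cvgP _ _ _ _ _ 0).
have fin n : L2norm (fun x => F n x - g x) \is a fin_num.
  by rewrite ge0_fin_numE ?L2norm_ge0//; apply: inL2_lty; exact: inL2B.
split; first exact: nearW.
apply/cvgrPdist_le => e e0; have [n hn] := dist e e0.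
exists n => // m /= nm; rewrite sub0r normrN ger0_norm ?fine_ge0 ?L2norm_ge0//.
by rewrite -lee_fin fineK//; exact: hn.
Qed.

End L2_completeness.

(** * Gaussians *)

Section signed_invariance.
Context {R : realType}.
Local Notation mu := (@lebesgue_measure R).
Implicit Types (f : R -> R) (F : R -> R[i]).

Lemma Rintegral_opp f : measurable_fun [set: R] f ->
  Rintegral mu [set: R] (fun x => f (- x)) = Rintegral mu [set: R] f.
Proof.
move=> mf; have mf' : measurable_fun [set: R] (EFin \o f) by exact/measurable_EFinP.
rewrite /Rintegral; congr fine; rewrite integralE [RHS]integralE; congr (_ - _)%E.
  rewrite -(integral_opp (measurable_funepos mf') (fun x => funepos_ge0 _ x)).
  by apply: eq_integral => x _; rewrite !funeposE.
rewrite -(integral_opp (measurable_funeneg mf') (fun x => funeneg_ge0 _ x)).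
by apply: eq_integral => x _; rewrite !funenegE.
Qed.

Lemma cint_opp F : cmeas F -> cint (fun x => F (- x)) = cint F.
Proof.
by move=> [mr mi]; rewrite /cintegral (Rintegral_opp mr) (Rintegral_opp mi).
Qed.

Lemma Rintegral_odd f : measurable_fun [set: R] f -> (forall x, f (- x) = - f x) ->
  mu.-integrable [set: R] (EFin \o f) -> Rintegral mu [set: R] f = 0.
Proof.
move=> mf of_ fi; have h := Rintegral_opp mf.
have : Rintegral mu [set: R] (fun x => f (- x)) = - Rintegral mu [set: R] f.
  rewrite -mulN1r -RintegralZl//; apply: eq_Rintegral => x _.
  by rewrite of_ mulN1r.
by rewrite h; lra.
Qed.

End signed_invariance.

Section gaussian.
Context {R : realType}.
Local Notation mu := (@lebesgue_measure R).

(** The parameter is the reciprocal of the standard deviation: as s tends to 0 the function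
    increases to 1 and acts as a convergence factor. *)
Definition gauss (s x : R) : R := expR (- (s ^+ 2 * x ^+ 2) / 2).

Lemma gauss_ge0 s x : 0 <= gauss s x.
Proof. exact: expR_ge0. Qed.

Lemma gauss_le1 s x : gauss s x <= 1.
Proof.
rewrite -[leRHS]expR0 ler_expR; have := sqr_ge0 (s * x); rewrite exprMn; lra.
Qed.

Lemma measurable_gauss s : measurable_fun [set: R] (gauss s).
Proof.
apply: measurableT_comp => //; apply: measurable_funM => //.
apply: measurableT_comp => //; apply: measurable_funM => //.
Qed.

Lemma integral_gauss s : 0 < s ->
  (\int[mu]_x (gauss s x)%:E = (Num.sqrt (2 * pi) / s)%:E)%E.
Proof.
move=> s0; have si0 : s^-1 != 0 by rewrite gt_eqF// invr_gt0.
have pk : normal_peak s^-1 = s / Num.sqrt (2 * pi).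
  rewrite /normal_peak -mulrnAr -mulr_natl sqrtrM ?sqr_ge0// sqrtr_sqr.
  by rewrite gtr0_norm ?invr_gt0// invfM invrK.
have h := @integral_normal_pdf R 0 s^-1.
have e x : normal_pdf 0 s^-1 x = (s / Num.sqrt (2 * pi)) * gauss s x.
  rewrite normal_pdfE// pk /normal_fun /gauss; congr (_ * expR _).
  by rewrite subr0 -mulr_natr; field; rewrite gt_eqF.
have {}h : (\int[mu]_x ((s / Num.sqrt (2 * pi))%:E * (gauss s x)%:E) = 1)%E.
  by rewrite -h; apply: eq_integral => x _; rewrite e EFinM.
have sp : 0 < s / Num.sqrt (2 * pi) by rewrite divr_gt0// sqrtr_gt0 mulr_gt0// pi_gt0.
move: h; rewrite ge0_integralZl//; last 3 first.
- by apply/measurable_EFinP; exact: measurable_gauss.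
- by move=> x _; rewrite lee_fin gauss_ge0.
- by rewrite lee_fin ltW.
move=> h; have a0 : s / Num.sqrt (2 * pi) != 0 by rewrite gt_eqF.
rewrite -[LHS]mul1e (_ : 1%E = (s / Num.sqrt (2 * pi))^-1%:E * (s / Num.sqrt (2 * pi))%:E)%E.
  by rewrite -muleA h mule1 invf_div.
by rewrite -EFinM mulVf.
Qed.

Lemma integrable_gauss s : 0 < s -> mu.-integrable [set: R] (EFin \o gauss s).
Proof.
move=> s0; apply: (integrable_of_le (measurable_gauss s) (measurable_gauss s)).
  by move=> x; rewrite ger0_norm ?gauss_ge0.
by rewrite integral_gauss// ltry.
Qed.

Lemma is_derive_gauss (s x : R) : is_derive x (1 : R) (gauss s) (- (s ^+ 2 * x) * gauss s x).
Proof.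
have dh : is_derive x (1 : R) (fun x : R => - (s ^+ 2 * x ^+ 2) / 2) (- (s ^+ 2 * x)).
  by apply: is_derive_eq; rewrite /GRing.scale/=; field.
by apply: is_derive_eq; rewrite mulrC.
Qed.

(** [gauss s] is the square of [gauss (s / sqrt 2)], and one of the two factors absorbs u = s |x|,
    because exp (u^2 / 4) >= 1 + u^2 / 4 >= u. *)
Lemma gauss_moment s x : 0 < s -> s * `|x| * gauss s x <= gauss (s / Num.sqrt 2) x.
Proof.
move=> s0; have -> : gauss s x = gauss (s / Num.sqrt 2) x * gauss (s / Num.sqrt 2) x.
  rewrite /gauss -expRD; congr expR.
  by rewrite expr_div_n sqr_sqrtr//; field.
rewrite mulrA ler_piMl ?gauss_ge0// /gauss -ler_pdivlMr ?expR_gt0// -expRN mul1r.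
apply: le_trans (expR_ge1Dx _).
rewrite expr_div_n sqr_sqrtr// -[x ^+ 2]real_normK ?num_real//.
have := sqr_ge0 (s * `|x| - 2); rewrite sqrrB exprMn; lra.
Qed.

Lemma integrable_gauss_moment s : 0 < s ->
  mu.-integrable [set: R] (EFin \o (fun x => x * gauss s x)).
Proof.
move=> s0; have s2 : 0 < s / Num.sqrt 2 by rewrite divr_gt0// sqrtr_gt0.
apply: (@integrable_of_le _ _ (fun x => s^-1 * gauss (s / Num.sqrt 2) x)).
- by apply: measurable_funM => //; exact: measurable_gauss.
- by apply: measurable_funM => //; exact: measurable_gauss.
- move=> x; rewrite ler_pdivlMl// normrM (ger0_norm (gauss_ge0 _ _)) mulrA.
  exact: gauss_moment.
- under eq_integral do rewrite EFinM.
  rewrite ge0_integralZl//.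
  + by rewrite integral_gauss// -EFinM ltry.
  + by apply/measurable_EFinP; exact: measurable_gauss.
  + by move=> x _; rewrite lee_fin gauss_ge0.
  + by rewrite lee_fin invr_ge0 ltW.
Qed.

(** The fundamental theorem on [-n, n] followed by dominated convergence; it takes the place of
    integration by parts on the line. *)
Lemma integral_derivative_eq0 (H h : R -> R) :
  (forall x, is_derive x (1 : R) H (h x)) -> continuous h ->
  mu.-integrable [set: R] (EFin \o h) ->
  H n%:R @[n --> \oo] --> (0 : R) -> H (- n%:R) @[n --> \oo] --> (0 : R) ->
  Rintegral mu [set: R] h = 0.
Proof.
move=> dH ch ih Hp Hn.
have mh : measurable_fun [set: R] h by exact: continuous_measurable_fun.
pose F n := (fun x => (h x * \1_(`[- n%:R, n%:R]) x)%:E) : R -> \bar R.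
(* The index is n + 1 because the fundamental theorem is applied on a nondegenerate interval. *)
have FE n : (\int[mu]_x F n.+1 x)%E = (H n.+1%:R - H (- n.+1%:R))%:E.
  transitivity (\int[mu]_(x in [set` `[(- n.+1%:R)%R, n.+1%:R%R]]) (h x)%:E)%E.
    rewrite [RHS]integral_mkcond; apply: eq_integral => x _.
    by rewrite /F patchE indicE; case: ifP => _; rewrite ?mulr1 ?mulr0.
  rewrite (@continuous_FTC2 _ h H)//.
  - by rewrite -subr_gt0 opprK -natrD ltr0n.
  - exact: continuous_subspaceT.
  - split.
    + by move=> x _; have [] := dH x.
    + apply: cvg_at_right_filter; apply: differentiable_continuous.
      by apply/derivable1_diffP; have [] := dH (- n.+1%:R).
    + apply: cvg_at_left_filter; apply: differentiable_continuous.
      by apply/derivable1_diffP; have [] := dH n.+1%:R.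
  - by move=> x _; rewrite derive1E; have [_] := dH x.
have mF n : measurable_fun [set: R] (F n).
  by apply/measurable_EFinP; apply: measurable_funM.
have mhE : measurable_fun [set: R] (EFin \o h) by exact/measurable_EFinP.
have ihn : mu.-integrable [set: R] (fun x => `|h x|%:E).
  by have := integrable_abse ih.
have H3 : {ae mu, forall x, [set: R] x -> F n x @[n --> \oo] --> (EFin \o h) x}.
  apply: ae_everywhere => x _; apply/cvg_EFinE; apply: cvg_near_cst.
  exists (Num.truncn `|x|).+1 => // n /= xn.
  rewrite indicE mem_set ?mulr1//= in_itv/=.
  by rewrite -ler_norml ltW// (lt_le_trans (truncnS_gt _))// ler_nat.
have H4 : {ae mu, forall x (n : nat), [set: R] x -> (`|F n x| <= `|h x|%:E)%E}.
  apply: ae_everywhere => x n _; rewrite /F /= lee_fin normrM indicE.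
  by case: (_ \in _); rewrite ?normr1 ?normr0 ?mulr1 ?mulr0.
have [_ _ L1] := @dominated_convergence _ _ _ mu _ measurableT F (EFin \o h) _
  mF mhE H3 ihn H4.
have L2 : (\int[mu]_x F n x)%E @[n --> \oo] --> (0 : R)%:E.
  rewrite -(cvg_shiftn 1); apply: cvg_trans.
    apply: near_eq_cvg; apply: nearW => n /=; rewrite addn1; exact/esym/FE.
  apply/cvg_EFinE; rewrite -(subr0 0); apply: cvgB.
    by move: Hp; rewrite -(cvg_shiftn 1); under eq_fun do rewrite addn1.
  by move: Hn; rewrite -(cvg_shiftn 1); under eq_fun do rewrite addn1.
by rewrite /Rintegral (cvg_unique _ L1 L2).
Qed.

Lemma gauss_cvg0 s : 0 < s -> gauss s n%:R @[n --> \oo] --> (0 : R).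
Proof.
move=> s0; apply: (@squeeze_cvgr _ _ _ _ (cst 0) (fun n => s^-1 * n%:R^-1)).
- near=> n; rewrite gauss_ge0/=.
  have n0 : 0 < n%:R :> R by rewrite ltr0n; near: n; exact: nbhs_infty_gt.
  have := le_trans (gauss_moment n%:R s0) (gauss_le1 _ _).
  by rewrite gtr0_norm// => h; rewrite -invfM -[leRHS]mul1r ler_pdivlMr ?mulr_gt0// mulrC.
- exact: cvg_cst.
- rewrite -(mulr0 s^-1); apply: cvgM; first exact: cvg_cst.
  by apply/gtr0_cvgV0; [near=> n; rewrite ltr0n; near: n; exact: nbhs_infty_gt|exact: cvgr_idn].
Unshelve. all: by end_near. Qed.

End gaussian.

(** * The Fourier transform of a Gaussian, through its differential equation *)

Section gaussian_transform.
Context {R : realType}.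
Local Notation mu := (@lebesgue_measure R).

Lemma integrable_bounded_mul (b f : R -> R) : measurable_fun [set: R] b ->
  (forall x, `|b x| <= 1) -> mu.-integrable [set: R] (EFin \o f) ->
  mu.-integrable [set: R] (EFin \o (fun x => b x * f x)).
Proof.
move=> mb b1 fi; have mf : measurable_fun [set: R] f.
  by apply/measurable_EFinP; exact: (measurable_int mu fi).
apply: (@integrable_of_le _ _ (fun x => `|f x|)).
- exact: measurable_funM.
- exact: measurableT_comp.
- by move=> x; rewrite normrM ler_piMl.
- by have /integrableP[] := fi.
Qed.

Lemma measurable_cosM (z : R) : measurable_fun [set: R] (fun x => cos (z * x)).
Proof.
apply: measurableT_comp; last exact: measurable_funM.
by apply: continuous_measurable_fun; exact: continuous_cos.
Qed.

Lemma measurable_sinM (z : R) : measurable_fun [set: R] (fun x => sin (z * x)).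
Proof.
apply: measurableT_comp; last exact: measurable_funM.
by apply: continuous_measurable_fun; exact: continuous_sin.
Qed.

Lemma norm_cos_le1 (x : R) : `|cos x| <= 1.
Proof. by rewrite ler_norml cos_geN1 cos_le1. Qed.

Lemma norm_sin_le1 (x : R) : `|sin x| <= 1.
Proof. by rewrite ler_norml sin_geN1 sin_le1. Qed.

Variables (s : R) (s0 : 0 < s).

Let phi z := Rintegral mu [set: R] (fun x => cos (z * x) * gauss s x).

Let cos_gauss z : mu.-integrable [set: R] (EFin \o (fun x => cos (z * x) * gauss s x)).
Proof.
apply: integrable_bounded_mul (integrable_gauss s0); first exact: measurable_cosM.
by move=> x; exact: norm_cos_le1.
Qed.

Let sin_gauss z :
  mu.-integrable [set: R] (EFin \o (fun x => sin (z * x) * (x * gauss s x))).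
Proof.
apply: integrable_bounded_mul (integrable_gauss_moment s0); first exact: measurable_sinM.
by move=> x; exact: norm_sin_le1.
Qed.

Let is_derive_sin_gauss (z x : R) : is_derive x (1 : R)
  (fun x => sin (z * x) * gauss s x)
  (z * (cos (z * x) * gauss s x) - s ^+ 2 * (sin (z * x) * (x * gauss s x))).
Proof.
have d1 : is_derive x (1 : R) (fun x : R => z * x) z.
  by apply: is_derive_eq; rewrite /GRing.scale/=; ring.
have d2 := is_derive_gauss s x.
have d3 : is_derive x (1 : R) (fun x : R => sin (z * x)) (cos (z * x) * z).
  exact: (@is_derive1_comp _ _ _ _ _ _ (is_derive_sin _) d1).
by apply: is_derive_eq; rewrite /GRing.scale/=; ring.
Qed.

(** The derivative in x of sin (z x) [gauss s x] has integral zero, and it contains both the cosine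
    integral and the first moment of the sine. *)
Let moment_phi z :
  Rintegral mu [set: R] (fun x => sin (z * x) * (x * gauss s x)) = z / s ^+ 2 * phi z.
Proof.
have i1 := @integrableZl _ _ _ mu _ measurableT z _ (cos_gauss z).
have i2 := @integrableZl _ _ _ mu _ measurableT (s ^+ 2) _ (sin_gauss z).
have : Rintegral mu [set: R]
    (fun x => z * (cos (z * x) * gauss s x) - s ^+ 2 * (sin (z * x) * (x * gauss s x))) = 0.
  apply: (integral_derivative_eq0 (is_derive_sin_gauss z)).
  - have cg : continuous (gauss s).
      move=> x; apply: differentiable_continuous; apply/derivable1_diffP.
      by have [] := is_derive_gauss s x.
    have cm : continuous (fun x : R => z * x).
      by move=> x; apply: cvgM; [exact: cvg_cst|exact: cvg_id].
    have cc : continuous (fun x => cos (z * x)).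
      by move=> x; exact: (continuous_comp (cm x) (@continuous_cos R _)).
    have cs : continuous (fun x => sin (z * x)).
      by move=> x; exact: (continuous_comp (cm x) (@continuous_sin R _)).
    move=> x; apply: cvgB.
      by apply: cvgM; [exact: cvg_cst|apply: cvgM; [exact: cc|exact: cg]].
    apply: cvgM; [exact: cvg_cst|apply: cvgM; [exact: cs|]].
    by apply: cvgM; [exact: cvg_id|exact: cg].
  - exact: (@integrableB _ _ _ mu _ measurableT _ _ i1 i2).
  - have sq (t : nat -> R) : (forall n, gauss s (t n) = gauss s n%:R) ->
        sin (z * t n) * gauss s (t n) @[n --> \oo] --> (0 : R).
      move=> ht; apply/norm_cvg0P.
      apply: (@squeeze_cvgr _ _ _ _ (cst 0) (fun n => gauss s n%:R)); last exact: gauss_cvg0.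
        apply: nearW => n; rewrite normr_ge0/= normrM ht (ger0_norm (gauss_ge0 _ _)).
        by rewrite ler_piMl ?gauss_ge0// norm_sin_le1.
      exact: cvg_cst.
    exact: sq.
  - apply/norm_cvg0P.
    apply: (@squeeze_cvgr _ _ _ _ (cst 0) (fun n => gauss s n%:R)); last exact: gauss_cvg0.
      apply: nearW => n; rewrite normr_ge0/= normrM.
      rewrite [X in _ * `|X|](_ : _ = gauss s n%:R); last by rewrite /gauss sqrrN.
      by rewrite (ger0_norm (gauss_ge0 _ _)) ler_piMl ?gauss_ge0// norm_sin_le1.
    exact: cvg_cst.
rewrite RintegralB// !RintegralZl// => /subr0_eq h.
have s2 : s ^+ 2 != 0 by rewrite gt_eqF// exprn_gt0.
by apply: (mulfI s2); rewrite -h mulrA mulrCA divff// mulr1.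
Qed.

(** Differentiation under the integral, with a majorant |x| [gauss s x] independent of z;
    [moment_phi] then closes the equation on [phi] itself. *)
Let is_derive_phi z : is_derive z (1 : R) phi (- (z / s ^+ 2 * phi z)).
Proof.
pose f (z x : R) := cos (z * x) * gauss s x.
have df (z' x : R) : is_derive z' (1 : R) (f ^~ x) (- (sin (z' * x) * (x * gauss s x))).
  have d1 : is_derive z' (1 : R) (fun z : R => z * x) x.
    by apply: is_derive_eq; rewrite /GRing.scale/=; ring.
  have d3 : is_derive z' (1 : R) (fun z : R => cos (z * x)) (- sin (z' * x) * x).
    exact: (@is_derive1_comp _ _ _ _ _ _ (is_derive_cos _) d1).
  by apply: is_derive_eq; rewrite /GRing.scale/=; ring.
have d1f z' x : partial1of2 f z' x = - (sin (z' * x) * (x * gauss s x)).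
  by rewrite partial1of2E; have [_] := df z' x.
have Iz : `]z - 1, z + 1[%classic z by rewrite /= in_itv/=; lra.
have if_ x : `]z - 1, z + 1[%classic x -> mu.-integrable [set: R] (EFin \o f x).
  by move=> _; exact: cos_gauss.
have dff x y : `]z - 1, z + 1[%classic x -> [set: R] y -> derivable (f ^~ y) x 1.
  by move=> _ _; have [] := df x y.
have iG : mu.-integrable [set: R] (EFin \o (fun x => `|x * gauss s x|)).
  exact: (integrable_abse (integrable_gauss_moment s0)).
have ub x y : `]z - 1, z + 1[%classic x -> [set: R] y ->
    `|partial1of2 f x y| <= `|y * gauss s y|.
  by move=> _ _; rewrite d1f normrN normrM ler_piMl// norm_sin_le1.
have dphi := @derivable_under_integral R _ _ mu f setT measurableT z _ _ Iz if_ dff _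
  (fun x => normr_ge0 _) iG ub.
have hphi : derive1 phi z = Rintegral mu [set: R] (fun y => partial1of2 f z y) :=
  @differentiation_under_integral R _ _ mu f setT measurableT z _ _ Iz if_ dff _
  (fun x => normr_ge0 _) iG ub.
apply: DeriveDef; first exact: dphi.
rewrite -derive1E hphi -moment_phi -mulN1r -RintegralZl//.
by apply: eq_Rintegral => x _; rewrite d1f mulN1r.
Qed.

(** [phi] and [gauss s^-1] solve the same first-order linear equation, so their quotient is
    constant; its value at 0 is the Gaussian integral. *)
Lemma integral_cos_gauss z : Rintegral mu [set: R] (fun x => cos (z * x) * gauss s x) =
  Num.sqrt (2 * pi) / s * gauss s^-1 z.
Proof.
have d (x : R) : is_derive x (1 : R) (fun z => phi z * (gauss s^-1 z)^-1) 0.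
  have dg := is_derive_gauss s^-1 x.
  have dp := is_derive_phi x.
  have g0 : gauss s^-1 x != 0 by rewrite gt_eqF// expR_gt0.
  apply: is_derive_eq.
  rewrite /GRing.scale/=; field; rewrite g0 gt_eqF//.
have := @is_derive_0_is_cst _ _ z 0 d.
have -> : phi 0 = Num.sqrt (2 * pi) / s.
  rewrite /phi /Rintegral (_ : (\int[mu]_x _ = \int[mu]_x (gauss s x)%:E)%E).
    by rewrite integral_gauss.
  by apply: eq_integral => x _; rewrite mul0r cos0 mul1r.
rewrite {2}/gauss expr0n/= mulr0 oppr0 mul0r expR0 invr1 mulr1 => <-.
by rewrite -[RHS]/(phi z * _ * _) divfK// gt_eqF// expR_gt0.
Qed.

Lemma cint_cis_gauss z : cint (fun x => cis (- (z * x)) * (gauss s x)%:C) =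
  (Num.sqrt (2 * pi) / s * gauss s^-1 z)%:C.
Proof.
apply: complexP => /=.
  rewrite -integral_cos_gauss; apply: eq_Rintegral => x _.
  by rewrite mulr0 subr0 cosN.
transitivity (Rintegral mu [set: R] (fun x => - (sin (z * x) * gauss s x))).
  by apply: eq_Rintegral => x _; rewrite mulr0 add0r sinN mulNr.
apply: Rintegral_odd.
- apply: measurableT_comp => //; apply: measurable_funM; first exact: measurable_sinM.
  exact: measurable_gauss.
- by move=> x; rewrite mulrN sinN mulNr /gauss sqrrN.
- under eq_fun do rewrite -mulNr -sinN -mulNr.
  apply: integrable_bounded_mul (integrable_gauss s0); first exact: measurable_sinM.
  by move=> x; exact: norm_sin_le1.
Qed.

End gaussian_transform.

(** * Plancherel's theorem *)

Section fourier_integral.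
Context {R : realType}.
Local Notation mu := (@lebesgue_measure R).
Implicit Types (f h : R -> R[i]) (s sigma xi : R).

(* s = -1 gives the Fourier transform, s = 1 its inverse up to the factor 2 pi. *)
Definition hat s f (xi : R) : R[i] := cint (fun x => cis (s * (x * xi)) * f x).

Lemma nint_mul_le (a b : R -> R[i]) (K : R * R -> R[i]) : cmeas K ->
  cintegrable a -> cintegrable b ->
  (forall x y, cmod (K (x, y)) <= cmod (a x) * cmod (b y)) ->
  (\int[mu]_x \int[mu]_y (cmod (K (x, y)))%:E < +oo)%E.
Proof.
move=> mK [ma aoo] [mb boo] Kab.
have mcK := measurable_cmod mK.
have mca := measurable_cmod ma; have mcb := measurable_cmod mb.
apply: (@le_lt_trans _ _ (\int[mu]_x ((cmod (a x))%:E * nint b))%E); last first.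
  rewrite ge0_integralZr//.
  - by rewrite lte_mul_pinfty ?nint_ge0// ge0_fin_numE ?nint_ge0.
  - exact/measurable_EFinP.
  - by move=> x _; rewrite lee_fin cmod_ge0.
  - exact: nint_ge0.
apply: ge0_le_integral => //.
- by move=> x _; apply: integral_ge0 => y _; rewrite lee_fin cmod_ge0.
- exact: (measurable_integral2 mcK (fun z => cmod_ge0 _)).
- by apply: emeasurable_funM => //; exact/measurable_EFinP.
move=> x _; rewrite /nint -ge0_integralZl//.
- under [leRHS]eq_integral do rewrite -EFinM.
  apply: ge0_integral_le.
  + exact: (measurable_section1 x mcK).
  + exact: measurable_funM.
  + by move=> y; exact: cmod_ge0.
  + by move=> y; exact: Kab.
- exact/measurable_EFinP.
- by move=> y _; rewrite lee_fin cmod_ge0.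
- by rewrite lee_fin cmod_ge0.
Qed.

Lemma cfubini_prod (a b : R -> R[i]) (K : R * R -> R[i]) : cmeas K ->
  cintegrable a -> cintegrable b ->
  (forall x y, cmod (K (x, y)) <= cmod (a x) * cmod (b y)) ->
  cint (fun x => cint (fun y => K (x, y))) = cint (fun y => cint (fun x => K (x, y))).
Proof. by move=> mK ia ib Kab; apply: cfubini => //; exact: (nint_mul_le mK ia ib). Qed.

Lemma cmeas_fst f : cmeas f -> cmeas (fun z : R * R => f z.1).
Proof. by move=> mf; exact: (cmeas_comp mf measurable_fst). Qed.

Lemma cmeas_snd f : cmeas f -> cmeas (fun z : R * R => f z.2).
Proof. by move=> mf; exact: (cmeas_comp mf measurable_snd). Qed.

Lemma cmeas_cis_prod s : cmeas (fun z : R * R => cis (s * (z.1 * z.2))).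
Proof.
apply: cmeas_cis; apply: measurable_funM => //.
by apply: measurable_funM; [exact: measurable_fst|exact: measurable_snd].
Qed.

Lemma cmeas_hat s f : cmeas f -> cmeas (hat s f).
Proof.
move=> mf; apply: (@cmeas_cint _ (fun z : R * R => cis (s * (z.2 * z.1)) * f z.2)).
apply: cmeasM; last exact: cmeas_snd.
apply: cmeas_cis; apply: measurable_funM => //.
by apply: measurable_funM; [exact: measurable_snd|exact: measurable_fst].
Qed.

Lemma cintegrable_cis s f (xi : R) : cintegrable f ->
  cintegrable (fun x => cis (s * (x * xi)) * f x).
Proof.
move=> fi; apply: (cintegrable_bounded (B := 1)) fi.
  by apply: cmeas_cis; apply: measurable_funM => //; exact: measurable_funM.
by move=> x; rewrite cmod_cis.
Qed.

Lemma cmod_hat_le s f xi : cintegrable f -> cmod (hat s f xi) <= fine (nint f).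
Proof.
move=> fi; have [mf foo] := fi.
apply: (@cmod_cint_le _ _ (fun x => cmod (f x))).
- by have [] := cintegrable_cis s xi fi.
- exact: measurable_cmod.
- by move=> x; rewrite cmodM cmod_cis mul1r.
- by rewrite fineK// ge0_fin_numE ?nint_ge0.
Qed.

Lemma hatB s f h xi : cintegrable f -> cintegrable h ->
  hat s (fun x => f x - h x) xi = hat s f xi - hat s h xi.
Proof.
move=> fi hi; rewrite /hat -cintB; [|exact: cintegrable_cis..].
by apply: eq_cint => x; rewrite mulrBr.
Qed.

Lemma hatD s f h xi : cintegrable f -> cintegrable h ->
  hat s (fun x => f x + h x) xi = hat s f xi + hat s h xi.
Proof.
move=> fi hi; rewrite /hat -cintD; [|exact: cintegrable_cis..].
by apply: eq_cint => x; rewrite mulrDr.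
Qed.

Lemma hatZ s f z xi : cintegrable f -> hat s (fun x => z * f x) xi = z * hat s f xi.
Proof.
move=> fi; rewrite /hat -cintZ; last exact: cintegrable_cis.
by apply: eq_cint => x; rewrite mulrCA.
Qed.

Lemma hatJ s f xi : cintegrable f -> hat s (fun x => (f x)^*) xi = (hat (- s) f xi)^*.
Proof.
move=> fi; rewrite /hat -cintJ; last exact: cintegrable_cis.
by apply: eq_cint => x; rewrite rmorphM /= -cisN mulNr opprK.
Qed.

(** Fubini: the exponential kernel is symmetric in its two variables. *)
Lemma hat_multiplication s f h : cintegrable f -> cintegrable h ->
  cint (fun xi => hat s f xi * h xi) = cint (fun x => f x * hat s h x).
Proof.
move=> fi hi; have [[mf _] [mh _]] := (fi, hi).
transitivity (cint (fun xi => cint (fun x => cis (s * (xi * x)) * h xi * f x))).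
  apply: eq_cint => xi; rewrite mulrC -cintZ; last exact: cintegrable_cis.
  by apply: eq_cint => x; rewrite [x * _]mulrC mulrCA mulrA.
have := @cfubini_prod h f (fun z => cis (s * (z.1 * z.2)) * h z.1 * f z.2).
move=> -> //=.
- apply: eq_cint => x; rewrite -cintZ; last exact: cintegrable_cis.
  by apply: eq_cint => xi; rewrite mulrC.
- apply: cmeasM; last exact: cmeas_snd.
  by apply: cmeasM; [exact: cmeas_cis_prod|exact: cmeas_fst].
- by move=> x y; rewrite !cmodM cmod_cis mul1r.
Qed.

(** This is 2 pi times the centred normal density of standard deviation sigma, that is, the
    transform of [gauss sigma]. Its mass 2 pi is the constant of Fourier inversion. *)
Definition heat (sigma z : R) : R := Num.sqrt (2 * pi) / sigma * gauss sigma^-1 z.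

Lemma heat_ge0 sigma z : 0 < sigma -> 0 <= heat sigma z.
Proof. by move=> s0; rewrite mulr_ge0 ?gauss_ge0// divr_ge0 ?sqrtr_ge0// ltW. Qed.

Lemma measurable_heat sigma : measurable_fun [set: R] (heat sigma).
Proof. by apply: measurable_funM => //; exact: measurable_gauss. Qed.

Lemma integral_heat sigma : 0 < sigma ->
  (\int[mu]_x (heat sigma x)%:E = (2 * pi)%:E)%E.
Proof.
move=> s0; have c0 : 0 <= Num.sqrt (2 * pi) / sigma by rewrite divr_ge0 ?sqrtr_ge0// ltW.
under eq_integral do rewrite EFinM.
rewrite ge0_integralZl//.
- rewrite integral_gauss ?invr_gt0// -EFinM; congr EFin.
  have p0 : 0 <= 2 * pi :> R by rewrite mulr_ge0// pi_ge0.
  rewrite -[RHS]sqr_sqrtr//; field; rewrite gt_eqF//.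
- by apply/measurable_EFinP; exact: measurable_gauss.
- by move=> x _; rewrite lee_fin gauss_ge0.
Qed.

Lemma gauss_cintegrable sigma : 0 < sigma -> cintegrable (fun x => (gauss sigma x)%:C).
Proof.
move=> s0; apply: (@cintegrable_le _ _ (gauss sigma)).
- by apply: cmeas_real; exact: measurable_gauss.
- exact: measurable_gauss.
- by move=> x; rewrite cmod_real ger0_norm ?gauss_ge0.
- by rewrite integral_gauss// ltry.
Qed.

Lemma hat_gauss s sigma (z : R) : s ^+ 2 = 1 -> 0 < sigma ->
  hat s (fun x => (gauss sigma x)%:C) z = (heat sigma z)%:C.
Proof.
move=> s2 s0; have -> : heat sigma z = heat sigma (- (s * z)).
  by rewrite /heat /gauss sqrrN exprMn s2 mul1r.
rewrite /heat -cint_cis_gauss//; apply: eq_cint => x.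
by rewrite mulNr opprK; congr (cis _ * _); ring.
Qed.

(** Gaussian summation of the inversion integral: the multiplication formula moves the transform
    from [h] to the modulated Gaussian, whose transform is a translated heat kernel. *)
Lemma hat_gauss_mul s sigma h x : s ^+ 2 = 1 -> 0 < sigma -> cintegrable h ->
  hat s (fun xi => hat (- s) h xi * (gauss sigma xi)%:C) x =
  cint (fun y => h y * (heat sigma (x - y))%:C).
Proof.
move=> s2 s0 hi; have [mh _] := hi; have gi := gauss_cintegrable s0.
rewrite /hat.
transitivity (cint (fun xi =>
    hat (- s) h xi * (cis (s * (xi * x)) * (gauss sigma xi)%:C))).
  by apply: eq_cint => xi; rewrite mulrCA.
rewrite hat_multiplication//; last exact: cintegrable_cis.
apply: eq_cint => y; congr (_ * _).
rewrite -(hat_gauss _ s2 s0); apply: eq_cint => xi.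
by rewrite mulrA -cisD; congr (cis _ * _); ring.
Qed.

(** With the Gaussian factor every integral converges absolutely, so the multiplication formula
    applies once the conjugate transform is read as the transform of the conjugate with opposite
    sign. *)
Lemma weighted_parseval s sigma f h : s ^+ 2 = 1 -> 0 < sigma ->
  cintegrable f -> cintegrable h ->
  cint (fun xi => hat s f xi * (hat s h xi)^* * (gauss sigma xi)%:C) =
  cint (fun x => f x * cint (fun y => (h y)^* * (heat sigma (x - y))%:C)).
Proof.
move=> s2 s0 fi hi.
have hJ := cintegrableJ hi.
transitivity (cint (fun xi => hat s f xi *
    (hat (- s) (fun x => (h x)^*) xi * (gauss sigma xi)%:C))).
  by apply: eq_cint => xi; rewrite hatJ// opprK mulrA.
have qi : cintegrable (fun xi =>
    hat (- s) (fun x => (h x)^*) xi * (gauss sigma xi)%:C).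
  apply: (cintegrable_bounded (B := fine (nint (fun x => (h x)^*)))).
  - by apply: cmeas_hat; case: hJ.
  - by move=> x; exact: cmod_hat_le.
  - exact: gauss_cintegrable.
rewrite (hat_multiplication s fi qi).
by apply: eq_cint => x; rewrite (hat_gauss_mul _ s2 s0 hJ).
Qed.

End fourier_integral.

(** * Bessel's inequality for integrable functions *)

Section bessel.
Context {R : realType}.
Local Notation mu := (@lebesgue_measure R).
Implicit Types (f h : R -> R[i]) (s sigma xi x y : R).

Lemma measurable_heat2 sigma :
  measurable_fun [set: R * R] (fun z : R * R => heat sigma (z.1 - z.2)).
Proof.
apply: measurableT_comp; first exact: measurable_heat.
by apply: measurable_funB; [exact: measurable_fst|exact: measurable_snd].
Qed.

Lemma heatN sigma x : heat sigma (- x) = heat sigma x.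
Proof. by rewrite /heat /gauss sqrrN. Qed.

Lemma integral_heat_shift sigma y : 0 < sigma ->
  (\int[mu]_x (heat sigma (x - y))%:E = (2 * pi)%:E)%E.
Proof.
move=> s0; rewrite -(integral_heat s0).
apply: (@integral_shift _ (fun x => (heat sigma x)%:E) (- y)).
- by apply/measurable_EFinP; exact: measurable_heat.
- by move=> x; rewrite lee_fin heat_ge0.
Qed.

Lemma integral_heat_shiftC sigma x : 0 < sigma ->
  (\int[mu]_y (heat sigma (x - y))%:E = (2 * pi)%:E)%E.
Proof.
move=> s0; rewrite -(integral_heat_shift x s0); apply: eq_integral => y _.
by rewrite -heatN opprB.
Qed.

(** Schur's argument for a symmetric kernel: |f x| |f y| is at most half the sum of the squares, and
    each half contributes pi times the squared norm since the heat kernel has mass 2 pi in either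
    variable. *)
Lemma heat_quadratic_le sigma f : 0 < sigma -> cmeas f ->
  (\int[mu]_x \int[mu]_y (cmod (f x) * cmod (f y) * heat sigma (x - y))%:E
   <= (2 * pi)%:E * L2sq f)%E.
Proof.
move=> s0 mf; have mcf := measurable_cmod mf.
have mh := measurable_heat2 sigma.
have c1 : measurable_fun [set: R * R] (fun z : R * R => cmod (f z.1)).
  exact: (measurableT_comp mcf measurable_fst).
have c2 : measurable_fun [set: R * R] (fun z : R * R => cmod (f z.2)).
  exact: (measurableT_comp mcf measurable_snd).
have h0 (z : R * R) : 0 <= heat sigma (z.1 - z.2) by exact: heat_ge0.
pose k1 (z : R * R) := 2^-1 * cmod (f z.1) ^+ 2 * heat sigma (z.1 - z.2).
pose k2 (z : R * R) := 2^-1 * cmod (f z.2) ^+ 2 * heat sigma (z.1 - z.2).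
have k10 z : 0 <= k1 z by rewrite /k1 mulr_ge0// mulr_ge0 ?sqr_ge0.
have k20 z : 0 <= k2 z by rewrite /k2 mulr_ge0// mulr_ge0 ?sqr_ge0.
have mk1 : measurable_fun [set: R * R] k1.
  by apply: measurable_funM => //; apply: measurable_funM => //; exact: measurable_funX.
have mk2 : measurable_fun [set: R * R] k2.
  by apply: measurable_funM => //; apply: measurable_funM => //; exact: measurable_funX.
have m2f : measurable_fun [set: R] (fun x => (cmod (f x) ^+ 2)%:E).
  by apply/measurable_EFinP; exact: measurable_cmod2.
have half x : (\int[mu]_y (2^-1 * cmod (f x) ^+ 2 * heat sigma (x - y))%:E =
    (pi)%:E * (cmod (f x) ^+ 2)%:E)%E.
  under eq_integral do rewrite EFinM.
  rewrite ge0_integralZl//; last 3 first.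
  - by apply/measurable_EFinP; exact: (measurable_section1 x mh).
  - by move=> y _; rewrite lee_fin heat_ge0.
  - by rewrite lee_fin mulr_ge0 ?sqr_ge0.
  by rewrite integral_heat_shiftC// -!EFinM; congr EFin; field.
have int1 : (\int[mu]_x \int[mu]_y (k1 (x, y))%:E = pi%:E * L2sq f)%E.
  rewrite /k1 /=; under eq_integral do rewrite half.
  rewrite ge0_integralZl// ?lee_fin ?pi_ge0//.
  by move=> x _; rewrite lee_fin sqr_ge0.
have int2 : (\int[mu]_x \int[mu]_y (k2 (x, y))%:E = pi%:E * L2sq f)%E.
  rewrite (tonelli mk2 k20) -int1; apply: eq_integral => x _.
  by apply: eq_integral => y _; rewrite /k1 /k2 /= -heatN opprB.
have -> : ((2 * pi)%:E * L2sq f = pi%:E * L2sq f + pi%:E * L2sq f)%E.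
  by rewrite -ge0_muleDl ?lee_fin ?pi_ge0// -EFinD; congr (EFin _ * _)%E; ring.
rewrite -{1}int1 -int2 -ge0_integralD//; last 4 first.
- by move=> x _; apply: integral_ge0 => y _; rewrite lee_fin.
- exact: (measurable_integral2 mk1 k10).
- by move=> x _; apply: integral_ge0 => y _; rewrite lee_fin.
- exact: (measurable_integral2 mk2 k20).
have m0 : measurable_fun [set: R * R]
    (fun z : R * R => cmod (f z.1) * cmod (f z.2) * heat sigma (z.1 - z.2)).
  by apply: measurable_funM => //; exact: measurable_funM.
have p0 (z : R * R) : 0 <= cmod (f z.1) * cmod (f z.2) * heat sigma (z.1 - z.2).
  by rewrite mulr_ge0// mulr_ge0 ?cmod_ge0.
apply: ge0_le_integral => //.
- by move=> x _; apply: integral_ge0 => y _; rewrite lee_fin (p0 (x, y)).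
- exact: (measurable_integral2 m0 p0).
- by apply: emeasurable_funD; [exact: (measurable_integral2 mk1 k10)|exact: (measurable_integral2 mk2 k20)].
move=> x _; rewrite -ge0_integralD//; last 4 first.
- by move=> y _; rewrite lee_fin.
- by apply/measurable_EFinP; exact: (measurable_section1 x mk1).
- by move=> y _; rewrite lee_fin.
- by apply/measurable_EFinP; exact: (measurable_section1 x mk2).
under [leRHS]eq_integral do rewrite -EFinD.
apply: ge0_integral_le.
- exact: (measurable_section1 x m0).
- by apply: measurable_funD; [exact: (measurable_section1 x mk1)|exact: (measurable_section1 x mk2)].
- by move=> y; exact: (p0 (x, y)).
- move=> y; rewrite /k1 /k2 /= -mulrDl ler_wpM2r ?heat_ge0//.
  by apply: le_trans (cmod_mul_le _ _) _; rewrite -mulrDr mulrC.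
Qed.

(** Regularised Parseval with both functions equal to [f]. The parameter is divided by sqrt 2 so
    that squaring the factor gives [gauss sigma]. *)
Lemma hat_gauss_L2_le s sigma f : s ^+ 2 = 1 -> 0 < sigma -> cintegrable f ->
  (L2sq (fun xi => hat s f xi * (gauss (sigma / Num.sqrt 2) xi)%:C)%R
   <= (2 * pi)%:E * L2sq f)%E.
Proof.
move=> s2 s0 fi; have [mf foo] := fi.
have mh := cmeas_hat s mf.
pose u xi := cmod (hat s f xi) ^+ 2 * gauss sigma xi.
have mu_ : measurable_fun [set: R] u.
  by apply: measurable_funM; [exact: measurable_cmod2|exact: measurable_gauss].
have u0 xi : 0 <= u xi by rewrite mulr_ge0 ?sqr_ge0 ?gauss_ge0.
have uE xi : cmod (hat s f xi * (gauss (sigma / Num.sqrt 2) xi)%:C) ^+ 2 = u xi.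
  rewrite cmodM exprMn cmod_real ger0_norm ?gauss_ge0// /u; congr (_ * _).
  by rewrite expr2 /gauss -expRD; congr expR; rewrite expr_div_n sqr_sqrtr//; field.
have uC xi : hat s f xi * (hat s f xi)^* * (gauss sigma xi)%:C = (u xi)%:C.
  by rewrite mulcJ -rmorphM.
have ui : cintegrable (fun xi => (u xi)%:C).
  apply: (@cintegrable_le _ _ (fun xi => fine (nint f) ^+ 2 * gauss sigma xi)).
  - exact: cmeas_real.
  - by apply: measurable_funM => //; exact: measurable_gauss.
  - move=> xi; rewrite cmod_real ger0_norm// /u ler_wpM2r ?gauss_ge0//.
    by rewrite ler_pXn2r ?nnegrE ?cmod_ge0 ?fine_ge0 ?nint_ge0// cmod_hat_le.
  - under eq_integral do rewrite EFinM.
    rewrite ge0_integralZl ?lee_fin ?sqr_ge0//.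
    + by rewrite integral_gauss// -EFinM ltry.
    + by apply/measurable_EFinP; exact: measurable_gauss.
    + by move=> xi _; rewrite lee_fin gauss_ge0.
have -> : L2sq (fun xi => hat s f xi * (gauss (sigma / Num.sqrt 2) xi)%:C) =
    (Rintegral mu [set: R] u)%:E.
  rewrite /L2sq /Rintegral fineK.
    by apply: eq_integral => xi _; rewrite uE.
  rewrite ge0_fin_numE; last by apply: integral_ge0 => xi _; rewrite lee_fin.
  have [_] := ui; rewrite /nint; apply: le_lt_trans; rewrite le_eqVlt.
  by apply/orP; left; apply/eqP/eq_integral => xi _; rewrite cmod_real ger0_norm.
have -> : Rintegral mu [set: R] u =
    complex.Re (cint (fun xi => (u xi)%:C)) by [].
have -> : cint (fun xi => (u xi)%:C) =
    cint (fun x => f x * cint (fun y => (f y)^* * (heat sigma (x - y))%:C)).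
  rewrite -(weighted_parseval s2 s0 fi fi).
  by apply: eq_cint => xi; rewrite uC.
apply: le_trans (heat_quadratic_le s0 mf).
have mK : cmeas (fun z : R * R => (f z.2)^* * (heat sigma (z.1 - z.2))%:C).
  apply: cmeasM; first by apply: cmeasJ; exact: cmeas_snd.
  by apply: cmeas_real; exact: measurable_heat2.
have mg := cmeas_cint mK; have mcK := measurable_cmod mK.
have bd x : cintegrable (fun y => (f y)^* * (heat sigma (x - y))%:C).
  have fJ := cintegrableJ fi.
  have : cintegrable (fun y => (heat sigma (x - y))%:C * (f y)^*).
    apply: (cintegrable_bounded (B := Num.sqrt (2 * pi) / sigma)) fJ.
      apply: cmeas_real; exact: (measurable_section1 x (measurable_heat2 sigma)).
    move=> y; rewrite cmod_real ger0_norm ?heat_ge0//.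
    by rewrite ler_piMr ?gauss_le1// divr_ge0 ?sqrtr_ge0// ltW.
  by congr cintegrable; apply/funext => y; rewrite mulrC.
have le1 x : ((cmod (cint (fun y => (f y)^* * (heat sigma (x - y))%:C)))%:E <=
    \int[mu]_y (cmod (f y) * heat sigma (x - y))%:E)%E.
  apply: le_trans (cmod_cint (bd x)) _; rewrite le_eqVlt; apply/orP; left; apply/eqP.
  by apply: eq_integral => y _; rewrite cmodM cmodJ cmod_real ger0_norm ?heat_ge0.
set c := fun x => cint (fun y => (f y)^* * (heat sigma (x - y))%:C).
have cB x : cmod (c x) <= Num.sqrt (2 * pi) / sigma * fine (nint f).
  apply: (@cmod_cint_le _ _ (fun y => Num.sqrt (2 * pi) / sigma * cmod (f y))).
  - by have [] := bd x.
  - by apply: measurable_funM => //; exact: measurable_cmod.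
  - move=> y; rewrite cmodM cmodJ cmod_real ger0_norm ?heat_ge0// mulrC.
    by rewrite ler_wpM2r ?cmod_ge0// ler_piMr ?gauss_le1// divr_ge0 ?sqrtr_ge0// ltW.
  - under eq_integral do rewrite EFinM.
    rewrite ge0_integralZl//.
    + by rewrite [leRHS]EFinM fineK// ge0_fin_numE ?nint_ge0.
    + by apply/measurable_EFinP; exact: measurable_cmod.
    + by move=> y _; rewrite lee_fin cmod_ge0.
    + by rewrite lee_fin divr_ge0 ?sqrtr_ge0// ltW.
have fci : cintegrable (fun x => f x * c x).
  have : cintegrable (fun x => c x * f x) by exact: (cintegrable_bounded mg cB).
  by congr cintegrable; apply/funext => x; rewrite mulrC.
apply: (@le_trans _ _ (cmod (cint (fun x => f x * c x)))%:E).
  by rewrite lee_fin; apply: le_trans (cmod_Re _); exact: ler_norm.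
apply: le_trans (cmod_cint fci) _.
have m0 : measurable_fun [set: R * R]
    (fun z : R * R => cmod (f z.1) * cmod (f z.2) * heat sigma (z.1 - z.2)).
  apply: measurable_funM; last exact: measurable_heat2.
  apply: measurable_funM; first exact: (measurableT_comp (measurable_cmod mf) measurable_fst).
  exact: (measurableT_comp (measurable_cmod mf) measurable_snd).
have p0 (z : R * R) : 0 <= cmod (f z.1) * cmod (f z.2) * heat sigma (z.1 - z.2).
  by rewrite mulr_ge0 ?heat_ge0// mulr_ge0 ?cmod_ge0.
apply: ge0_le_integral => //.
- by move=> x _; rewrite lee_fin cmod_ge0.
- by apply/measurable_EFinP; apply: measurable_cmod; case: fci.
- exact: (measurable_integral2 m0 p0).
move=> x _; rewrite cmodM EFinM.
apply: (@le_trans _ _ ((cmod (f x))%:E * \int[mu]_y (cmod (f y) * heat sigma (x - y))%:E)%E).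
  by rewrite lee_wpmul2l ?lee_fin ?cmod_ge0//; exact: le1.
rewrite -ge0_integralZl ?lee_fin ?cmod_ge0//.
- rewrite le_eqVlt; apply/orP; left; apply/eqP.
  by apply: eq_integral => y _; rewrite -EFinM mulrA.
- apply/measurable_EFinP; apply: measurable_funM; first exact: measurable_cmod.
  exact: (measurable_section1 x (measurable_heat2 sigma)).
- by move=> y _; rewrite lee_fin mulr_ge0 ?cmod_ge0 ?heat_ge0.
Qed.

Lemma gauss_cvg1 (c : R) xi : gauss (n.+1%:R^-1 * c) xi @[n --> \oo] --> (1 : R).
Proof.
have h : - ((n.+1%:R^-1 * c) ^+ 2 * xi ^+ 2) / 2 @[n --> \oo] --> (0 : R).
  rewrite (_ : 0 = - ((0 * c) ^+ 2 * xi ^+ 2) / 2); last by rewrite mul0r expr0n/= mul0r oppr0 mul0r.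
  apply: cvgM; last exact: cvg_cst.
  apply: cvgN; apply: cvgM; last exact: cvg_cst.
  rewrite expr2; under eq_fun do rewrite expr2.
  by apply: cvgM; (apply: cvgM; last exact: cvg_cst); exact: cvg_harmonic.
have /(_ _)/= := @cvg_comp _ _ _ _ (@expR R) _ _ _ h (@continuous_expR R 0).
by rewrite expR0.
Qed.

(** Fatou's lemma as sigma tends to 0. Only the inequality is obtained at this stage; equality comes
    from inversion, in [L2norm_fourier]. *)
Lemma bessel s f : s ^+ 2 = 1 -> cintegrable f ->
  (L2norm (hat s f) <= (Num.sqrt (2 * pi))%:E * L2norm f)%E.
Proof.
move=> s2 fi; have [mf foo] := fi; have mh := cmeas_hat s mf.
apply: (@L2_fatou _ (fun n xi => hat s f xi * (gauss (n.+1%:R^-1 / Num.sqrt 2) xi)%:C)).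
- by move=> n; apply: cmeasM => //; apply: cmeas_real; exact: measurable_gauss.
- exact: mh.
- apply: ae_everywhere => xi.
  have h : cmod (hat s f xi) * `|gauss (n.+1%:R^-1 / Num.sqrt 2) xi - 1| @[n --> \oo] --> (0 : R).
    rewrite -(mulr0 (cmod (hat s f xi))); apply: cvgM; first exact: cvg_cst.
    by apply/norm_cvg0P/subr_cvg0; exact: gauss_cvg1.
  apply: cvg_trans h; apply: near_eq_cvg; apply: nearW => n.
  by rewrite -cmod_real -cmodM; congr cmod; rewrite rmorphB/= mulrBr mulr1.
- move=> n; apply: L2norm_le; first exact: sqrtr_ge0.
  rewrite sqr_sqrtr; last by rewrite mulr_ge0// pi_ge0.
  by apply: hat_gauss_L2_le => //; rewrite invr_gt0.
Qed.

End bessel.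

(** * Parseval's identity against indicators of intervals *)

Section interval_pairing.
Context {R : realType}.
Local Notation mu := (@lebesgue_measure R).
Implicit Types (f h : R -> R[i]) (s sigma xi x y : R).

Definition cindic (A : set R) (x : R) : R[i] := (\1_A x)%:C.

Lemma cmod_cindic (A : set R) x : cmod (cindic A x) = \1_A x.
Proof. by rewrite cmod_real ger0_norm// indicE ler0n. Qed.

Lemma cmod_cindic_le1 (A : set R) x : cmod (cindic A x) <= 1.
Proof. by rewrite cmod_cindic indicE lern1; case: (_ \in _). Qed.

Lemma cmeas_cindic (A : set R) : measurable A -> cmeas (cindic A).
Proof. by move=> mA; apply: cmeas_real; exact: measurable_indic. Qed.

Lemma integral_indic_itv (a b : R) : (\int[mu]_x (\1_`[a, b] x)%:E < +oo)%E.
Proof.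
rewrite integral_indic//= setIT lebesgue_measure_itv/=.
by case: ifP => _; rewrite ?ltry// -EFinB ltry.
Qed.

Lemma cintegrable_cindic (a b : R) : cintegrable (cindic `[a, b]).
Proof.
apply: (@cintegrable_le _ _ (\1_`[a, b])) => //.
- exact: cmeas_cindic.
- by move=> x; rewrite cmod_cindic.
- exact: integral_indic_itv.
Qed.

Lemma inL2_cindic (a b : R) : inL2 (cindic `[a, b]).
Proof.
apply/inL2P; split; first exact: cmeas_cindic.
apply/L2norm_lty; rewrite /L2sq; apply: le_lt_trans (integral_indic_itv a b).
rewrite le_eqVlt; apply/orP; left; apply/eqP; apply: eq_integral => x _.
by rewrite cmod_cindic indicE; case: (_ \in _); rewrite ?expr0n ?expr1n.
Qed.

Lemma inL2_itv_cintegrable (a b : R) f : inL2 f ->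
  cintegrable (fun x => cindic `[a, b] x * f x).
Proof. by move=> Lf; apply: inL2_mul_cintegrable => //; exact: inL2_cindic. Qed.

Lemma inL2_itv (a b : R) f : inL2 f -> inL2 (fun x => cindic `[a, b] x * f x).
Proof.
move=> Lf; apply: (inL2_bounded (B := 1)) => //; first exact: cmeas_cindic.
by move=> x; exact: cmod_cindic_le1.
Qed.

(** The substitution y = x - sigma u moves sigma into the indicator and leaves a majorant that does
    not depend on it. *)
Lemma heat_itv_scale (a b sigma x : R) : 0 < sigma ->
  (\int[mu]_y (\1_`[a, b] y * heat sigma (x - y))%:E =
   \int[mu]_u (\1_`[a, b] (x - sigma * u)%R * (Num.sqrt (2 * pi) * gauss 1 u))%:E)%E.
Proof.
move=> s0.
pose G (u : R) := (\1_`[a, b] (x - u) * heat sigma u)%:E.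
have mG : measurable_fun [set: R] G.
  apply/measurable_EFinP; apply: measurable_funM; last exact: measurable_heat.
  by apply: measurableT_comp => //; exact: measurable_funB.
have G0 u : (0 <= G u)%E by rewrite lee_fin mulr_ge0 ?heat_ge0// indicE ler0n.
transitivity (\int[mu]_u G u)%E.
  rewrite -(integral_opp mG G0).
  have mGo : measurable_fun [set: R] (fun u => G (- u)).
    have mo : measurable_fun [set: R] (fun u : R => - u) by exact: measurable_funN.
    exact: (measurableT_comp mG mo).
  rewrite -(integral_shift (- x) mGo (fun u => G0 _)).
  by apply: eq_integral => y _; rewrite /G; congr (EFin (\1_`[a, b] _ * heat sigma _)); ring.
have := integral_scale s0 mG G0.
rewrite -[X in (_ * X)%E]mul1e => h.
have -> : (\int[mu]_u G u = sigma%:E * \int[mu]_u G (sigma * u)%R)%E.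
  by rewrite h mul1e muleA -EFinM divff ?gt_eqF// mul1e.
rewrite -ge0_integralZl//.
- apply: eq_integral => u _; rewrite /G -EFinM; congr EFin.
  rewrite mulrCA; congr (_ * _); rewrite /heat mulrA mulrCA divff ?gt_eqF// mulr1.
  by congr (_ * _); rewrite /gauss; congr expR; field; rewrite gt_eqF.
- have ms : measurable_fun [set: R] (fun u : R => sigma * u) by exact: measurable_funM.
  exact: (measurableT_comp mG ms).
- by rewrite lee_fin ltW.
Qed.

(** Away from the endpoints the indicator at x - u / (n + 1) is eventually constant in n. At an
    endpoint of a nondegenerate interval the limit would be half the mass, hence the two
    exclusions. *)
Lemma heat_itv_cvg (a b x : R) : x != a -> x != b ->
  (\int[mu]_y (\1_`[a, b] y * heat n.+1%:R^-1 (x - y))%:E)%E @[n --> \oo] -->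
  (2 * pi * \1_`[a, b] x)%:E.
Proof.
move=> xa xb.
have c0 : 0 <= Num.sqrt (2 * pi) :> R by exact: sqrtr_ge0.
have mg : measurable_fun [set: R] (fun u : R => Num.sqrt (2 * pi) * gauss 1 u).
  by apply: measurable_funM => //; exact: measurable_gauss.
have g0 (u : R) : 0 <= Num.sqrt (2 * pi) * gauss 1 u by rewrite mulr_ge0 ?gauss_ge0.
have ig : (\int[mu]_u (Num.sqrt (2 * pi) * gauss 1 u)%:E = (2 * pi)%:E)%E.
  rewrite -(integral_heat ltr01); apply: eq_integral => u _.
  by rewrite /heat divr1 invr1.
pose F (n : nat) u := (\1_`[a, b] (x - n.+1%:R^-1 * u)%R * (Num.sqrt (2 * pi) * gauss 1 u))%:E.
have mF n : measurable_fun [set: R] (F n).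
  have ms : measurable_fun [set: R] (fun u : R => x - n.+1%:R^-1 * u).
    by apply: measurable_funB => //; exact: measurable_funM.
  have mi : measurable_fun [set: R] (\1_`[a, b] : R -> R) by exact: measurable_indic.
  by apply/measurable_EFinP; exact: (measurable_funM (measurableT_comp mi ms) mg).
have H3 : {ae mu, forall u, [set: R] u -> F n u @[n --> \oo] -->
    (\1_`[a, b] x * (Num.sqrt (2 * pi) * gauss 1 u))%:E}.
  apply: ae_everywhere => u _; apply/cvg_EFinE; apply: cvg_near_cst.
  have h : x - n.+1%:R^-1 * u @[n --> \oo] --> x.
    rewrite -[X in _ --> X]subr0; apply: cvgB; first exact: cvg_cst.
    by rewrite -(mul0r u); apply: cvgM; [exact: cvg_harmonic|exact: cvg_cst].
  have [xab|xab] := boolP (x \in `[a, b]%classic).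
    have /andP[ax xb'] : a < x < b.
      move: xab; rewrite inE/= in_itv/= => /andP[ax xb'].
      by rewrite !lt_neqAle ax xb' xb eq_sym xa.
    have h1 := cvgr_gt _ h _ ax; have h2 := cvgr_lt _ h _ xb'.
    near=> n; rewrite !indicE xab mem_set//= in_itv/=.
    by apply/andP; split; apply: ltW; near: n; [exact: h1|exact: h2].
  have [xlt|] := ltP x a.
    have h1 := cvgr_lt _ h _ xlt.
    near=> n.
    rewrite !indicE (negbTE xab) memNset//= in_itv/= => /andP[+ _].
    by apply/negP; rewrite -ltNge; near: n; exact: h1.
  rewrite le_eqVlt eq_sym (negbTE xa)/= => ax.
  have bx : b < x.
    by move: xab; rewrite notin_setE/= in_itv/= (ltW ax)/= => /negP; rewrite -ltNge.
  have h1 := cvgr_gt _ h _ bx.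
  near=> n.
  rewrite !indicE (negbTE xab) memNset//= in_itv/= => /andP[_].
  by apply/negP; rewrite -ltNge; near: n; exact: h1.
have H4 : {ae mu, forall u (n : nat), [set: R] u ->
    (`|F n u| <= (EFin \o (fun u => Num.sqrt (2 * pi) * gauss 1 u)%R) u)%E}.
  apply: ae_everywhere => u n _; rewrite /F /= lee_fin normrM (ger0_norm (g0 u)) indicE.
  by rewrite ler_piMl// ger0_norm ?ler0n// lern1; case: (_ \in _).
have mlim : measurable_fun [set: R]
    (fun u => (\1_`[a, b] x * (Num.sqrt (2 * pi) * gauss 1 u))%:E).
  by apply/measurable_EFinP; exact: measurable_funM.
have iG : mu.-integrable [set: R] (EFin \o (fun u => Num.sqrt (2 * pi) * gauss 1 u)).
  apply: (integrable_of_le mg mg); first by move=> u; rewrite ger0_norm.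
  by rewrite ig ltry.
have [_ _] := @dominated_convergence _ _ _ mu _ measurableT F _ _ mF mlim H3 iG H4.
under eq_fun do rewrite -heat_itv_scale ?invr_gt0//.
have -> : (\int[mu]_u (\1_`[a, b] x * (Num.sqrt (2 * pi) * gauss 1 u))%:E =
    (2 * pi * \1_`[a, b] x)%:E)%E.
  under eq_integral do rewrite EFinM.
  rewrite ge0_integralZl//.
  - by rewrite ig -EFinM mulrC.
  - exact/measurable_EFinP.
  - by move=> u _; rewrite lee_fin.
exact.
Unshelve. all: by end_near. Qed.

Lemma cint_real (r : R -> R) :
  cint (fun x => (r x)%:C) = (Rintegral mu [set: R] r)%:C.
Proof. by apply: complexP => //=; rewrite /Rintegral integral0. Qed.

Lemma parseval_itv s (a b : R) f : s ^+ 2 = 1 -> cintegrable f -> inL2 f ->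
  cint (fun xi => hat s f xi * (hat s (cindic `[a, b]) xi)^*) =
  (2 * pi)%:C * cint (fun x => f x * cindic `[a, b] x).
Proof.
move=> s2 fi Lf; set h := cindic `[a, b]; have [mf _] := fi.
have hi : cintegrable h by exact: cintegrable_cindic.
have Lh : inL2 h by exact: inL2_cindic.
have mh := inL2_cmeas Lh.
have LF k : cintegrable k -> inL2 k -> inL2 (hat s k).
  move=> ki Lk; apply/inL2P; split; first by apply: cmeas_hat; case: ki.
  by apply: le_lt_trans (bessel s2 ki) _; rewrite lte_mul_pinfty ?lee_fin ?sqrtr_ge0// inL2_lty.
have LhJ : inL2 (fun xi => (hat s h xi)^*).
  have /inL2P[mhh hoo] := LF h hi Lh; apply/inL2P; split; first exact: cmeasJ.
  by rewrite (@eq_L2norm _ _ (hat s h))// => x; rewrite cmodJ.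
have Pi := inL2_mul_cintegrable (LF f fi Lf) LhJ.
have [mP Poo] := Pi; have mcP := measurable_cmod mP.
pose F n xi := hat s f xi * (hat s h xi)^* * (gauss (n.+1%:R^-1 * 1) xi)%:C.
have mg n : measurable_fun [set: R] (gauss (n.+1%:R^-1 * 1)) by exact: measurable_gauss.
have L1 : cmod (cint (F n) - cint (fun xi => hat s f xi * (hat s h xi)^*)) @[n --> \oo] --> (0 : R).
  apply: (cdominated_cvg _ mP mcP Poo _ _ Pi).
  - by move=> n; apply: cmeasM => //; exact: cmeas_real.
  - move=> n xi; rewrite /F [leLHS]cmodM cmod_real ger0_norm ?gauss_ge0//.
    by rewrite ler_piMr ?cmod_ge0// gauss_le1.
  - apply: ae_everywhere => xi.
    have hh : cmod (hat s f xi * (hat s h xi)^*) * `|gauss (n.+1%:R^-1 * 1) xi - 1| @[n --> \oo] --> (0 : R).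
      rewrite -(mulr0 (cmod (hat s f xi * (hat s h xi)^*))); apply: cvgM; first exact: cvg_cst.
      by apply/norm_cvg0P/subr_cvg0; exact: gauss_cvg1.
    apply: cvg_trans hh; apply: near_eq_cvg; apply: nearW => n.
    rewrite -cmod_real -cmodM; congr cmod; rewrite /F rmorphB/= mulrBr; congr (_ - _).
    exact: mulr1.
pose I (n : nat) x := (\int[mu]_y (\1_`[a, b] y * heat n.+1%:R^-1 (x - y))%:E)%E.
pose c n x := cint (fun y => (h y)^* * (heat (n.+1%:R^-1 * 1) (x - y))%:C).
have s0 n : 0 < n.+1%:R^-1 :> R by rewrite invr_gt0.
have cE n x : c n x = (fine (I n x))%:C.
  rewrite /c mulr1 -cint_real; apply: eq_cint => y.
  rewrite (_ : (h y)^* = h y); last exact: conjc_real.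
  by rewrite -[h y]/((\1_`[a, b] y)%:C) -rmorphM.
have I2pi n x : (0 <= I n x <= (2 * pi)%:E)%E.
  apply/andP; split.
    by apply: integral_ge0 => y _; rewrite lee_fin mulr_ge0 ?heat_ge0 ?indicE ?ler0n ?s0.
  rewrite -(integral_heat_shiftC x (s0 n)).
  have mhs : measurable_fun [set: R] (fun y => heat n.+1%:R^-1 (x - y)).
    exact: (measurable_section1 x (measurable_heat2 _)).
  have mi : measurable_fun [set: R] (\1_`[a, b] : R -> R) by exact: measurable_indic.
  apply: ge0_integral_le => //.
  - exact: measurable_funM.
  - by move=> y; rewrite mulr_ge0 ?heat_ge0 ?indicE ?ler0n ?s0.
  - by move=> y; rewrite ler_piMl ?heat_ge0 ?s0 ?indicE ?lern1 ?leq_b1.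
have Ifin n x : I n x \is a fin_num.
  have /andP[I0 I1] := I2pi n x.
  by rewrite ge0_fin_numE//; apply: le_lt_trans I1 _; rewrite ltry.
have p20 : 0 <= 2 * pi :> R by rewrite mulr_ge0// pi_ge0.
have L2 : cmod (cint (fun x => f x * c n x) - cint (fun x => f x * ((2 * pi)%:C * h x))) @[n --> \oo] --> (0 : R).
  have mc n : cmeas (c n).
    apply: (@cmeas_cint _ (fun z : R * R => (h z.2)^* * (heat (n.+1%:R^-1 * 1) (z.1 - z.2))%:C)).
    apply: cmeasM; first by apply: cmeasJ; exact: cmeas_snd.
    by apply: cmeas_real; exact: measurable_heat2.
  apply: (@cdominated_cvg _ _ _ (fun x => (2 * pi) * cmod (f x))).
  - by move=> n; exact: cmeasM.
  - by apply: cmeasM => //; apply: cmeasM => //; exact: cmeas_cst.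
  - by apply: measurable_funM => //; exact: measurable_cmod.
  - under eq_integral do rewrite EFinM.
    rewrite ge0_integralZl ?lee_fin//.
    + by rewrite lte_mul_pinfty ?lee_fin//; case: fi.
    + by apply/measurable_EFinP; exact: measurable_cmod.
    + by move=> x _; rewrite lee_fin cmod_ge0.
  - move=> n x; rewrite cmodM mulrC ler_wpM2r ?cmod_ge0// cE cmod_real.
    have /andP[I0 I1] := I2pi n x.
    by rewrite ger0_norm ?fine_ge0// -lee_fin fineK.
  - have nab : {ae mu, forall x, x != a /\ x != b}.
      exists ([set a] `|` [set b]); split.
      + by apply: measurableU; exact: measurable_set1.
      + by rewrite null_set_setU//; exact: lebesgue_measure_set1.
      + move=> x /= /not_andP[] /negP; rewrite negbK => /eqP ->; by [left|right].
    apply: ae_imply nab => x [xa xb].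
    have := heat_itv_cvg xa xb; rewrite -/(I _ x) => hI.
    have {}hI : fine (I n x) @[n --> \oo] --> 2 * pi * \1_`[a, b] x by exact: (fine_cvg hI).
    have hh : cmod (f x) * `|fine (I n x) - 2 * pi * \1_`[a, b] x| @[n --> \oo] --> (0 : R).
      rewrite -(mulr0 (cmod (f x))); apply: cvgM; first exact: cvg_cst.
      by apply/norm_cvg0P/subr_cvg0.
    apply: cvg_trans hh; apply: near_eq_cvg; apply: nearW => n.
    by rewrite -cmod_real -cmodM; congr cmod; rewrite rmorphB/= cE rmorphM/= mulrBr.
  - have hp : cintegrable (fun x => ((2 * pi)%:C * h x) * f x).
      apply: (cintegrable_bounded (B := 2 * pi)) fi.
        by apply: cmeasM => //; exact: cmeas_cst.
      by move=> x; rewrite cmodM cmod_real ger0_norm// ler_piMr// cmod_cindic_le1.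
    by move: hp; congr cintegrable; apply/funext => x; rewrite mulrC.
have FE n : cint (F n) = cint (fun x => f x * c n x).
  by apply: weighted_parseval; rewrite ?mulr1.
have -> : (2 * pi)%:C * cint (fun x => f x * h x) = cint (fun x => f x * ((2 * pi)%:C * h x)).
  rewrite -cintZ; first by apply: eq_cint => x; rewrite mulrCA.
  exact: inL2_mul_cintegrable.
set z := cint _; set w := cint _.
apply/subr0_eq/cmod_eq0/eqP; rewrite eq_le cmod_ge0 andbT.
have L12 : cmod (cint (F n) - z) + cmod (cint (F n) - w) @[n --> \oo] --> (0 : R).
  rewrite -(addr0 0); apply: cvgD; first exact: L1.
  by under eq_fun do rewrite FE; exact: L2.
apply: (cvgr_to_ge L12); apply: nearW => n.
rewrite (cmodBC (cint (F n)) z); apply: le_trans (cmodD _ _).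
by rewrite subrKA.
Qed.

End interval_pairing.

(** * The transform on L^2: existence, uniqueness, inversion *)

Section L2_fourier.
Context {R : realType}.
Local Notation mu := (@lebesgue_measure R).
Implicit Types (f g h k : R -> R[i]) (s : R).

Lemma cvg_cmod_unique (u : nat -> R[i]) (a b : R[i]) :
  cmod (u n - a) @[n --> \oo] --> (0 : R) ->
  cmod (u n - b) @[n --> \oo] --> (0 : R) -> a = b.
Proof.
move=> ua ub; apply/subr0_eq/cmod_eq0/eqP; rewrite eq_le cmod_ge0 andbT.
have uab : cmod (u n - a) + cmod (u n - b) @[n --> \oo] --> (0 : R).
  by rewrite -(addr0 0); exact: cvgD.
apply: (cvgr_to_ge uab); apply: nearW => n.
by rewrite (cmodBC (u n) a); apply: le_trans (cmodD _ _); rewrite subrKA.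
Qed.

(** Lebesgue differentiation: r is a.e. the derivative of its primitive, which is constant. *)
Lemma ae0_of_intervals (r : R -> R) : mu.-integrable [set: R] (EFin \o r) ->
  (forall x, Rintegral mu `]-oo, x] r = 0) -> {ae mu, forall x, r x = 0}.
Proof.
move=> ir r0.
have lr : locally_integrable [set: R] r.
  have := integrable_locally measurableT ir; rewrite /restrict /patch.
  by congr locally_integrable; apply/funext => x; rewrite in_setT.
have ir' y : mu.-integrable `]-oo, y] (EFin \o r).
  by apply: integrableS ir.
have := FTC1Ny ir' lr; apply: ae_imply => x /= [_ <-].
rewrite (_ : (fun y => _) = cst 0); last by apply/funext => y; rewrite r0.
by rewrite derive1_cst.
Qed.

Lemma ae0_of_cint_intervals f : inL2 f ->
  (forall a b, cint (fun x => f x * cindic `[a, b] x) = 0) ->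
  {ae mu, forall x, f x = 0}.
Proof.
move=> Lf f0.
suff h (m : nat) : {ae mu, forall x, cindic `[- m%:R, m%:R] x * f x = 0}.
  have := ae_all h; apply: ae_imply => x hx.
  have := hx (Num.truncn `|x|).+1; rewrite /cindic indicE mem_set ?mul1r//=.
  by rewrite in_itv/= -ler_norml ltW// truncnS_gt.
pose F x := cindic `[- m%:R, m%:R] x * f x.
have iF : cintegrable F by exact: inL2_itv_cintegrable.
(* Cutting to [-m, m] makes f integrable, and a half-line meets [-m, m] in the interval
   [-m, min (m, x)], possibly empty, to which the hypothesis applies. *)
have F0 x : cintegral `]-oo, x] F = 0.
  rewrite cintegral_indic// -[RHS](f0 (- m%:R) (Num.min m%:R x)).
  apply: eq_cint => y; rewrite /F mulrA mulrC; congr (_ * _).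
  rewrite /cindic -rmorphM /= !indicE; congr (_%:C).
  rewrite -natrM mulnb; congr ((_ : bool)%:R).
  apply/idP/idP; rewrite !inE/= !in_itv/= le_min.
    by move=> /andP[/set_mem/= + /set_mem/=]; rewrite !in_itv/= => -> /andP[-> ->].
  by move=> /andP[a /andP[b c]]; rewrite !mem_set//= in_itv/= ?a ?b ?c.
have hr := ae0_of_intervals (cintegrable_Re iF).
have hi := ae0_of_intervals (cintegrable_Im iF).
apply: (ae_imply2 _ (hr _) (hi _)).
- by move=> x /= h1 h2; apply: complexP.
- by move=> x; have /(congr1 (@complex.Re R)) := F0 x.
- by move=> x; have /(congr1 (@complex.Im R)) := F0 x.
Qed.

Definition trunc (n : nat) f x := cindic `[- n%:R, n%:R] x * f x.

Lemma cintegrable_trunc n f : inL2 f -> cintegrable (trunc n f).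
Proof. exact: inL2_itv_cintegrable. Qed.

Lemma inL2_trunc n f : inL2 f -> inL2 (trunc n f).
Proof. exact: inL2_itv. Qed.

Lemma cmod_trunc_le n f x : cmod (trunc n f x) <= cmod (f x).
Proof. by rewrite cmodM ler_piMl ?cmod_ge0// cmod_cindic_le1. Qed.

Lemma trunc_cvg f : inL2 f ->
  L2norm (fun x => trunc n f x - f x) @[n --> \oo] --> (0%E : \bar R).
Proof.
move=> Lf; apply: (L2_dominated _ _ Lf).
- by move=> n; exact: (inL2_cmeas (inL2_trunc n Lf)).
- exact: inL2_cmeas.
- by move=> n x; exact: cmod_trunc_le.
- apply: ae_everywhere => x; apply: cvg_near_cst; exists (Num.truncn `|x|).+1 => // n /= xn.
  rewrite /trunc /cindic indicE mem_set ?mul1r ?subrr ?cmod0//= in_itv/=.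
  by rewrite -ler_norml ltW// (lt_le_trans (truncnS_gt _))// ler_nat.
Qed.

Lemma inL2_hat s f : s ^+ 2 = 1 -> cintegrable f -> inL2 f -> inL2 (hat s f).
Proof.
move=> s2 fi Lf; apply/inL2P; split; first by apply: cmeas_hat; case: fi.
apply: le_lt_trans (bessel s2 fi) _.
by rewrite lte_mul_pinfty ?lee_fin ?sqrtr_ge0// inL2_lty.
Qed.

Lemma inL2_hat_trunc s n f : s ^+ 2 = 1 -> inL2 f -> inL2 (hat s (trunc n f)).
Proof. by move=> s2 Lf; apply: inL2_hat; [|exact: cintegrable_trunc|exact: inL2_trunc]. Qed.

(** A relation rather than a function: it is stable under a.e. modification on either side
    ([FT_aeL], [FT_ae]), as representatives chosen by [xget] require. *)
Definition is_FT s f g := [/\ inL2 f, inL2 g &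
  L2norm (fun xi => g xi - hat s (trunc n f) xi) @[n --> \oo] --> (0%E : \bar R)].

(** The truncations of f converge in L^2, Bessel's inequality makes their transforms a Cauchy
    sequence, and L^2 is complete. *)
Lemma FT_exists s f : s ^+ 2 = 1 -> inL2 f -> exists g, is_FT s f g.
Proof.
move=> s2 Lf; have LF n := inL2_hat_trunc n s2 Lf.
have [||g Lg Fg] := @L2_complete _ (fun n => hat s (trunc n f)).
- by [].
- move=> e e0; pose d := e / 2 / (Num.sqrt (2 * pi) + 1).
  have p1 : 0 < Num.sqrt (2 * pi) + 1 :> R by rewrite ltr_wpDl ?sqrtr_ge0.
  have d0 : 0 < d by rewrite /d !divr_gt0.
  have /fine_cvgP[[N1 _ hN1] /cvgrPdist_le/(_ _ d0)[N2 _ hN2]] := trunc_cvg Lf.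
  have small n : (maxn N1 N2 <= n)%N -> (L2norm (fun x => trunc n f x - f x)%R <= d%:E)%E.
    rewrite geq_max => /andP[n1 n2]; have := hN2 n n2.
    rewrite /= sub0r normrN ger0_norm ?fine_ge0 ?L2norm_ge0// => h.
    by rewrite -(fineK (hN1 n n1)) lee_fin.
  have mf := inL2_cmeas Lf.
  have mt n := inL2_cmeas (inL2_trunc n Lf).
  exists (maxn N1 N2) => m n Nm Nn.
  have it := cintegrableB (cintegrable_trunc m Lf) (cintegrable_trunc n Lf).
  rewrite (@eq_L2norm _ _ (hat s (fun x => trunc m f x - trunc n f x))); last first.
    by move=> xi; rewrite hatB//; exact: cintegrable_trunc.
  apply: le_trans (bessel s2 it) _.
  apply: (@le_trans _ _ ((Num.sqrt (2 * pi))%:E * (d%:E + d%:E))%E).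
    rewrite lee_wpmul2l ?lee_fin ?sqrtr_ge0//.
    apply: le_trans (L2norm_dist (mt m) mf (mt n)) _.
    by rewrite leeD ?small// L2normBC small.
  have dE : (d + d) * (Num.sqrt (2 * pi) + 1) = e.
    by rewrite /d; field; rewrite gt_eqF.
  rewrite -EFinD -EFinM lee_fin -[leRHS]dE mulrC.
  by apply: ler_wpM2l; [rewrite addr_ge0// ltW|rewrite lerDl].
- exists g; split => //; move: Fg; apply: cvg_trans; apply: near_eq_cvg.
  by apply: nearW => n; rewrite L2normBC.
Qed.

Lemma FT_lim s f g : s ^+ 2 = 1 -> is_FT s f g ->
  L2norm (fun xi => hat s (trunc n f) xi - g xi) @[n --> \oo] --> (0%E : \bar R).
Proof.
move=> s2 [_ _]; apply: cvg_trans; apply: near_eq_cvg.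
by apply: nearW => n; rewrite L2normBC.
Qed.

Lemma FT_unique s f g h : s ^+ 2 = 1 -> is_FT s f g -> is_FT s f h ->
  {ae mu, forall x, g x = h x}.
Proof.
move=> s2 fg fh; have [Lf Lg _] := fg; have [_ Lh _] := fh.
apply: (L2_lim_unique _ _ _ (FT_lim s2 fg) (FT_lim s2 fh)).
- by move=> n; exact: (inL2_cmeas (inL2_hat_trunc n s2 Lf)).
- exact: inL2_cmeas.
- exact: inL2_cmeas.
Qed.

Lemma FT_ae s f g h : is_FT s f g -> inL2 h -> {ae mu, forall x, g x = h x} ->
  is_FT s f h.
Proof.
move=> [Lf Lg fg] Lh gh; split => //; move: fg; apply: cvg_trans; apply: near_eq_cvg.
have mT n : cmeas (hat s (trunc n f)).
  by apply: cmeas_hat; case: (cintegrable_trunc n Lf).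
have mg := inL2_cmeas Lg; have mh := inL2_cmeas Lh.
apply: nearW => n; apply: ae_eq_L2norm; [exact: cmeasB..|].
by apply: ae_imply gh => x ->.
Qed.

Lemma FT_aeL s f f' g : is_FT s f g -> inL2 f' -> {ae mu, forall x, f x = f' x} ->
  is_FT s f' g.
Proof.
move=> [Lf Lg fg] Lf' ff'; split => //; move: fg; apply: cvg_trans; apply: near_eq_cvg.
apply: nearW => n; apply: eq_L2norm => xi; congr (cmod (_ - _)).
have [mt _] := cintegrable_trunc n Lf; have [mt' _] := cintegrable_trunc n Lf'.
apply: ae_eq_cint.
- by apply: cmeasM => //; apply: cmeas_cis; apply: measurable_funM => //; exact: measurable_funM.
- by apply: cmeasM => //; apply: cmeas_cis; apply: measurable_funM => //; exact: measurable_funM.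
by apply: ae_imply ff' => x; rewrite /trunc => ->.
Qed.

Lemma FT_lin s (a : R[i]) f f' g g' : is_FT s f g -> is_FT s f' g' ->
  is_FT s (fun x => a * f x + f' x) (fun x => a * g x + g' x).
Proof.
move=> [Lf Lg fg] [Lf' Lg' fg']; split.
- by apply: inL2D => //; exact: inL2Z.
- by apply: inL2D => //; exact: inL2Z.
have mT n h : inL2 h -> cmeas (hat s (trunc n h)).
  by move=> Lh; apply: cmeas_hat; case: (cintegrable_trunc n Lh).
have mg := inL2_cmeas Lg; have mg' := inL2_cmeas Lg'.
apply: (@squeeze_cvge0 _ _ _ _ _ (fun n =>
  (cmod a)%:E * L2norm (fun xi => g xi - hat s (trunc n f) xi)%R +
  L2norm (fun xi => g' xi - hat s (trunc n f') xi)%R)%E).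
- by move=> n; exact: L2norm_ge0.
- move=> n; rewrite -L2normZ; last by apply: cmeasB => //; exact: mT.
  apply: le_trans (L2normD _ _); last 2 first.
  + by apply: cmeasM; [exact: cmeas_cst|apply: cmeasB => //; exact: mT].
  + by apply: cmeasB => //; exact: mT.
  rewrite le_eqVlt; apply/orP; left; apply/eqP; apply: eq_L2norm => xi; congr cmod.
  have -> : hat s (trunc n (fun x => a * f x + f' x)) xi =
      a * hat s (trunc n f) xi + hat s (trunc n f') xi.
    rewrite -hatZ; last exact: cintegrable_trunc.
    rewrite -hatD; [|by apply: cintegrableZ; exact: cintegrable_trunc|exact: cintegrable_trunc].
    by apply: eq_cint => x; rewrite /trunc; ring.
  by ring.
- have h : ((cmod a)%:E * L2norm (fun xi => g xi - hat s (trunc n f) xi)%R)%E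
      @[n --> \oo] --> (0%E : \bar R).
    by rewrite -(mule0 (cmod a)%:E); apply: cvgeZl.
  by rewrite -(adde0 0%E); apply: cvgeD.
Qed.

Lemma FT_norm_le s f g : s ^+ 2 = 1 -> is_FT s f g ->
  (L2norm g <= (Num.sqrt (2 * pi))%:E * L2norm f)%E.
Proof.
move=> s2 fg; have [Lf Lg gc] := fg.
have h : (L2norm (fun xi => g xi - hat s (trunc n f) xi)%R +
    (Num.sqrt (2 * pi))%:E * L2norm f)%E @[n --> \oo] -->
    (0 + (Num.sqrt (2 * pi))%:E * L2norm f)%E.
  by apply: cvgeD => //; exact: cvg_cst.
rewrite add0e in h; apply: (cvge_to_ge h); apply: nearW => n.
have mt := inL2_cmeas (inL2_hat_trunc n s2 Lf); have mg := inL2_cmeas Lg.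
apply: (@le_trans _ _ (L2norm (fun xi => (g xi - hat s (trunc n f) xi) + hat s (trunc n f) xi)%R)).
  by rewrite le_eqVlt; apply/orP; left; apply/eqP; apply: eq_L2norm => xi; rewrite subrK.
apply: le_trans (L2normD (cmeasB mg mt) mt) _; rewrite leeD2l//.
apply: le_trans (bessel s2 (cintegrable_trunc n Lf)) _.
rewrite lee_wpmul2l ?lee_fin ?sqrtr_ge0//; apply: L2norm_mono.
- exact: (inL2_cmeas (inL2_trunc n Lf)).
- exact: inL2_cmeas.
- by move=> x; exact: cmod_trunc_le.
Qed.

(* Parseval against indicators of intervals is enough: an L^2 function whose integral
   over every interval vanishes is zero a.e. *)
Lemma FT_pair_itv s f g (a b : R) : s ^+ 2 = 1 -> is_FT s f g ->
  cint (fun xi => g xi * (hat s (cindic `[a, b]) xi)^*) =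
  (2 * pi)%:C * cint (fun x => f x * cindic `[a, b] x).
Proof.
move=> s2 fg; have [Lf Lg _] := fg.
have LI := inL2_cindic a b; have iI := cintegrable_cindic a b.
have LhJ : inL2 (fun xi => (hat s (cindic `[a, b]) xi)^*).
  have /inL2P[mhh hoo] := inL2_hat s2 iI LI; apply/inL2P; split; first exact: cmeasJ.
  by rewrite (@eq_L2norm _ _ (hat s (cindic `[a, b])))// => x; rewrite cmodJ.
have L1 := L2_pairing_cvg (fun n => inL2_hat_trunc n s2 Lf) Lg LhJ (FT_lim s2 fg).
have L2 := L2_pairing_cvg (fun n => inL2_trunc n Lf) Lf LI (trunc_cvg Lf).
apply: (cvg_cmod_unique L1).
have L3 : cmod (2 * pi)%:C * cmod (cint (fun x => trunc n f x * cindic `[a, b] x) -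
    cint (fun x => f x * cindic `[a, b] x)) @[n --> \oo] --> (0 : R).
  by rewrite -(mulr0 (cmod (2 * pi)%:C)); apply: cvgM => //; exact: cvg_cst.
apply: cvg_trans L3; apply: near_eq_cvg; apply: nearW => n.
rewrite -cmodM mulrBr; congr cmod; congr (_ - _).
by rewrite parseval_itv//; [exact: cintegrable_trunc|exact: inL2_trunc].
Qed.

(** The difference is tested on intervals. The multiplication formula moves the second transform
    onto the indicator, where [hat (- s)] is the conjugate of [hat s]; the resulting pairing with
    [g] is the one evaluated by [FT_pair_itv]. *)
Lemma FT_inversion s f g k : s ^+ 2 = 1 -> is_FT s f g -> is_FT (- s) g k ->
  {ae mu, forall x, k x = (2 * pi)%:C * f x}.
Proof.
move=> s2 fg gk; have [Lf Lg _] := fg; have [_ Lk _] := gk.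
have sn2 : (- s) ^+ 2 = 1 by rewrite sqrrN.
have L2f := inL2Z (2 * pi)%:C Lf.
suff : {ae mu, forall x, k x - (2 * pi)%:C * f x = 0}.
  by apply: ae_imply => x /subr0_eq.
apply: ae0_of_cint_intervals; first exact: inL2B.
move=> a b; have LI := inL2_cindic a b; have iI := cintegrable_cindic a b.
have LhJ : inL2 (fun xi => (hat s (cindic `[a, b]) xi)^*).
  have /inL2P[mhh hoo] := inL2_hat s2 iI LI; apply/inL2P; split; first exact: cmeasJ.
  by rewrite (@eq_L2norm _ _ (hat s (cindic `[a, b])))// => x; rewrite cmodJ.
have -> : cint (fun x => (k x - (2 * pi)%:C * f x) * cindic `[a, b] x) =
    cint (fun x => k x * cindic `[a, b] x) - (2 * pi)%:C * cint (fun x => f x * cindic `[a, b] x).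
  rewrite -cintZ; last exact: inL2_mul_cintegrable.
  rewrite -cintB; [|exact: inL2_mul_cintegrable|].
    by apply: eq_cint => x; ring.
  by apply: cintegrableZ; exact: inL2_mul_cintegrable.
rewrite -(FT_pair_itv a b s2 fg); apply/eqP; rewrite subr_eq0; apply/eqP.
have L1 := L2_pairing_cvg (fun n => inL2_hat_trunc n sn2 Lg) Lk LI (FT_lim sn2 gk).
have L2 := L2_pairing_cvg (fun n => inL2_trunc n Lg) Lg LhJ (trunc_cvg Lg).
apply: (cvg_cmod_unique L1); apply: cvg_trans L2; apply: near_eq_cvg; apply: nearW => n.
congr (cmod (_ - _)).
have ig := cintegrable_trunc n Lg.
rewrite (hat_multiplication (- s) ig iI); apply: eq_cint => xi; congr (_ * _).
rewrite -[s in LHS]opprK -hatJ//; apply: eq_cint => x; congr (_ * _).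
exact: conjc_real.
Qed.

End L2_fourier.

(** * Plancherel's theorem for [fourier] and [ifourier] *)

Section plancherel.
Context {R : realType}.
Local Notation mu := (@lebesgue_measure R).
Implicit Types (f g h : R -> R[i]).

Let twopi_gt0 : 0 < 2 * pi :> R.
Proof. by rewrite mulr_gt0// pi_gt0. Qed.

Let twopiC_neq0 : (2 * pi)%:C != 0 :> R[i].
Proof. by apply/negP => /eqP /complexI h; move: twopi_gt0; rewrite h ltxx. Qed.

Lemma fourier_truncE n f xi : fourier_trunc n f xi = hat (- 1) (trunc n f) xi.
Proof.
rewrite /fourier_trunc cintegral_indic//; apply: eq_cint => x.
by rewrite /trunc /cindic mulN1r mulrCA.
Qed.

Lemma ifourier_truncE n g x :
  ifourier_trunc n g x = ((2 * pi)^-1)%:C * hat 1 (trunc n g) x.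
Proof.
rewrite /ifourier_trunc cintegral_indic//; congr (_ * _); apply: eq_cint => xi.
by rewrite /trunc /cindic mul1r mulrCA mulrC [x * xi]mulrC; ring.
Qed.

Lemma is_fourierP f g : is_fourier f g <-> is_FT (- 1) f g.
Proof.
by split=> -[Lf Lg h]; split => //; move: h; apply: cvg_trans; apply: near_eq_cvg;
  apply: nearW => n; apply: eq_L2norm => xi; rewrite fourier_truncE.
Qed.

Lemma is_ifourierP g f : is_ifourier g f <-> is_FT 1 g (fun x => (2 * pi)%:C * f x).
Proof.
have E n : inL2 g -> inL2 f ->
    L2norm (fun x => (2 * pi)%:C * f x - hat 1 (trunc n g) x) =
    ((2 * pi)%:E * L2norm (fun x => f x - ifourier_trunc n g x)%R)%E.
  move=> Lg Lf; have ig := cintegrable_trunc n Lg.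
  have -> : (2 * pi : R)%:E = (cmod (2 * pi : R)%:C)%:E by rewrite cmod_real gtr0_norm.
  rewrite -L2normZ.
    apply: eq_L2norm => x; rewrite ifourier_truncE mulrBr mulrA -rmorphM divff ?gt_eqF//.
    by rewrite mul1r.
  apply: cmeasB; first exact: inL2_cmeas.
  rewrite (_ : ifourier_trunc n g = fun x => ((2 * pi)^-1)%:C * hat 1 (trunc n g) x).
    by apply: cmeasM; [exact: cmeas_cst|apply: cmeas_hat; case: ig].
  by apply/funext => x; rewrite ifourier_truncE.
split=> [[Lg Lf h]|[Lg Lf' h]].
  split => //; first exact: inL2Z.
  under eq_fun do rewrite E//.
  by rewrite -(mule0 (2 * pi)%:E); apply: cvgeZl.
have Lf : inL2 f.
  have := inL2Z ((2 * pi)^-1)%:C Lf'; congr inL2; apply/funext => x.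
  by rewrite mulrA -rmorphM mulVf ?gt_eqF// mul1r.
split => //; rewrite -(mule0 ((2 * pi)^-1)%:E).
have h2 : ((2 * pi)^-1%:E * L2norm (fun x => (2 * pi)%:C * f x - hat 1 (trunc n g) x)%R)%E
    @[n --> \oo] --> ((2 * pi)^-1%:E * 0)%E by apply: cvgeZl.
apply: cvg_trans h2; apply: near_eq_cvg; apply: nearW => n.
by rewrite E// muleA -EFinM mulVf ?gt_eqF// mul1e.
Qed.

Lemma fourierP f : inL2 f -> is_fourier f (fourier f).
Proof.
move=> Lf; rewrite /fourier; case: xgetP => [g _ //|no].
have [|g /is_fourierP fg] := @FT_exists _ (- 1) f _ Lf; first by rewrite sqrrN expr1n.
by have := no g; case.
Qed.

Lemma ifourierP g : inL2 g -> is_ifourier g (ifourier g).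
Proof.
move=> Lg; rewrite /ifourier; case: xgetP => [f _ //|no].
have [|f fg] := @FT_exists _ 1 g _ Lg; first by rewrite expr1n.
have := no (fun x => ((2 * pi)^-1)%:C * f x); case; apply/is_ifourierP.
move: fg; congr is_FT; apply/funext => x.
by rewrite mulrA -rmorphM divff ?gt_eqF// mul1r.
Qed.

Lemma inL2_fourier f : inL2 f -> inL2 (fourier f).
Proof. by case/fourierP. Qed.

Lemma inL2_ifourier g : inL2 g -> inL2 (ifourier g).
Proof. by case/ifourierP. Qed.

Lemma fourier_eq f g : is_FT (- 1) f g -> {ae mu, forall xi, fourier f xi = g xi}.
Proof.
move=> fg; have [Lf _ _] := fg; have /is_fourierP ff := fourierP Lf.
by apply: FT_unique ff fg; rewrite sqrrN expr1n.
Qed.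

Lemma ifourier_eq g f : is_FT 1 g (fun x => (2 * pi)%:C * f x) ->
  {ae mu, forall x, ifourier g x = f x}.
Proof.
move=> gf; have [Lg _ _] := gf; have /is_ifourierP gg := ifourierP Lg.
have := FT_unique _ gg gf; rewrite expr1n => /(_ erefl).
by apply: ae_imply => x /(mulfI twopiC_neq0).
Qed.

Lemma fourierK f : inL2 f -> {ae mu, forall x, ifourier (fourier f) x = f x}.
Proof.
move=> Lf; have /is_fourierP ff := fourierP Lf.
have /is_ifourierP gg := ifourierP (inL2_fourier Lf).
have := FT_inversion _ ff; rewrite opprK sqrrN expr1n => /(_ _ erefl gg).
by apply: ae_imply => x /(mulfI twopiC_neq0).
Qed.

Lemma is_FT_fourier f : inL2 f -> is_FT (- 1) f (fourier f).
Proof. by move=> /fourierP /is_fourierP. Qed.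

Lemma ifourierK g : inL2 g -> {ae mu, forall xi, fourier (ifourier g) xi = g xi}.
Proof.
move=> Lg; have /is_ifourierP gg := ifourierP Lg.
have Lk := inL2_ifourier Lg; have ff := is_FT_fourier Lk.
(* The zero pair turns the two-term linearity of [FT_lin] into multiplication by 2 pi. *)
have f0 : is_FT (- 1) (fun=> 0 : R[i]) (fun=> 0).
  split; [exact: inL2_0|exact: inL2_0|].
  rewrite (_ : (fun n => _) = fun=> 0%E); first exact: cvg_cst.
  apply/funext => n; rewrite -[RHS](@L2norm0 R); apply: eq_L2norm => xi.
  rewrite (_ : hat _ _ xi = 0) ?subr0//.
  rewrite /hat (_ : (fun x => _) = fun x => 0 * (fun=> 0 : R[i]) x); last first.
    by apply/funext => x; rewrite /trunc !mulr0.
  rewrite cintZ ?mul0r//; split; first exact: cmeas_cst.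
  by rewrite /nint; under eq_integral do rewrite cmod0; rewrite integral0.
have ff2 := FT_lin (2 * pi)%:C ff f0.
have gg2 : is_FT 1 g (fun x => (2 * pi)%:C * ifourier g x + 0).
  by move: gg; congr is_FT; apply/funext => x; rewrite addr0.
have := FT_inversion _ gg2 ff2; rewrite expr1n => /(_ erefl).
by apply: ae_imply => x; rewrite addr0 => /(mulfI twopiC_neq0).
Qed.

(** One inequality is Bessel's for f; the other is Bessel's for the inverse transform of
    [fourier f], which is f a.e. *)
Lemma L2norm_fourier f : inL2 f ->
  L2norm (fourier f) = ((Num.sqrt (2 * pi))%:E * L2norm f)%E.
Proof.
move=> Lf; apply/eqP; rewrite eq_le.
rewrite (FT_norm_le _ (is_FT_fourier Lf)) ?sqrrN ?expr1n//=.
have /is_ifourierP gg := ifourierP (inL2_fourier Lf).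
have s0 : 0 < Num.sqrt (2 * pi) :> R by rewrite sqrtr_gt0.
have := FT_norm_le _ gg; rewrite expr1n => /(_ erefl).
rewrite L2normZ; last by apply: inL2_cmeas; apply: inL2_ifourier; exact: inL2_fourier.
rewrite cmod_real gtr0_norm// (ae_eq_L2norm _ _ (fourierK Lf)); last 2 first.
- by apply: inL2_cmeas; apply: inL2_ifourier; exact: inL2_fourier.
- exact: inL2_cmeas.
have -> : (2 * pi)%:E = ((Num.sqrt (2 * pi))%:E * (Num.sqrt (2 * pi))%:E)%E :> \bar R.
  by rewrite -EFinM -expr2 sqr_sqrtr// ltW.
by rewrite -muleA lee_pmul2l.
Qed.

Lemma L2norm_ifourier g : inL2 g ->
  L2norm g = ((Num.sqrt (2 * pi))%:E * L2norm (ifourier g))%E.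
Proof.
move=> Lg; rewrite -L2norm_fourier; last exact: inL2_ifourier.
apply: ae_eq_L2norm.
- exact: inL2_cmeas.
- by apply: inL2_cmeas; apply: inL2_fourier; exact: inL2_ifourier.
- by have := ifourierK Lg; apply: ae_imply => x ->.
Qed.

(** An equality of functions: both arguments have the same set of inverse transforms, and [xget]
    picks the same element of it. *)
Lemma eq_ifourier g h : inL2 g -> inL2 h -> {ae mu, forall x, g x = h x} ->
  ifourier g = ifourier h.
Proof.
move=> Lg Lh gh; rewrite /ifourier; congr xget; apply/seteqP.
split=> f /is_ifourierP gf; apply/is_ifourierP.
  exact: (FT_aeL gf).
by apply: (FT_aeL gf) => //; apply: ae_imply gh => x ->.
Qed.

Lemma eq_fourier g h : inL2 g -> inL2 h -> {ae mu, forall x, g x = h x} ->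
  fourier g = fourier h.
Proof.
move=> Lg Lh gh; rewrite /fourier; congr xget; apply/seteqP.
split=> f /is_fourierP gf; apply/is_fourierP.
  exact: (FT_aeL gf).
by apply: (FT_aeL gf) => //; apply: ae_imply gh => x ->.
Qed.

Lemma ifourierD g h : inL2 g -> inL2 h ->
  {ae mu, forall x, ifourier (fun xi => g xi + h xi) x = ifourier g x + ifourier h x}.
Proof.
move=> Lg Lh; have /is_ifourierP gg := ifourierP Lg; have /is_ifourierP hh := ifourierP Lh.
apply: ifourier_eq; have := FT_lin 1 gg hh; congr is_FT; apply/funext => x.
  by rewrite mul1r.
by rewrite mul1r; apply/esym; exact: mulrDr.
Qed.

End plancherel.

(** * The constant c_alpha *)

Section half_line.
Context {R : realType}.
Local Notation mu := (@lebesgue_measure R).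

Lemma ge0_integral_mkcond (A : set R) (f : R -> R) :
  (\int[mu]_(x in A) (f x)%:E = \int[mu]_x (\1_A x * f x)%:E)%E.
Proof.
rewrite integral_mkcond; apply: eq_integral => x _.
by rewrite patchE indicE; case: ifP => _; rewrite ?mul1r ?mul0r.
Qed.

Lemma integral_pos_cvg (a b : nat -> R) (f : R -> R) :
  measurable_fun [set: R] f -> (forall x, 0 < x -> 0 <= f x) ->
  (forall n, 0 < a n) -> (forall m n, (m <= n)%N -> a n <= a m) ->
  (forall m n, (m <= n)%N -> b m <= b n) ->
  (forall x, 0 < x -> exists n, a n <= x <= b n) ->
  (\int[mu]_(x in `[a n, b n]) (f x)%:E)%E @[n --> \oo] -->
  (\int[mu]_(x in `]0%R, +oo[) (f x)%:E)%E.
Proof.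
move=> mf f0 a0 ha hb cov.
have -> : `]0%R, +oo[%classic = \bigcup_n `[a n, b n]%classic.
  apply/seteqP; split=> x /=; rewrite in_itv/= ?andbT.
    by move=> /cov[n nx]; exists n => //=; rewrite in_itv.
  by case=> n _ /=; rewrite in_itv/= => /andP[anx _]; exact: lt_le_trans anx.
apply: ge0_nondecreasing_set_cvg_integral => //.
- move=> m n mn; apply/subsetPset => x /=; rewrite !in_itv/= => /andP[h1 h2].
  by rewrite (le_trans (ha _ _ mn) h1) (le_trans h2 (hb _ _ mn)).
- move=> n; apply/measurable_EFinP; exact: measurable_funTS.
- move=> n x /=; rewrite in_itv/= => /andP[anx _]; rewrite lee_fin f0//.
  exact: lt_le_trans anx.
Qed.

Lemma harmonic_cover (x : R) : 0 < x -> exists n, n.+1%:R^-1 <= x <= n.+1%:R.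
Proof.
move=> x0; exists (maxn (Num.truncn x) (Num.truncn x^-1)); apply/andP; split.
  rewrite invf_ple ?posrE//; apply: (le_trans (ltW (truncnS_gt _))).
  by rewrite ler_nat ltnS leq_maxr.
apply: (le_trans (ltW (truncnS_gt _))); by rewrite ler_nat ltnS leq_maxl.
Qed.

Lemma integral_even (f : R -> R) : measurable_fun [set: R] f -> (forall x, 0 <= f x) ->
  (forall x, f (- x) = f x) ->
  (\int[mu]_x (f x)%:E = \int[mu]_(x in `]0%R, +oo[) (f x)%:E + \int[mu]_(x in `]0%R, +oo[) (f x)%:E)%E.
Proof.
move=> mf f0 ef.
have mi (A : set R) : measurable A -> measurable_fun [set: R] (\1_A : R -> R).
  by move=> mA; exact: measurable_indic.
have mp : measurable_fun [set: R] (fun x => \1_`]0%R, +oo[ x * f x).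
  by apply: measurable_funM => //; exact: mi.
have p0 x : 0 <= \1_`]0%R, +oo[ x * f x by rewrite mulr_ge0// indicE ler0n.
have h : (\int[mu]_x (\1_`]0%R, +oo[ (- x) * f (- x))%:E =
    \int[mu]_x (\1_`]0%R, +oo[ x * f x)%:E)%E.
  apply: (@integral_opp _ (fun x => (\1_`]0%R, +oo[ x * f x)%:E)).
    exact/measurable_EFinP.
  by move=> x; rewrite lee_fin.
rewrite [RHS](_ : _ = (\int[mu]_x (\1_`]0%R, +oo[ x * f x)%:E +
    \int[mu]_x (\1_`]0%R, +oo[ (- x) * f (- x))%:E)%E); last first.
  by rewrite h ge0_integral_mkcond.
have mn : measurable_fun [set: R] (fun x => \1_`]0%R, +oo[ (- x) * f (- x)).
  have mo : measurable_fun [set: R] (fun u : R => - u) by exact: measurable_funN.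
  exact: (measurableT_comp mp mo).
rewrite -ge0_integralD//; last 4 first.
- by move=> x _; rewrite lee_fin.
- exact/measurable_EFinP.
- by move=> x _; rewrite lee_fin.
- exact/measurable_EFinP.
apply: ae_eq_integral => //.
- exact/measurable_EFinP.
- by apply: emeasurable_funD; exact/measurable_EFinP.
(* The two open half-lines miss only the origin. *)
exists [set 0]; split; first exact: measurable_set1.
  exact: lebesgue_measure_set1.
move=> x /= hx; apply: contrapT => /eqP x0; apply: hx => _.
rewrite ef !indicE -EFinD -mulrDl; congr EFin; rewrite -[LHS]mul1r; congr (_ * _).
have [xp|xn] := ltP 0 x.
  rewrite mem_set ?memNset/= ?in_itv/= ?andbT ?oppr_gt0 ?addr0//.
  by apply/negP; rewrite -leNgt ltW.
have {x0}xn : x < 0 by rewrite lt_neqAle x0.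
rewrite memNset ?mem_set/= ?in_itv/= ?andbT ?oppr_gt0 ?add0r//.
by apply/negP; rewrite -leNgt ltW.
Qed.

Lemma measurable_powR_norm (p : R) : measurable_fun [set: R] (fun x : R => `|x| `^ p).
Proof. by apply: (measurableT_comp (measurable_powR p)); exact: normr_measurable. Qed.

Lemma within_continuous_pos (f : R -> R) (a b : R) : 0 < a ->
  (forall x, 0 < x -> {for x, continuous f}) -> {within `[a, b], continuous f}.
Proof.
move=> a0 cf; apply: continuous_in_subspaceT => x; rewrite inE/= in_itv/= => /andP[ax _].
by apply: cf; exact: lt_le_trans ax.
Qed.

Lemma is_derive_continuous (f : R -> R) (x d : R) :
  is_derive x (1 : R) f d -> {for x, continuous f}.
Proof.
by move=> [df _]; apply: differentiable_continuous; exact/derivable1_diffP.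
Qed.

Lemma FTC_pos (F f : R -> R) (a b : R) : 0 < a -> a < b ->
  (forall x : R, 0 < x -> is_derive x (1 : R) F (f x)) ->
  (forall x, 0 < x -> {for x, continuous f}) ->
  (\int[mu]_(x in `[a, b]) (f x)%:E)%E = (F b - F a)%:E.
Proof.
move=> a0 ab dF cf; have b0 := lt_trans a0 ab.
rewrite (@continuous_FTC2 _ f F)//.
- exact: within_continuous_pos.
- split.
  + move=> x; rewrite in_itv/= => /andP[ax _].
    by have [] := dF x (lt_trans a0 ax).
  + by apply: cvg_at_right_filter; exact: (is_derive_continuous (dF a a0)).
  + by apply: cvg_at_left_filter; exact: (is_derive_continuous (dF b b0)).
- move=> x; rewrite in_itv/= => /andP[ax _]; rewrite derive1E.
  by have [_] := dF x (lt_trans a0 ax).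
Qed.

Lemma is_derive_powR_prim (p x : R) : p != 0 -> 0 < x ->
  is_derive x (1 : R) (fun x => x `^ p / p) (x `^ (p - 1)).
Proof.
move=> p0 x0; have := is_derive1_powR p x0 => d.
by apply: is_derive_eq; rewrite /GRing.scale/=; field.
Qed.

Lemma powR_continuous_pos (p x : R) : 0 < x -> {for x, continuous (fun x => x `^ p)}.
Proof. by move=> x0; exact: (is_derive_continuous (is_derive1_powR p x0)). Qed.

Lemma integral_powR_itv (p a b : R) : p != 0 -> 0 < a -> a < b ->
  (\int[mu]_(x in `[a, b]) (x `^ (p - 1))%:E)%E = (b `^ p / p - a `^ p / p)%:E.
Proof.
move=> p0 a0 ab; apply: (@FTC_pos (fun x => x `^ p / p) (fun x => x `^ (p - 1))) => //.
- by move=> x; exact: is_derive_powR_prim.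
- by move=> x; exact: powR_continuous_pos.
Qed.

End half_line.

(** * Gamma values as moments of the Gaussian on the half-line *)

Section gamma_moments.
Context {R : realType}.
Local Notation mu := (@lebesgue_measure R).

Lemma measurable_gamma_integrand (z : R) :
  measurable_fun [set: R] (fun y : R => y `^ z * expR (- y)).
Proof.
apply: measurable_funM; first exact: measurable_powR.
by apply: measurableT_comp => //; exact: measurable_funN.
Qed.

Lemma measurable_moment (p : R) : measurable_fun [set: R] (fun x : R => x `^ p * gauss 1 x).
Proof. by apply: measurable_funM; [exact: measurable_powR|exact: measurable_gauss]. Qed.

Lemma gauss1E (x : R) : gauss 1 x = expR (- (x ^+ 2 / 2)).
Proof. by rewrite /gauss expr1n mul1r mulNr. Qed.

Lemma gamma_substitution (p x : R) : 0 < x ->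
  (x ^+ 2 / 2) `^ ((p - 1) / 2) * expR (- (x ^+ 2 / 2)) * x =
  2 `^ ((1 - p) / 2) * (x `^ p * gauss 1 x).
Proof.
move=> x0; have x0' := ltW x0; have i2 : 0 <= 2^-1 :> R by rewrite invr_ge0.
rewrite gauss1E powRM ?exprn_ge0//.
have -> : (x ^+ 2) `^ ((p - 1) / 2) = x `^ (p - 1).
  by rewrite -(@powR_mulrn _ x 2)// -powRrM; congr (_ `^ _); field.
have -> : (2^-1 : R) `^ ((p - 1) / 2) = 2 `^ ((1 - p) / 2).
  by rewrite -(@powR_inv1 _ 2)// -powRrM; congr (_ `^ _); field.
have -> : x `^ p = x `^ (p - 1) * x.
  by rewrite -{3}(powRr1 x0') -powRD ?subrK//; apply/implyP => _; rewrite gt_eqF.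
by ring.
Qed.

(** The substitution y = x^2 / 2, made on compact intervals away from 0, where the possibly negative
    powers are continuous. *)
Lemma gamma_moment_itv (p a b : R) : 0 < a -> a < b ->
  (\int[mu]_(y in `[(a ^+ 2 / 2)%R, (b ^+ 2 / 2)%R]) (y `^ ((p - 1) / 2) * expR (- y))%:E =
   \int[mu]_(x in `[a, b]) (2 `^ ((1 - p) / 2) * (x `^ p * gauss 1 x))%:E)%E.
Proof.
move=> a0 ab.
have dF (x : R) : is_derive x (1 : R) (fun x => x ^+ 2 / 2 : R) x.
  by apply: is_derive_eq; rewrite /GRing.scale/=; field.
have F'E : derive1 (fun x : R => x ^+ 2 / 2) = id.
  by apply/funext => x; rewrite derive1E; have [_] := dF x.
rewrite (@integration_by_substitution_increasing _ (fun x => x ^+ 2 / 2)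
  (fun y => y `^ ((p - 1) / 2) * expR (- y)) a b (ltW ab)).
- rewrite F'E; apply: eq_integral => x; rewrite inE/= in_itv/= => /andP[ax _].
  have x0 : 0 < x := lt_le_trans a0 ax.
  by congr EFin; exact: gamma_substitution.
- move=> x y; rewrite !in_itv/= => /andP[ax _] /andP[ay _] xy.
  by rewrite ltr_pM2r// ltr_pXn2r ?nnegrE// ltW// (lt_le_trans a0).
- by rewrite F'E => x _; exact: cvg_id.
- by rewrite F'E; apply/cvg_ex; exists a; apply: cvg_at_right_filter; exact: cvg_id.
- by rewrite F'E; apply/cvg_ex; exists b; apply: cvg_at_left_filter; exact: cvg_id.
- split.
  + by move=> x _; have [] := dF x.
  + by apply: cvg_at_right_filter; exact: (is_derive_continuous (dF a)).
  + by apply: cvg_at_left_filter; exact: (is_derive_continuous (dF b)).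
- apply: within_continuous_pos; first by rewrite divr_gt0// exprn_gt0.
  move=> x x0; apply: continuousM; first exact: powR_continuous_pos.
  by apply: continuous_comp; [exact: opp_continuous|exact: continuous_expR].
Qed.

Definition pos_moment (p : R) : \bar R :=
  (\int[mu]_(x in `]0%R, +oo[) (x `^ p * gauss 1 x)%:E)%E.

Lemma gamma_pos_moment (p : R) :
  (\int[mu]_(y in `]0%R, +oo[) (y `^ ((p + 1) / 2 - 1) * expR (- y))%:E =
   (2 `^ ((1 - p) / 2))%:E * pos_moment p)%E.
Proof.
have -> : (p + 1) / 2 - 1 = (p - 1) / 2 by field.
have mE : measurable_fun (`]0%R, +oo[%classic : set R) (fun x : R => (x `^ p * gauss 1 x)%:E).
  by apply/measurable_EFinP/measurable_funTS; exact: measurable_moment.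
rewrite /pos_moment -ge0_integralZl ?lee_fin ?powR_ge0//; last first.
  by move=> x _; rewrite lee_fin mulr_ge0 ?powR_ge0 ?gauss_ge0.
(* The shift by 2 ensures [a n] < 1 < [b n], so that each interval is nondegenerate from n = 0
   on. *)
pose a (n : nat) : R := n.+2%:R^-1; pose b (n : nat) : R := n.+2%:R.
have a0 n : 0 < a n by rewrite /a invr_gt0.
have ab n : a n < b n.
  by apply: (@lt_trans _ _ 1); rewrite /a /b ?invf_lt1// ltr1n.
have ha m n : (m <= n)%N -> a n <= a m.
  by move=> mn; rewrite /a lef_pV2 ?posrE// ler_nat.
have hb m n : (m <= n)%N -> b m <= b n by move=> mn; rewrite ler_nat.
have cov x : 0 < x -> exists n, a n <= x <= b n.
  move=> /harmonic_cover[n /andP[h1 h2]]; exists n; apply/andP; split.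
    by apply: le_trans h1; rewrite lef_pV2 ?posrE// ler_nat.
  by apply: (le_trans h2); rewrite ler_nat.
have sq (x y : R) : 0 < x -> x <= y -> x ^+ 2 / 2 <= y ^+ 2 / 2.
  move=> x0 xy; rewrite ler_pM2r// ler_pXn2r ?nnegrE// ltW//.
  exact: lt_le_trans xy.
have L1 := @integral_pos_cvg _ (fun n => a n ^+ 2 / 2) (fun n => b n ^+ 2 / 2) _
  (measurable_gamma_integrand ((p - 1) / 2)).
have {}L1 := L1 (fun x x0 => mulr_ge0 (powR_ge0 _ _) (expR_ge0 _)).
have {}L1 := L1 (fun n => divr_gt0 (exprn_gt0 _ (a0 n)) (ltr0Sn _ 1)).
have {}L1 := L1 (fun m n mn => sq _ _ (a0 n) (ha m n mn)).
have {}L1 := L1 (fun m n mn => sq _ _ (lt_trans (a0 m) (ab m)) (hb m n mn)).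
have L2 := @integral_pos_cvg _ a b (fun x => 2 `^ ((1 - p) / 2) * (x `^ p * gauss 1 x))
  (measurable_funM (measurable_cst _) (measurable_moment p))
  (fun x _ => mulr_ge0 (powR_ge0 _ _) (mulr_ge0 (powR_ge0 _ _) (gauss_ge0 _ _)))
  a0 ha hb cov.
have cov2 x : 0 < x -> exists n, a n ^+ 2 / 2 <= x <= b n ^+ 2 / 2.
  move=> x0; have [|n /andP[h1 h2]] := cov (Num.sqrt (2 * x)).
    by rewrite sqrtr_gt0 mulr_gt0.
  have e : x = Num.sqrt (2 * x) ^+ 2 / 2.
    by rewrite sqr_sqrtr ?mulr_ge0 ?ltW//; field.
  exists n; rewrite {1 2}e sq//= sq// sqrtr_gt0 mulr_gt0//.
apply: (cvg_unique _ (L1 cov2)) => //.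
apply: cvg_trans L2; apply: near_eq_cvg; apply: nearW => n.
by rewrite gamma_moment_itv.
Qed.

(** On the half-line x^p <= 1 + x, and the Gaussian and its first absolute moment are integrable. *)
Lemma pos_moment_lty (p : R) : 0 < p < 1 -> (pos_moment p < +oo)%E.
Proof.
move=> /andP[p0 p1].
have mg : measurable_fun [set: R] (gauss 1 : R -> R) := measurable_gauss 1.
apply: (@le_lt_trans _ _ (\int[mu]_x (gauss 1 x + `|x * gauss 1 x|)%:E)%E); last first.
  have mg2 : measurable_fun [set: R] (fun x : R => `|x * gauss 1 x|).
    by apply: measurableT_comp => //; exact: measurable_funM.
  have /measurable_EFinP mgE := mg; have /measurable_EFinP mg2E := mg2.
  under eq_integral do rewrite EFinD.
  rewrite ge0_integralD//; last by move=> x _; rewrite lee_fin gauss_ge0.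
  rewrite lte_add_pinfty//; first by rewrite integral_gauss// ltry.
  by have /integrableP[] := @integrable_gauss_moment R 1 ltr01.
rewrite /pos_moment ge0_integral_mkcond; apply: ge0_integral_le.
- by apply: measurable_funM; [exact: measurable_indic|exact: measurable_moment].
- by apply: measurable_funD => //; apply: measurableT_comp => //; exact: measurable_funM.
- by move=> x; rewrite mulr_ge0 ?mulr_ge0 ?powR_ge0 ?gauss_ge0// indicE ler0n.
- move=> x; rewrite indicE; have [/set_mem/=|_] := boolP (x \in `]0%R, +oo[%classic); last first.
    by rewrite mul0r addr_ge0 ?gauss_ge0.
  rewrite in_itv/= andbT => x0; rewrite mul1r normrM (gtr0_norm x0) (ger0_norm (gauss_ge0 _ _)).
  rewrite -[X in _ <= X + _]mul1r -mulrDl ler_wpM2r ?gauss_ge0//.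
  have [x1|x1] := leP x 1.
    apply: (@le_trans _ _ (x `^ 0)); first by rewrite ger_powR ?x0// ltW.
    by rewrite powRr0 lerDl ltW.
  apply: (@le_trans _ _ (x `^ 1)); first by rewrite ler_powR// ltW.
  by rewrite powRr1 ?lerDr// ltW.
Qed.

Lemma pos_moment_gt0 (p : R) : 0 < p < 1 -> (0 < pos_moment p)%E.
Proof.
move=> /andP[p0 p1].
have g2 : 0 < gauss 1 2 :> R by exact: expR_gt0.
have m12 : (\int[mu]_x (gauss 1 2 * \1_`[1%R, 2%R] x)%:E = (gauss 1 2 : R)%:E)%E.
  have mi : measurable_fun [set: R] (fun x : R => (\1_`[1%R, 2%R] x)%:E : \bar R).
    by apply/measurable_EFinP; exact: measurable_indic.
  under eq_integral do rewrite EFinM.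
  rewrite ge0_integralZl//; last by rewrite lee_fin ltW.
  rewrite integral_indic//= setIT lebesgue_measure_itv/= lte_fin ltr1n/= -EFinB.
  by rewrite -EFinM; congr EFin; rewrite (_ : 2 - 1 = 1) ?mulr1//; ring.
apply: (@lt_le_trans _ _ (gauss 1 2 : R)%:E); first by rewrite lte_fin.
rewrite -m12 /pos_moment [leRHS]ge0_integral_mkcond; apply: ge0_integral_le.
- by apply: measurable_funM => //; exact: measurable_indic.
- by apply: measurable_funM; [exact: measurable_indic|exact: measurable_moment].
- by move=> x; rewrite mulr_ge0 ?gauss_ge0// indicE ler0n.
- move=> x; rewrite !indicE; have [/set_mem/=|_] := boolP (x \in `[1%R, 2%R]%classic); last first.
    by rewrite mulr0 mulr_ge0 ?mulr_ge0 ?powR_ge0 ?gauss_ge0// ler0n.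
  rewrite in_itv/= => /andP[x1 x2]; have x0 : 0 < x by exact: lt_le_trans x1.
  rewrite mem_set/= ?in_itv/= ?x0// mul1r mulr1.
  rewrite -[leLHS]mul1r ler_pM ?gauss_ge0//.
    by rewrite -(powRr0 x) ler_powR// ltW.
  rewrite !gauss1E ler_expR lerN2 ler_pM2r// ler_pXn2r ?nnegrE// ltW//.
Qed.

End gamma_moments.

(** * The multiplier integral and its value in terms of Gaussian moments *)

Section fractional_constant.
Context {R : realType}.
Local Notation mu := (@lebesgue_measure R).
Variables (alpha : R) (alpha01 : 0 < alpha < 1).

Let a0 : 0 < alpha. Proof. by case/andP: alpha01. Qed.
Let a1' : 1 + alpha != 0. Proof. by rewrite gt_eqF// addr_gt0. Qed.

(* |eta|^-(1 + alpha), with the value 0 at eta = 0. *)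
Definition frac_kernel (eta : R) : R := (`|eta| `^ (1 + alpha))^-1.

Lemma frac_kernel_ge0 eta : 0 <= frac_kernel eta.
Proof. by rewrite invr_ge0 powR_ge0. Qed.

Lemma measurable_frac_kernel : measurable_fun [set: R] frac_kernel.
Proof.
rewrite (_ : frac_kernel = fun eta => `|eta| `^ (- (1 + alpha))); last first.
  by apply/funext => eta; rewrite powRN.
exact: measurable_powR_norm.
Qed.

Lemma frac_kernelN eta : frac_kernel (- eta) = frac_kernel eta.
Proof. by rewrite /frac_kernel normrN. Qed.

Lemma frac_kernelM (c eta : R) : 0 < c ->
  frac_kernel (c * eta) = (c `^ (1 + alpha))^-1 * frac_kernel eta.
Proof.
by move=> c0; rewrite /frac_kernel normrM gtr0_norm// powRM ?(ltW c0)// invfM.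
Qed.

Lemma integral_gauss_derivative (eta : R) : 0 < eta ->
  (\int[mu]_(s in `[0%R, eta]) (s * gauss 1 s)%:E)%E = (1 - gauss 1 eta)%:E.
Proof.
move=> e0.
have d (s : R) : is_derive s (1 : R) (fun s => - gauss 1 s) (s * gauss 1 s).
  have dg := is_derive_gauss 1 s.
  by apply: is_derive_eq; ring.
have cg (s : R) : {for s, continuous (gauss 1 : R -> R)}.
  exact: (is_derive_continuous (is_derive_gauss 1 s)).
rewrite (@continuous_FTC2 _ (fun s => s * gauss 1 s) (fun s => - gauss 1 s))//.
- by rewrite -EFinB; congr EFin; rewrite [gauss 1 0]gauss1E expr0n/= mul0r oppr0 expR0; ring.
- apply: continuous_subspaceT => s; apply: cvgM; [exact: cvg_id|exact: cg].
- split.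
  + by move=> s _; have [] := d s.
  + by apply: cvg_at_right_filter; exact: (is_derive_continuous (d 0)).
  + by apply: cvg_at_left_filter; exact: (is_derive_continuous (d eta)).
- by move=> s _; rewrite derive1E; have [_] := d s.
Qed.

Lemma powR_cvgy (p : R) : 0 < p -> x `^ p @[x --> +oo] --> +oo.
Proof.
move=> p0; apply/cvgryPge => A; near=> x; apply: (le_trans (ler_norm A)).
have pn : p != 0 by rewrite gt_eqF.
rewrite -(powRr1 (normr_ge0 A)) -(mulVf pn) powRrM.
apply: ge0_ler_powR; rewrite ?nnegrE ?powR_ge0 ?(ltW p0)//; near: x.
Unshelve. all: by end_near. Qed.

Lemma integral_powR_tail (p s : R) : 0 < p -> 0 < s ->
  (\int[mu]_(eta in `[s, +oo[) (eta `^ (- p - 1))%:E)%E = (s `^ (- p) / p)%:E.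
Proof.
move=> p0 s0; have pn0 : - p != 0 by rewrite oppr_eq0 gt_eqF.
have d (x : R) : 0 < x -> is_derive x (1 : R) (fun x => x `^ (- p) / - p) (x `^ (- p - 1)).
  by move=> x0; exact: is_derive_powR_prim.
rewrite (@ge0_continuous_FTC2y _ (fun x => x `^ (- p - 1)) (fun x => x `^ (- p) / - p) s 0).
- by rewrite -EFinB sub0r; congr EFin; field; rewrite gt_eqF.
- by move=> x _; exact: powR_ge0.
- apply: continuous_in_subspaceT => x; rewrite inE/= in_itv/= andbT => sx.
  by apply: powR_continuous_pos; exact: lt_le_trans sx.
- rewrite -(mul0r (- p)^-1); apply: cvgM; last exact: cvg_cst.
  under eq_fun do rewrite powRN.
  apply/gtr0_cvgV0; first by near=> x; rewrite powR_gt0.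
  exact: powR_cvgy.
- by move=> x sx; have [] := d x (lt_trans s0 sx).
- by apply: cvg_at_right_filter; exact: (is_derive_continuous (d s s0)).
- by move=> x; rewrite in_itv/= andbT => sx; rewrite derive1E; have [_] := d x (lt_trans s0 sx).
Unshelve. all: by end_near. Qed.

(* Tonelli, with 1 - gauss 1 eta written as the integral of s gauss 1 s over [0, eta]. *)
Lemma integral_frac_kernel_gauss :
  (\int[mu]_(eta in `]0%R, +oo[) (frac_kernel eta * (1 - gauss 1 eta))%:E =
   alpha^-1%:E * pos_moment (1 - alpha))%E.
Proof.
pose P : R -> R := \1_(`]0%R, +oo[%classic : set R).
pose Q : R -> R := \1_(`[0%R, +oo[%classic : set R).
have mP : measurable_fun [set: R] P by exact: measurable_indic.
have mQ : measurable_fun [set: R] Q by exact: measurable_indic.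
have P0 x : 0 <= P x by rewrite /P indicE ler0n.
have Q0 x : 0 <= Q x by rewrite /Q indicE ler0n.
(* The factor [Q (z.1 - z.2)] encodes z.2 <= z.1; the absolute value makes every factor nonnegative
   on the whole plane. *)
pose k (z : R * R) := P z.1 * frac_kernel z.1 * (P z.2 * Q (z.1 - z.2) * (`|z.2| * gauss 1 z.2)).
have k0 z : 0 <= k z.
  by rewrite /k !mulr_ge0 ?frac_kernel_ge0 ?gauss_ge0.
have mz1 : measurable_fun [set: R * R] (fun z : R * R => z.1) by exact: measurable_fst.
have mz2 : measurable_fun [set: R * R] (fun z : R * R => z.2) by exact: measurable_snd.
have mg : measurable_fun [set: R] (gauss 1 : R -> R) := measurable_gauss 1.
have mn : measurable_fun [set: R] (fun s : R => `|s| * gauss 1 s).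
  by apply: measurable_funM => //; exact: normr_measurable.
have mk : measurable_fun [set: R * R] k.
  apply: measurable_funM.
    exact: (measurableT_comp (measurable_funM mP measurable_frac_kernel) mz1).
  apply: measurable_funM; last exact: (measurableT_comp mn mz2).
  apply: measurable_funM; first exact: (measurableT_comp mP mz2).
  exact: (measurableT_comp mQ (measurable_funB mz1 mz2)).
have E1 eta : (\int[mu]_s (k (eta, s))%:E = (P eta * (frac_kernel eta * (1 - gauss 1 eta)))%:E)%E.
  have [e0|e0] := ltP 0 eta; last first.
    have -> : P eta = 0 by rewrite /P indicE memNset//= in_itv/= andbT; apply/negP; rewrite -leNgt.
    rewrite mul0r; transitivity (\int[mu]_(s in [set: R]) (0 : \bar R))%E; last by rewrite integral0.
    apply: eq_integral => s _; rewrite /k /=.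
    have -> : P eta = 0 by rewrite /P indicE memNset//= in_itv/= andbT; apply/negP; rewrite -leNgt.
    by rewrite !mul0r.
  have Pe : P eta = 1 by rewrite /P indicE mem_set//= in_itv/= andbT.
  rewrite Pe mul1r EFinM -(integral_gauss_derivative e0).
  rewrite [in RHS]ge0_integral_mkcond -ge0_integralZl ?lee_fin ?frac_kernel_ge0//.
  - apply: eq_integral => s _; rewrite -EFinM; congr EFin; rewrite /k /= Pe mul1r; congr (_ * _).
    have [s0|s0] := ltP 0 s.
      have -> : P s = 1 by rewrite /P indicE mem_set//= in_itv/= andbT.
      rewrite mul1r gtr0_norm//; congr (_ * _); rewrite /Q !indicE.
      have [se|se] := leP s eta; first by rewrite !mem_set//= in_itv/= ?andbT ?subr_ge0// ltW.
      rewrite !memNset//= in_itv/= ?andbT ?subr_ge0.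
        by move=> /andP[_]; rewrite leNgt se.
      by rewrite leNgt se.
    have -> : P s = 0 by rewrite /P indicE memNset//= in_itv/= andbT; apply/negP; rewrite -leNgt.
    rewrite !mul0r; move: s0; rewrite le_eqVlt => /predU1P[->|s0]; first by rewrite mul0r mulr0.
    rewrite indicE memNset ?mul0r//= in_itv/= => /andP[+ _].
    by apply/negP; rewrite -ltNge.
  - apply/measurable_EFinP; apply: measurable_funM; first exact: measurable_indic.
    exact: measurable_funM.
  - move=> s _; rewrite lee_fin indicE; have [/set_mem/=|_] := boolP (s \in _); last by rewrite mul0r.
    by rewrite in_itv/= => /andP[s0 _]; rewrite mul1r mulr_ge0 ?gauss_ge0.
have E2 s : (\int[mu]_eta (k (eta, s))%:E = (P s * (alpha^-1 * (s `^ (1 - alpha) * gauss 1 s)))%:E)%E.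
  have [s0|s0] := ltP 0 s; last first.
    have Ps : P s = 0 by rewrite /P indicE memNset//= in_itv/= andbT; apply/negP; rewrite -leNgt.
    rewrite Ps mul0r; transitivity (\int[mu]_(eta in [set: R]) (0 : \bar R))%E; last by rewrite integral0.
    by apply: eq_integral => eta _; rewrite /k /= Ps !(mul0r, mulr0).
  have Ps : P s = 1 by rewrite /P indicE mem_set//= in_itv/= andbT.
  have -> : P s * (alpha^-1 * (s `^ (1 - alpha) * gauss 1 s)) =
      (s * gauss 1 s) * (s `^ (- alpha) / alpha).
    rewrite Ps mul1r powRD; last by apply/implyP => _; rewrite gt_eqF.
    by rewrite powRr1 ?(ltW s0)//; ring.
  rewrite [in RHS]EFinM -(integral_powR_tail a0 s0).
  rewrite [in RHS]ge0_integral_mkcond -ge0_integralZl ?lee_fin ?mulr_ge0 ?gauss_ge0 ?(ltW s0)//.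
  - apply: eq_integral => eta _; rewrite -EFinM; congr EFin; rewrite /k /= Ps mul1r gtr0_norm//.
    rewrite mulrA [RHS]mulrC; congr (_ * _).
    have [se|se] := leP s eta.
      have e0 : 0 < eta by exact: lt_le_trans se.
      have -> : P eta = 1 by rewrite /P indicE mem_set//= in_itv/= andbT.
      have -> : Q (eta - s) = 1 by rewrite /Q indicE mem_set//= in_itv/= andbT subr_ge0.
      rewrite indicE mem_set/= ?in_itv/= ?se// mulr1 !mul1r /frac_kernel gtr0_norm// -powRN.
      by congr (_ `^ _); ring.
    have -> : Q (eta - s) = 0.
      by rewrite /Q indicE memNset//= in_itv/= andbT; apply/negP; rewrite -ltNge subr_lt0.
    rewrite indicE memNset ?mul0r ?mulr0//= in_itv/= andbT.
    by apply/negP; rewrite -ltNge.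
  - apply/measurable_EFinP; apply: measurable_funM; first exact: measurable_indic.
    exact: measurable_powR.
  - by move=> eta _; rewrite lee_fin mulr_ge0 ?powR_ge0// indicE ler0n.
rewrite ge0_integral_mkcond.
have -> : (\int[mu]_x (\1_`]0%R, +oo[ x * (frac_kernel x * (1 - gauss 1 x)))%:E =
    \int[mu]_x \int[mu]_y (k (x, y))%:E)%E.
  by apply: eq_integral => x _; rewrite E1.
rewrite (tonelli mk k0) /pos_moment -ge0_integralZl ?lee_fin ?invr_ge0 ?ltW//.
- rewrite [RHS]integral_mkcond; apply: eq_integral => s _; rewrite E2 patchE /P indicE.
  by case: ifP => _; rewrite ?mul1r ?mul0r.
- by apply/measurable_EFinP/measurable_funTS; exact: measurable_moment.
- by move=> x _; rewrite lee_fin mulr_ge0 ?powR_ge0 ?gauss_ge0.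
Qed.

(** Kept in [\bar R], since finiteness is read off later from the moment identity, in
    [frac_constE]. *)
Definition frac_const : \bar R := (\int[mu]_eta ((1 - cos eta) * frac_kernel eta)%:E)%E.

Lemma one_sub_cos_ge0 (x : R) : 0 <= 1 - cos x.
Proof. by rewrite subr_ge0 cos_le1. Qed.

Lemma measurable_one_sub_cos (x : R) : measurable_fun [set: R] (fun eta => 1 - cos (x * eta)).
Proof. by apply: measurable_funB => //; exact: measurable_cosM. Qed.

(** Homogeneity: dilation by x gives the power (1 + alpha) - 1 = alpha, after a reduction to x > 0
    by parity. *)
Lemma integral_frac_multiplier (x : R) :
  (\int[mu]_eta ((1 - cos (x * eta)) * frac_kernel eta)%:E = (`|x| `^ alpha)%:E * frac_const)%E.
Proof.
wlog x0 : x / 0 <= x.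
  move=> h; have [x0|x0] := leP 0 x; first exact: h.
  rewrite -normrN -(h (- x)); last by rewrite oppr_ge0 ltW.
  by apply: eq_integral => eta _; rewrite mulNr cosN.
rewrite ger0_norm//; move: x0; rewrite le_eqVlt => /predU1P[<-|x0].
  rewrite powR0 ?gt_eqF// mul0e; under eq_integral do rewrite mul0r cos0 subrr mul0r.
  by rewrite integral0.
pose f (eta : R) := ((1 - cos eta) * frac_kernel eta)%:E.
have mf : measurable_fun [set: R] f.
  apply/measurable_EFinP; apply: measurable_funM; last exact: measurable_frac_kernel.
  by have := measurable_one_sub_cos 1; under eq_fun do rewrite mul1r.
have f0 eta : (0 <= f eta)%E by rewrite lee_fin mulr_ge0 ?one_sub_cos_ge0 ?frac_kernel_ge0.
have h := integral_scale x0 mf f0.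
have e eta : ((1 - cos (x * eta)) * frac_kernel eta)%:E = ((x `^ (1 + alpha))%:E * f (x * eta)%R)%E.
  rewrite /f -EFinM frac_kernelM//; congr EFin; field.
  by rewrite gt_eqF// powR_gt0.
have ms : measurable_fun [set: R] (fun u : R => x * u) by exact: measurable_funM.
have mfx : measurable_fun [set: R] (fun u : R => f (x * u)) by exact: (measurableT_comp mf ms).
have px0 : (0 <= (x `^ (1 + alpha))%:E)%E by rewrite lee_fin powR_ge0.
under eq_integral do rewrite e.
rewrite (@ge0_integralZl _ _ _ mu _ measurableT _ mfx _ (fun eta _ => f0 (x * eta)) px0).
rewrite h muleA -EFinM; congr (_%:E * _)%E.
rewrite powRD; last by rewrite (negbTE a1').
by rewrite powRr1 ?ltW// mulrC mulrA mulVf ?mul1r// gt_eqF.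
Qed.

Lemma integral_gauss_one_sub_cos (eta : R) :
  (\int[mu]_x (gauss 1 x * (1 - cos (x * eta)))%:E)%E =
  (Num.sqrt (2 * pi) * (1 - gauss 1 eta))%:E.
Proof.
have i1 := @integrable_gauss R 1 ltr01.
have i2 : mu.-integrable [set: R] (EFin \o (fun x => cos (eta * x) * gauss 1 x)).
  apply: integrable_bounded_mul i1; first exact: measurable_cosM.
  by move=> x; exact: norm_cos_le1.
have h := integral_cos_gauss (@ltr01 R) eta.
transitivity (\int[mu]_x ((gauss 1 x)%:E - (cos (eta * x) * gauss 1 x)%:E))%E.
  apply: eq_integral => x _; rewrite -EFinB; congr EFin.
  by rewrite [x * eta]mulrC; ring.
rewrite (@integralB _ _ _ mu _ measurableT _ _ i1 i2) integral_gauss//.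
rewrite -[X in (_ - X)%E]fineK; last exact: (integrable_fin_num measurableT i2).
rewrite -[fine _]/(Rintegral mu [set: R] (fun x => cos (eta * x) * gauss 1 x)) h.
by rewrite divr1 invr1 -EFinB; congr EFin; ring.
Qed.

(* Integrate integral_frac_multiplier against gauss 1, in both orders. *)
Lemma frac_const_moments :
  (frac_const * (pos_moment alpha + pos_moment alpha) =
   (Num.sqrt (2 * pi))%:E * (alpha^-1%:E * (pos_moment (1 - alpha)%R + pos_moment (1 - alpha)%R)))%E.
Proof.
pose k (z : R * R) := gauss 1 z.1 * ((1 - cos (z.1 * z.2)) * frac_kernel z.2).
have k0 z : 0 <= k z by rewrite /k !mulr_ge0 ?gauss_ge0 ?one_sub_cos_ge0 ?frac_kernel_ge0.
have mz1 : measurable_fun [set: R * R] (fun z : R * R => z.1) by exact: measurable_fst.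
have mz2 : measurable_fun [set: R * R] (fun z : R * R => z.2) by exact: measurable_snd.
have mcos : measurable_fun [set: R] (@cos R).
  by apply: continuous_measurable_fun; exact: continuous_cos.
have mk : measurable_fun [set: R * R] k.
  apply: measurable_funM; first exact: (measurableT_comp (measurable_gauss 1) mz1).
  apply: measurable_funM; last exact: (measurableT_comp measurable_frac_kernel mz2).
  apply: measurable_funB => //.
  exact: (measurableT_comp mcos (measurable_funM mz1 mz2)).
have e1 : (\int[mu]_x \int[mu]_y (k (x, y))%:E =
    frac_const * (pos_moment alpha + pos_moment alpha))%E.
  pose q (x : R) := `|x| `^ alpha * gauss 1 x.
  have mq : measurable_fun [set: R] q.
    by apply: measurable_funM; [exact: measurable_powR_norm|exact: measurable_gauss].
  have q0 x : 0 <= q x by rewrite mulr_ge0 ?powR_ge0 ?gauss_ge0.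
  have -> : (pos_moment alpha + pos_moment alpha = \int[mu]_x (q x)%:E)%E.
    have qe x : q (- x) = q x by rewrite /q normrN /gauss sqrrN.
    have qp : (pos_moment alpha = \int[mu]_(x in `]0%R, +oo[) (q x)%:E)%E.
      apply: eq_integral => x; rewrite inE/= in_itv/= andbT => x0.
      by rewrite /q gtr0_norm.
    by rewrite (integral_even mq q0 qe) qp.
  rewrite -ge0_integralZl//; last 3 first.
  - exact/measurable_EFinP.
  - by move=> x _; rewrite lee_fin.
  - by apply: integral_ge0 => eta _; rewrite lee_fin mulr_ge0 ?one_sub_cos_ge0 ?frac_kernel_ge0.
  apply: eq_integral => x _; rewrite /k /=.
  under eq_integral do rewrite EFinM.
  rewrite ge0_integralZl ?lee_fin ?gauss_ge0//.
  - by rewrite integral_frac_multiplier muleA -EFinM muleC [gauss 1 x * _]mulrC.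
  - apply/measurable_EFinP; apply: measurable_funM; last exact: measurable_frac_kernel.
    exact: measurable_one_sub_cos.
  - by move=> eta _; rewrite lee_fin mulr_ge0 ?one_sub_cos_ge0 ?frac_kernel_ge0.
apply: (etrans (esym e1)); apply: (etrans (tonelli mk k0)).
have mB : measurable_fun [set: R] (fun eta => frac_kernel eta * (1 - gauss 1 eta)).
  apply: measurable_funM; first exact: measurable_frac_kernel.
  by apply: measurable_funB => //; exact: measurable_gauss.
have B0 eta : 0 <= frac_kernel eta * (1 - gauss 1 eta).
  by rewrite mulr_ge0 ?frac_kernel_ge0// subr_ge0 gauss_le1.
rewrite ge0_muleDr; last 2 first.
- by apply: integral_ge0 => x _; rewrite lee_fin mulr_ge0 ?powR_ge0 ?gauss_ge0.
- by apply: integral_ge0 => x _; rewrite lee_fin mulr_ge0 ?powR_ge0 ?gauss_ge0.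
rewrite -integral_frac_kernel_gauss.
have Be eta : frac_kernel (- eta) * (1 - gauss 1 (- eta)) = frac_kernel eta * (1 - gauss 1 eta).
  by rewrite frac_kernelN /gauss sqrrN.
rewrite -(integral_even mB B0 Be).
rewrite -ge0_integralZl ?lee_fin ?sqrtr_ge0//; last 2 first.
- exact/measurable_EFinP.
- by move=> eta _; rewrite lee_fin.
apply: eq_integral => y _; rewrite /k /=.
transitivity (\int[mu]_x ((frac_kernel y)%:E * (gauss 1 x * (1 - cos (x * y)))%:E))%E.
  by apply: eq_integral => x _; rewrite -EFinM; congr EFin; ring.
rewrite ge0_integralZl ?lee_fin ?frac_kernel_ge0//.
- by rewrite integral_gauss_one_sub_cos -!EFinM; congr EFin; ring.
- apply/measurable_EFinP; apply: measurable_funM; first exact: measurable_gauss.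
  by have := measurable_one_sub_cos y; under eq_fun do rewrite mulrC.
- by move=> x _; rewrite lee_fin mulr_ge0 ?gauss_ge0 ?one_sub_cos_ge0.
Qed.

End fractional_constant.

(** * Identification of the constant with c_alpha *)

Section fractional_constant_value.
Context {R : realType}.
Local Notation mu := (@lebesgue_measure R).
Variables (alpha : R) (alpha01 : 0 < alpha < 1).

Let a0 : 0 < alpha. Proof. by case/andP: alpha01. Qed.
Let a1 : alpha < 1. Proof. by case/andP: alpha01. Qed.
Let a01' : 0 < 1 - alpha < 1. Proof. by have := a0; have := a1; lra. Qed.

Lemma pos_moment_fin (p : R) : 0 < p < 1 -> pos_moment p = (fine (pos_moment p))%:E.
Proof.
move=> p01; rewrite fineK// ge0_fin_numE ?pos_moment_lty// ltW//.
exact: pos_moment_gt0.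
Qed.

Lemma fine_pos_moment_gt0 (p : R) : 0 < p < 1 -> 0 < fine (pos_moment p).
Proof. by move=> p01; rewrite -lte_fin -pos_moment_fin// pos_moment_gt0. Qed.

Lemma Gamma_integral_moment (p : R) : 0 < p < 1 ->
  Gamma_integral ((p + 1) / 2) = 2 `^ ((1 - p) / 2) * fine (pos_moment p).
Proof.
move=> p01; rewrite /Gamma_integral /Rintegral gamma_pos_moment pos_moment_fin//.
Qed.

(** As -alpha / 2 lies in ]-1/2, 0[, a single step of the recurrence reaches the positive argument 1
    - alpha / 2. *)
Lemma Gamma_neg_half : Gamma (- alpha / 2) = 2 `^ (alpha / 2) * fine (pos_moment (1 - alpha)) / (- alpha / 2).
Proof.
have an : (0 < - alpha / 2) = false by apply/negbTE; rewrite -leNgt; have := a0; lra.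
rewrite /Gamma an.
have -> : Num.truncn (- (- alpha / 2)) = 0%N.
  by apply/eqP; rewrite -leqn0 -ltnS truncn_lt_nat; have := a1; have := a0; lra.
rewrite big_ord1 addr0; congr (_ / _).
have -> : - alpha / 2 + 1 = ((1 - alpha) + 1) / 2 by field.
by rewrite Gamma_integral_moment//; congr (_ `^ _ * _); field.
Qed.

Lemma frac_constE : frac_const alpha = (- c_ alpha)%:E.
Proof.
have m0 := fine_pos_moment_gt0 alpha01; have m0' := fine_pos_moment_gt0 a01'.
have := frac_const_moments alpha01.
rewrite (pos_moment_fin alpha01) (pos_moment_fin a01').
set m := fine (pos_moment alpha) in m0 *; set m' := fine (pos_moment (1 - alpha)) in m0' *.
rewrite -!EFinD -!EFinM.
have K0 : (0 <= frac_const alpha)%E.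
  by apply: integral_ge0 => eta _; rewrite lee_fin mulr_ge0 ?one_sub_cos_ge0 ?frac_kernel_ge0.
have mm0 : 0 < m + m := addr_gt0 m0 m0.
(* An infinite constant is excluded here: multiplied by positive moments it would be infinite, while
   the other side is real. *)
case: (frac_const alpha) K0 => [k| |]//=; last by rewrite gt0_mulye ?lte_fin.
move=> _ [] h; congr EFin.
have -> : k = Num.sqrt (2 * pi) * (alpha^-1 * (m' + m')) / (m + m).
  by rewrite -h mulfK// gt_eqF.
have g1 : Gamma ((1 + alpha) / 2) = 2 `^ ((1 - alpha) / 2) * m.
  have pos : 0 < (1 + alpha) / 2 by have := a0; lra.
  by rewrite /Gamma pos addrC Gamma_integral_moment.
rewrite /c_ g1 Gamma_neg_half -/m' powR12_sqrt ?pi_ge0// sqrtrM// .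
have p2 (x : R) : 2 `^ x != 0 by rewrite gt_eqF// powR_gt0.
(* All powers of 2 are expressed by u = 2^(alpha / 2) and v = 2^((1 - alpha) / 2), related by u v =
   sqrt 2; what remains is a rational identity. *)
have s2 : Num.sqrt 2 = 2 `^ (alpha / 2) * 2 `^ ((1 - alpha) / 2) :> R.
  rewrite -powRD; last by rewrite (_ : (2 == 0 :> R) = false) ?implybT// pnatr_eq0.
  by rewrite -powR12_sqrt//; congr (_ `^ _); field.
have s2' : 2 `^ (- alpha) = (2 `^ (alpha / 2))^-1 * (2 `^ (alpha / 2))^-1 :> R.
  rewrite -!powRN -powRD; last by rewrite (_ : (2 == 0 :> R) = false) ?implybT// pnatr_eq0.
  by congr (_ `^ _); field.
have s22 : Num.sqrt 2 * Num.sqrt 2 = 2 :> R by rewrite -expr2 sqr_sqrtr.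
have := p2 (alpha / 2); have := p2 ((1 - alpha) / 2).
rewrite s2'; move: s2; set u := 2 `^ (alpha / 2); set v := 2 `^ ((1 - alpha) / 2) => s2 v0 u0.
have e2 : 2 = (u * v) * (u * v) :> R by rewrite -s2 s22.
rewrite s2.
have -> : - (Num.sqrt pi * (u^-1 * u^-1) * (u * m' / (- alpha / 2)) / (v * m)) =
    Num.sqrt pi * (2 * m') / (u * v * alpha * m).
  by field; rewrite v0 u0 !gt_eqF.
rewrite e2; field; rewrite v0 u0 !gt_eqF//.
Qed.

(** The integral of a nonnegative function is -c_alpha, and it cannot vanish because the other side
    of the moment identity is positive. *)
Lemma c_alpha_lt0 : c_ alpha < 0.
Proof.
rewrite -oppr_gt0 -lte_fin -frac_constE lt0e; apply/andP; split; last first.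
  by apply: integral_ge0 => eta _; rewrite lee_fin mulr_ge0 ?one_sub_cos_ge0 ?frac_kernel_ge0.
apply/eqP => K0; have := frac_const_moments alpha01.
rewrite K0 mul0e => /esym/eqP.
rewrite (pos_moment_fin a01') -!EFinD -!EFinM eqe.
have m0' := fine_pos_moment_gt0 a01'.
by apply/negP; rewrite gt_eqF// mulr_gt0 ?sqrtr_gt0 ?mulr_gt0 ?pi_gt0 ?invr_gt0 ?addr_gt0.
Qed.

End fractional_constant_value.

(** * Schur's test and the kernel of Phi *)

Section schur.
Context {R : realType}.
Local Notation mu := (@lebesgue_measure R).

Lemma poweR_half_sqr (x : \bar R) : (0 <= x)%E -> (poweR x 2^-1 * poweR x 2^-1 = x)%E.
Proof.
case: x => [r| |]//=.
- by rewrite lee_fin => r0; rewrite -EFinM powR12_sqrt// -expr2 sqr_sqrtr.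
- by move=> _; rewrite invr_eq0 (negbTE (_ : 2 != 0))//= mulyy.
Qed.

(** Hoelder's inequality for the factors sqrt k and sqrt k f. Squares appear as products because the
    integrals may be infinite. *)
Lemma weighted_cauchy_schwarz (k f : R -> R) :
  measurable_fun [set: R] k -> measurable_fun [set: R] f ->
  (forall x, 0 <= k x) -> (forall x, 0 <= f x) ->
  ((\int[mu]_x (k x * f x)%:E) * (\int[mu]_x (k x * f x)%:E) <=
   (\int[mu]_x (k x)%:E) * (\int[mu]_x (k x * f x ^+ 2)%:E))%E.
Proof.
move=> mk mf k0 f0.
have mq : measurable_fun [set: R] (fun x => Num.sqrt (k x)).
  apply: (@measurableT_comp _ _ _ _ _ _ (@Num.sqrt R)) => //.
  by apply: continuous_measurable_fun; exact: sqrt_continuous.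
have mqf : measurable_fun [set: R] (fun x => Num.sqrt (k x) * f x) by exact: measurable_funM.
have := @hoelder _ _ _ mu _ _ 2 2 mq mqf.
rewrite !Lnorm2E Lnorm1 => /(_ _ _ _) h.
have {}h : (\int[mu]_x (k x * f x)%:E <=
    poweR (\int[mu]_x (k x)%:E) 2^-1 * poweR (\int[mu]_x (k x * f x ^+ 2)%:E) 2^-1)%E.
  have e1 : (\int[mu]_x (Num.sqrt (k x) ^+ 2)%:E = \int[mu]_x (k x)%:E)%E.
    by apply: eq_integral => x _; rewrite sqr_sqrtr.
  have e2 : (\int[mu]_x ((Num.sqrt (k x) * f x) ^+ 2)%:E = \int[mu]_x (k x * f x ^+ 2)%:E)%E.
    by apply: eq_integral => x _; rewrite exprMn sqr_sqrtr.
  rewrite -e1 -e2; apply: le_trans (h _ _ _) => //; last by field.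
  rewrite le_eqVlt; apply/orP; left; apply/eqP; apply: eq_integral => x _ /=.
  by rewrite mulrA -expr2 sqr_sqrtr// ger0_norm// mulr_ge0.
have I0 : (0 <= \int[mu]_x (k x * f x)%:E)%E.
  by apply: integral_ge0 => x _; rewrite lee_fin mulr_ge0.
apply: le_trans (lee_pmul I0 I0 h h) _.
rewrite muleACA !poweR_half_sqr//.
  by apply: integral_ge0 => x _; rewrite lee_fin mulr_ge0 ?sqr_ge0.
by apply: integral_ge0 => x _; rewrite lee_fin.
Qed.

(** Cauchy-Schwarz with respect to the measure k (x, y) dy brings out the bound A on the mass of
    each row; Tonelli then brings out the bound B on the columns. *)
Lemma schur_test (k : R * R -> R) (f : R -> R) (A B : R) :
  measurable_fun [set: R * R] k -> measurable_fun [set: R] f ->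
  (forall z, 0 <= k z) -> (forall x, 0 <= f x) -> 0 <= A -> 0 <= B ->
  (forall x, (\int[mu]_y (k (x, y))%:E <= A%:E)%E) ->
  (forall y, (\int[mu]_x (k (x, y))%:E <= B%:E)%E) ->
  (\int[mu]_x ((\int[mu]_y (k (x, y) * f y)%:E) * (\int[mu]_y (k (x, y) * f y)%:E)) <=
   (A * B)%:E * \int[mu]_x (f x ^+ 2)%:E)%E.
Proof.
move=> mk mf k0 f0 A0 B0 kA kB.
have mf2 : measurable_fun [set: R * R] (fun z : R * R => f z.2).
  exact: (measurableT_comp mf measurable_snd).
pose k1 (z : R * R) := k z * f z.2; pose k2 (z : R * R) := k z * f z.2 ^+ 2.
have mk1 : measurable_fun [set: R * R] k1 by exact: measurable_funM.
have mk2 : measurable_fun [set: R * R] k2.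
  by apply: measurable_funM => //; exact: measurable_funX.
have k10 z : 0 <= k1 z by rewrite /k1 mulr_ge0.
have k20 z : 0 <= k2 z by rewrite /k2 mulr_ge0 ?sqr_ge0.
have mT := measurable_integral2 mk1 k10.
have mU := measurable_integral2 mk2 k20.
have T0 x : (0 <= \int[mu]_y (k1 (x, y))%:E)%E.
  by apply: integral_ge0 => y _; rewrite lee_fin.
have U0 x : (0 <= \int[mu]_y (k2 (x, y))%:E)%E.
  by apply: integral_ge0 => y _; rewrite lee_fin.
apply: (@le_trans _ _ (\int[mu]_x (A%:E * \int[mu]_y (k2 (x, y))%:E))%E).
  apply: ge0_le_integral => //.
  - by move=> x _; exact: mule_ge0 (T0 x) (T0 x).
  - exact: emeasurable_funM.
  - exact: measurable_funeM.
  move=> x _; apply: (le_trans (weighted_cauchy_schwarz (measurable_section1 x mk) mf (fun y => k0 (x, y)) f0)).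
  exact: lee_wpmul2r (U0 x) _ _ (kA x).
rewrite ge0_integralZl//.
rewrite EFinM -muleA lee_wpmul2l ?lee_fin//.
rewrite (tonelli mk2 k20).
have mf2E : measurable_fun [set: R] (fun x => (f x ^+ 2)%:E).
  by apply/measurable_EFinP; exact: measurable_funX.
rewrite -ge0_integralZl ?lee_fin//; last by move=> x _; rewrite lee_fin sqr_ge0.
apply: ge0_le_integral => //.
- by move=> y _; apply: integral_ge0 => x _; rewrite lee_fin.
- have msw : measurable_fun [set: R * R] (fun z : R * R => k2 (z.2, z.1)).
    exact: (measurableT_comp mk2 (measurable_fun_pair measurable_snd measurable_fst)).
  exact: (measurable_integral2 msw (fun z => k20 _)).
- exact: measurable_funeM.
move=> y _; rewrite /k2 /=.
under eq_integral do rewrite mulrC EFinM.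
rewrite ge0_integralZl ?lee_fin ?sqr_ge0//.
- by rewrite muleC lee_wpmul2r ?lee_fin ?sqr_ge0.
- by apply/measurable_EFinP; exact: (measurable_section2 y mk).
- by move=> x _; rewrite lee_fin.
Qed.

End schur.

(** * The model kernel with a cutoff at |eta| = 1 / a *)

Section min_kernel.
Context {R : realType}.
Local Notation mu := (@lebesgue_measure R).

(** Of size a |eta|^-m near 0 and |eta|^-(1 + m) at infinity: m < 1 gives integrability at the
    origin and m > 0 at infinity. *)
Definition min_kernel (m a eta : R) : R := Num.min 1 (a * `|eta|) * frac_kernel m eta.

Lemma min_kernel_ge0 (m a eta : R) : 0 <= a -> 0 <= min_kernel m a eta.
Proof.
by move=> a0; rewrite /min_kernel mulr_ge0 ?frac_kernel_ge0// le_min ler01 mulr_ge0.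
Qed.

Lemma measurable_min_kernel (m a : R) : measurable_fun [set: R] (min_kernel m a).
Proof.
apply: measurable_funM; last exact: measurable_frac_kernel.
apply: measurable_minr => //; apply: measurable_funM => //.
Qed.

Lemma min_kernelN (m a eta : R) : min_kernel m a (- eta) = min_kernel m a eta.
Proof. by rewrite /min_kernel normrN frac_kernelN. Qed.

Lemma min_kernelM (m a eta : R) : 0 < a ->
  min_kernel m a eta = a `^ (1 + m) * min_kernel m 1 (a * eta).
Proof.
move=> a0; rewrite /min_kernel frac_kernelM// normrM (gtr0_norm a0) mul1r.
by rewrite mulrCA mulVKf// gt_eqF// powR_gt0.
Qed.

Lemma min_kernel_bound (m x : R) : 0 < m -> 0 < x ->
  min_kernel m 1 x <= \1_`]0%R, 1%R] x * x `^ ((1 - m) - 1) + \1_`[1%R, +oo[ x * x `^ (- m - 1).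
Proof.
move=> m0 x0; rewrite /min_kernel mul1r (gtr0_norm x0) /frac_kernel (gtr0_norm x0).
rewrite -powRN (_ : - (1 + m) = - m - 1); last by ring.
have [x1|x1] := leP x 1.
- rewrite !indicE mem_set/= ?in_itv/= ?x0// mul1r.
  apply: (@le_trans _ _ (x `^ ((1 - m) - 1))); last first.
    by rewrite lerDl mulr_ge0 ?powR_ge0.
  rewrite (_ : 1 - m - 1 = 1 + (- m - 1)); last by ring.
  rewrite (@powRD _ x 1); last by rewrite (gt_eqF x0) implybT.
  by rewrite (powRr1 (ltW x0)).
- rewrite !indicE memNset/= ?in_itv/= ?x0/= ?mul0r ?add0r; last by apply/negP; rewrite -ltNge.
  by rewrite mem_set/= ?in_itv/= ?(ltW x1)// mul1r.
Qed.

Lemma integral_min_kernel1 (m : R) : 0 < m < 1 ->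
  (\int[mu]_eta (min_kernel m 1 eta)%:E < +oo)%E.
Proof.
move=> /andP[m0 m1].
have mk := measurable_min_kernel m 1.
rewrite (@integral_even _ _ mk (fun x => min_kernel_ge0 m x ler01) (min_kernelN m 1)).
(* The first term is the integral of x^-m over ]0, 1], the second that of x^(-1 - m) over [1,
   +oo[. *)
suff h : (\int[mu]_(x in `]0%R, +oo[) (min_kernel m 1 x)%:E <= ((1 - m)^-1 + m^-1)%:E)%E.
  by apply: le_lt_trans (leeD h h) _; rewrite -EFinD ltry.
pose a (n : nat) : R := n.+2%:R^-1; pose b (n : nat) : R := n.+2%:R.
have a0 n : 0 < a n by rewrite /a invr_gt0.
have a1 n : a n < 1 by rewrite /a invf_lt1// ltr1n.
have ha k n : (k <= n)%N -> a n <= a k.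
  by move=> mn; rewrite /a lef_pV2 ?posrE// ler_nat.
have hb k n : (k <= n)%N -> b k <= b n by move=> mn; rewrite ler_nat.
have cov x : 0 < x -> exists n, a n <= x <= b n.
  move=> /harmonic_cover[n /andP[h1 h2]]; exists n; apply/andP; split.
    by apply: le_trans h1; rewrite lef_pV2 ?posrE// ler_nat.
  by apply: (le_trans h2); rewrite ler_nat.
have L := integral_pos_cvg mk (fun x _ => min_kernel_ge0 m x ler01) a0 ha hb cov.
apply: (cvge_to_le L); apply: nearW => n.
have n1m : 1 - m != 0 by rewrite gt_eqF// subr_gt0.
have mp (p : R) (A : set R) : measurable A ->
    measurable_fun [set: R] (fun x => \1_A x * x `^ p).
  by move=> mA; apply: measurable_funM; [exact: measurable_indic|exact: measurable_powR].
have p0 (p : R) (A : set R) x : 0 <= \1_A x * x `^ p by rewrite mulr_ge0 ?powR_ge0.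
apply: (@le_trans _ _ (\int[mu]_x (\1_`[a n, 1%R] x * x `^ ((1 - m) - 1)
    + \1_`[1%R, +oo[ x * x `^ (- m - 1))%:E)%E).
  rewrite ge0_integral_mkcond; apply: ge0_integral_le.
  - by apply: measurable_funM => //; exact: measurable_indic.
  - by apply: measurable_funD; exact: mp.
  - by move=> x; rewrite mulr_ge0 ?min_kernel_ge0.
  move=> x; rewrite {1}indicE; have [/set_mem/=|_] := boolP (x \in _); last first.
    by rewrite mul0r addr_ge0.
  rewrite in_itv/= => /andP[ax _]; rewrite mul1r.
  have x0 := lt_le_trans (a0 n) ax.
  apply: le_trans (min_kernel_bound m0 x0) _; rewrite lerD2r ler_wpM2r ?powR_ge0//.
  rewrite !indicE ler_nat.
  have [/set_mem/=|_] := boolP (x \in `]0%R, 1%R]%classic) => //.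
  by rewrite in_itv/= => /andP[_ x1]; rewrite mem_set//= in_itv/= ax.
have E1 : measurable_fun [set: R] (fun x => (\1_`[a n, 1%R] x * x `^ ((1 - m) - 1))%:E).
  by apply/measurable_EFinP; exact: mp.
have E2 : measurable_fun [set: R] (fun x => (\1_`[1%R, +oo[ x * x `^ (- m - 1))%:E).
  by apply/measurable_EFinP; exact: mp.
under eq_integral do rewrite EFinD.
rewrite (@ge0_integralD _ _ _ mu _ measurableT _ _ _ E1 _ E2)//; last 2 first.
- by move=> x _; rewrite lee_fin.
- by move=> x _; rewrite lee_fin.
rewrite -!ge0_integral_mkcond integral_powR_itv// integral_powR_tail//.
rewrite -EFinD lee_fin !powR1 !div1r lerD2r gerBl.
by rewrite divr_ge0 ?powR_ge0// subr_ge0 ltW.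
Qed.

Lemma integral_min_kernel (m : R) : 0 < m < 1 ->
  exists2 C : R, 0 <= C & forall a, 0 < a ->
  (\int[mu]_eta (min_kernel m a eta)%:E = (a `^ m * C)%:E)%E.
Proof.
move=> m01; exists (fine (\int[mu]_eta (min_kernel m 1 eta)%:E)%E).
  by rewrite fine_ge0// integral_ge0// => x _; rewrite lee_fin min_kernel_ge0.
have fk : (\int[mu]_eta (min_kernel m 1 eta)%:E)%E \is a fin_num.
  rewrite ge0_fin_numE ?integral_min_kernel1//.
  by rewrite integral_ge0// => x _; rewrite lee_fin min_kernel_ge0.
move=> a a0; rewrite EFinM fineK//.
have mkE : measurable_fun [set: R] (fun eta => (min_kernel m 1 eta)%:E).
  by apply/measurable_EFinP; exact: measurable_min_kernel.
have k0 (eta : R) : (0 <= (min_kernel m 1 eta)%:E)%E by rewrite lee_fin min_kernel_ge0.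
have maE : measurable_fun [set: R] (fun eta => (min_kernel m 1 (a * eta))%:E).
  by apply/measurable_EFinP; apply: measurableT_comp (measurable_min_kernel m 1) _; exact: measurable_funM.
under eq_integral do rewrite (min_kernelM _ _ a0) EFinM.
have aE : (0 <= (a `^ (1 + m))%:E)%E by rewrite lee_fin powR_ge0.
apply: etrans (@ge0_integralZl _ _ _ mu _ measurableT _ maE _ (fun x _ => k0 (a * x)) aE) _.
rewrite (integral_scale a0 mkE k0) muleA -EFinM; congr (_%:E * _)%E.
rewrite (@powRD _ a 1); last by rewrite (gt_eqF a0) implybT.
by rewrite (powRr1 (ltW a0)) mulrC mulrA mulVf ?mul1r// gt_eqF.
Qed.

End min_kernel.

(** * Bounds for the oscillating factor *)

Section phase.
Context {R : realType}.

Lemma norm_sin_le (x : R) : `|sin x| <= `|x|.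
Proof.
have pos (y : R) : 0 <= y -> `|sin y| <= y.
  move=> y0; have [|c _] := @MVT_segment R (@sin R) (@cos R) 0 y y0 (fun z _ => is_derive_sin z).
    by apply: continuous_subspaceT; exact: continuous_sin.
  rewrite sin0 !subr0 => ->; rewrite normrM (ger0_norm y0).
  by rewrite ler_piMl// norm_cos_le1.
have [x0|/ltW x0] := leP 0 x; first by rewrite (ger0_norm x0) pos.
by rewrite -[`|sin x|]normrN -sinN (ler0_norm x0) pos// oppr_ge0.
Qed.

Lemma cmod_cis_sub1 (x : R) : cmod (cis x - 1) = 2 * `|sin (x / 2)|.
Proof.
apply: (@pexpIrn _ 2) => //; rewrite ?nnegrE ?cmod_ge0 ?mulr_ge0//.
rewrite sqr_cmod ReD ReN ImD ImN /= exprMn real_normK ?num_real//.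
have e : x = (x / 2) *+ 2 by rewrite mulr2n; field.
have c : cos x = 1 - 2 * sin (x / 2) ^+ 2.
  by rewrite {1}e cos_mulr2n cos2sin2; ring.
have := cos2Dsin2 x; rewrite c; lra.
Qed.

Lemma cmod_cis_sub1_le2 (x : R) : cmod (cis x - 1) <= 2.
Proof. by rewrite cmod_cis_sub1 -[leRHS]mulr1 ler_wpM2l// norm_sin_le1. Qed.

Lemma cmod_cis_sub1_le (x : R) : cmod (cis x - 1) <= `|x|.
Proof.
rewrite cmod_cis_sub1; apply: (le_trans (ler_wpM2l _ (norm_sin_le _))) => //.
by rewrite normrM (ger0_norm (_ : 0 <= 2^-1))// mulrCA mulfV// mulr1.
Qed.

Lemma cmod_cis_sub1N (x : R) : cmod (cis (- x) - 1) = cmod (cis x - 1).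
Proof. by rewrite !cmod_cis_sub1 mulNr sinN normrN. Qed.

(* In Phi, zeta stands for xi + eta. *)
Definition osc (t xi zeta : R) : R := cmod (cis (t * (zeta ^+ 3 - xi ^+ 3)) - 1).

Lemma oscC t xi zeta : osc t xi zeta = osc t zeta xi.
Proof. by rewrite /osc -cmod_cis_sub1N -mulrN opprB. Qed.

Lemma osc_ge0 t xi zeta : 0 <= osc t xi zeta.
Proof. exact: cmod_ge0. Qed.

(** Where B |zeta - xi| >= 1 the trivial bound 2 is enough, whence 2 <= c. Otherwise |exp (i s) - 1|
    <= |s| is used with the factored difference of cubes, so the hypothesis on the quadratic form is
    needed in that regime only. *)
Lemma osc_le (t xi zeta B c : R) : 2 <= c ->
  0 <= B -> (B * `|zeta - xi| <= 1 ->
     `|zeta - xi| * `|zeta ^+ 2 + zeta * xi + xi ^+ 2| <= c * (B * `|zeta - xi|)) ->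
  osc t xi zeta <= c * (1 + `|t|) * Num.min 1 (B * `|zeta - xi|).
Proof.
move=> c2 B0 h; have c0 : 0 <= c by exact: le_trans c2.
have [B1|/ltW B1] := leP 1 (B * `|zeta - xi|).
  rewrite mulr1; apply: le_trans (cmod_cis_sub1_le2 _) _.
  by apply: (le_trans c2); rewrite ler_peMr// lerDl.
apply: le_trans (cmod_cis_sub1_le _) _.
have -> : zeta ^+ 3 - xi ^+ 3 = (zeta - xi) * (zeta ^+ 2 + zeta * xi + xi ^+ 2) by ring.
rewrite !normrM; apply: (le_trans (ler_wpM2l (normr_ge0 t) (h B1))).
rewrite [leRHS](_ : _ = (1 + `|t|) * (c * (B * `|zeta - xi|))); last by ring.
by rewrite ler_wpM2r ?mulr_ge0// lerDr.
Qed.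

(** In the regime that matters |zeta - xi| <= 1, since the factor 1 + zeta^2 is at least 1. Then xi
    is within 1 of zeta and the quadratic form is at most 5 (1 + zeta^2). *)
Lemma osc_le_near (t xi zeta : R) :
  osc t xi zeta <= 5 * (1 + `|t|) * Num.min 1 ((1 + zeta ^+ 2) * `|zeta - xi|).
Proof.
have z0 := sqr_ge0 zeta.
apply: osc_le => [||h]; [by lra|by lra|].
rewrite [leRHS](_ : _ = `|zeta - xi| * (5 * (1 + zeta ^+ 2))); last by ring.
apply: ler_wpM2l => //.
have e1 : `|zeta - xi| <= 1.
  by apply: le_trans h; rewrite ler_peMl// lerDl.
have e2 : (zeta - xi) ^+ 2 <= 1.
  by rewrite -[X in _ <= X](expr1n _ 2) -real_normK ?num_real// ler_pXn2r ?nnegrE.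
have f1 : 0 <= xi ^+ 2 by exact: sqr_ge0.
have f2 : 0 <= (2 * zeta - xi) ^+ 2 by exact: sqr_ge0.
by rewrite ler_norml; apply/andP; split; lra.
Qed.

(** Here |xi| <= 2 |zeta - xi|, so |zeta - xi| <= 1 forces |xi| <= 2 and |zeta| <= 1; the constant
    is 7 = 1 + 2 + 4. *)
Lemma osc_le_far (t xi zeta : R) : 2 * `|zeta| <= `|xi| ->
  osc t xi zeta <= 7 * (1 + `|t|) * Num.min 1 (1 * `|zeta - xi|).
Proof.
move=> zx; have h2 : `|xi| <= 2 * `|zeta - xi|.
  by have := ler_normB zeta (zeta - xi); rewrite (_ : zeta - (zeta - xi) = xi); [lra|ring].
apply: osc_le => [||]; [by lra|by lra|rewrite mul1r => h].
rewrite mulrC; apply: ler_wpM2r => //.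
have := ler_normD (zeta ^+ 2 + zeta * xi) (xi ^+ 2); have := ler_normD (zeta ^+ 2) (zeta * xi).
rewrite [`|zeta * xi|]normrM !normrX => h3 h4.
have z0 := normr_ge0 zeta; have x0 := normr_ge0 xi.
have z1 : `|zeta| <= 1 by lra.
have x2 : `|xi| <= 2 by lra.
have g1 : `|zeta| * `|xi| <= 1 * 2 by exact: ler_pM.
have g2 : `|zeta| ^+ 2 <= 1 ^+ 2 by rewrite ler_pXn2r ?nnegrE.
have g3 : `|xi| ^+ 2 <= 2 ^+ 2 by rewrite ler_pXn2r ?nnegrE.
lra.
Qed.

Lemma powR_normD_le (b x y : R) : 0 <= b <= 1 ->
  `|x + y| `^ b <= 2 * (`|x| `^ b + `|y| `^ b).
Proof.
move=> /andP[b0 b1].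
wlog xy : x y / `|x| <= `|y|.
  move=> h; have [?|/ltW ?] := leP `|x| `|y|; first exact: h.
  by rewrite (addrC x) (addrC (`|x| `^ b)); exact: h.
have h : `|x + y| `^ b <= (2 * `|y|) `^ b.
  apply: ge0_ler_powR; rewrite ?nnegrE ?mulr_ge0//.
  by apply: le_trans (ler_normD _ _) _; lra.
apply: (le_trans h); rewrite powRM//.
have h2 : 2 `^ b <= 2 by apply: ler1_powR; lra.
have := powR_ge0 `|x| b; have := powR_ge0 `|y| b; nra.
Qed.

End phase.

(** * Pointwise bounds for the kernel of Phi *)

Section kernel.
Context {R : realType}.
Local Notation mu := (@lebesgue_measure R).
Variables (alpha beta : R) (alpha01 : 0 < alpha < 1) (beta_alpha : 0 <= beta < alpha).

(** The absolute kernel of |xi|^beta Phi in the variables (xi, zeta), up to the constant 1 /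
    c_alpha. Both parts of the theorem use it, with beta = 0 in the first. *)
Definition osc_kernel (t : R) (z : R * R) : R :=
  `|z.1| `^ beta * osc t z.1 z.2 * frac_kernel alpha (z.2 - z.1).

(** Exactly the weight of the Sobolev space of order beta + 2 alpha. *)
Definition wt (zeta : R) : R := (1 + zeta ^+ 2) `^ (alpha + beta / 2).

Let a0 : 0 < alpha. Proof. by case/andP: alpha01. Qed.
Let a1 : alpha < 1. Proof. by case/andP: alpha01. Qed.
Let b0 : 0 <= beta. Proof. by case/andP: beta_alpha. Qed.
Let ba : beta < alpha. Proof. by case/andP: beta_alpha. Qed.
Let b01 : 0 <= beta <= 1. Proof. by rewrite b0/= (le_trans (ltW ba) (ltW a1)). Qed.
Let p0 : 0 <= alpha + beta / 2. Proof. by rewrite addr_ge0 ?divr_ge0 ?(ltW a0). Qed.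
Let bra1 (x : R) : 1 <= 1 + x ^+ 2. Proof. by rewrite lerDl sqr_ge0. Qed.
Let bra0 (x : R) : 0 < 1 + x ^+ 2. Proof. exact: lt_le_trans (bra1 x). Qed.

Lemma osc_kernel_ge0 t z : 0 <= osc_kernel t z.
Proof. by rewrite /osc_kernel !mulr_ge0 ?powR_ge0 ?osc_ge0 ?frac_kernel_ge0. Qed.

Lemma measurable_osc t : measurable_fun [set: R * R] (fun z : R * R => osc t z.1 z.2).
Proof.
apply: measurable_cmod; apply: cmeasB; last exact: cmeas_cst.
apply: cmeas_cis; apply: measurable_funM => //; apply: measurable_funB.
  by apply: measurable_funX; exact: measurable_snd.
by apply: measurable_funX; exact: measurable_fst.
Qed.

Lemma measurable_osc_kernel t : measurable_fun [set: R * R] (osc_kernel t).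
Proof.
apply: measurable_funM.
  apply: measurable_funM; last exact: measurable_osc.
  exact: (measurableT_comp (measurable_powR_norm beta) measurable_fst).
apply: (measurableT_comp (measurable_frac_kernel alpha)).
by apply: measurable_funB; [exact: measurable_snd|exact: measurable_fst].
Qed.

Lemma wt_ge1 x : 1 <= wt x.
Proof. by rewrite -(powRr0 (1 + x ^+ 2)); apply: ler_powR. Qed.

Lemma wt_gt0 x : 0 < wt x.
Proof. exact: lt_le_trans (wt_ge1 x). Qed.

Lemma measurable_wt : measurable_fun [set: R] wt.
Proof.
have h : measurable_fun [set: R] (fun x : R => 1 + x ^+ 2).
  by apply: measurable_funD => //; exact: measurable_funX.
exact: (measurableT_comp (@measurable_powR R _) h).
Qed.

Lemma norm_powR_le_bracket (b x : R) : 0 <= b -> `|x| `^ b <= (1 + x ^+ 2) `^ (b / 2).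
Proof.
move=> h; have -> : `|x| `^ b = (`|x| ^+ 2) `^ (b / 2).
  by rewrite -powR_mulrn// -powRrM; congr (_ `^ _); field.
apply: ge0_ler_powR; rewrite ?nnegrE ?divr_ge0 ?(ltW (bra0 x)) ?sqr_ge0//.
by rewrite real_normK ?num_real// lerDr.
Qed.

Lemma norm_powR_min_kernel (c eta : R) :
  `|eta| `^ beta * min_kernel alpha c eta = min_kernel (alpha - beta) c eta.
Proof.
have [->|e0] := eqVneq eta 0; first by rewrite /min_kernel normr0 mulr0 min_r// !mul0r mulr0.
rewrite /min_kernel mulrCA; congr (_ * _).
have n0 : `|eta| != 0 by rewrite normr_eq0.
rewrite /frac_kernel -!powRN -powRD; last by rewrite n0 implybT.
by congr (_ `^ _); ring.
Qed.

(* |xi|^beta <= 2 (|zeta|^beta + |zeta - xi|^beta) leaves only weights at zeta. *)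
Lemma osc_kernel_near t (xi zeta : R) :
  osc_kernel t (xi, zeta) <= 10 * (1 + `|t|) *
   ((1 + zeta ^+ 2) `^ (beta / 2) * min_kernel alpha (1 + zeta ^+ 2) (zeta - xi) +
    min_kernel (alpha - beta) (1 + zeta ^+ 2) (zeta - xi)).
Proof.
rewrite /osc_kernel /= -norm_powR_min_kernel -mulrDl.
have h1 : `|xi| `^ beta <= 2 * ((1 + zeta ^+ 2) `^ (beta / 2) + `|zeta - xi| `^ beta).
  rewrite {1}(_ : xi = zeta + (xi - zeta)); last by ring.
  apply: le_trans (powR_normD_le _ _ b01) _; rewrite ler_pM2l// (distrC xi) lerD2r.
  exact: norm_powR_le_bracket.
have h2 := osc_le_near t xi zeta.
rewrite [leRHS](_ : _ = 2 * ((1 + zeta ^+ 2) `^ (beta / 2) + `|zeta - xi| `^ beta) *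
   (5 * (1 + `|t|) * Num.min 1 ((1 + zeta ^+ 2) * `|zeta - xi|)) * frac_kernel alpha (zeta - xi)).
  apply: ler_wpM2r; first exact: frac_kernel_ge0.
  by apply: ler_pM => //; rewrite ?powR_ge0 ?osc_ge0.
by rewrite /min_kernel; ring.
Qed.

(* If 2 |zeta| <= |xi| then |xi| <= 2 |zeta - xi|; otherwise the weight at zeta
   dominates the weight at xi. *)
Lemma osc_kernel_far t (xi zeta : R) :
  osc_kernel t (xi, zeta) / wt zeta <= (1 + `|t|) *
   (5 * 4 `^ (alpha + beta / 2) * (1 + xi ^+ 2) `^ (- alpha)
      * min_kernel alpha (1 + xi ^+ 2) (zeta - xi) +
    14 * min_kernel (alpha - beta) 1 (zeta - xi)).
Proof.
have w0 := wt_gt0 zeta; have t0 := normr_ge0 t.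
rewrite ler_pdivrMr// /osc_kernel /=.
have m1 : 0 <= min_kernel alpha (1 + xi ^+ 2) (zeta - xi) by exact: min_kernel_ge0 (ltW (bra0 xi)).
have m2 : 0 <= min_kernel (alpha - beta) 1 (zeta - xi) by exact: min_kernel_ge0.
have fk := frac_kernel_ge0 alpha (zeta - xi).
have [far|near] := leP (2 * `|zeta|) `|xi|.
- apply: (@le_trans _ _ ((1 + `|t|) * (14 * min_kernel (alpha - beta) 1 (zeta - xi)))); last first.
    rewrite -[leLHS]mulr1; apply: ler_pM => //; last exact: wt_ge1.
      by apply: mulr_ge0; [exact: addr_ge0|exact: mulr_ge0].
    apply: ler_wpM2l; first exact: addr_ge0.
    by rewrite lerDr; apply: mulr_ge0 => //; apply: mulr_ge0; [apply: mulr_ge0 => //|]; exact: powR_ge0.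
  rewrite -norm_powR_min_kernel /min_kernel.
  rewrite [leRHS](_ : _ = 2 * `|zeta - xi| `^ beta * (7 * (1 + `|t|) *
    Num.min 1 (1 * `|zeta - xi|)) * frac_kernel alpha (zeta - xi)); last by ring.
  apply: ler_wpM2r => //; apply: ler_pM; rewrite ?powR_ge0 ?osc_ge0//; last exact: osc_le_far.
  have h : `|xi| <= 2 * `|zeta - xi|.
    by have := ler_normB zeta (zeta - xi); rewrite (_ : zeta - (zeta - xi) = xi); [lra|ring].
  apply: (@le_trans _ _ ((2 * `|zeta - xi|) `^ beta)).
    by apply: ge0_ler_powR; rewrite ?nnegrE ?mulr_ge0.
  rewrite powRM// ler_wpM2r ?powR_ge0//; case/andP: b01 => _ b1.
  by apply: ler1_powR; lra.
- apply: (@le_trans _ _ ((1 + `|t|) * (5 * 4 `^ (alpha + beta / 2) * (1 + xi ^+ 2) `^ (- alpha)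
      * min_kernel alpha (1 + xi ^+ 2) (zeta - xi)) * wt zeta)); last first.
    apply: ler_wpM2r; first exact: ltW.
    apply: ler_wpM2l; first exact: addr_ge0.
    by rewrite lerDl; exact: mulr_ge0.
  (* From |xi| < 2 |zeta| follows 1 + xi^2 <= 4 (1 + zeta^2). The power -alpha is kept at xi in
     order to cancel the mass (1 + xi^2)^alpha of the model kernel. *)
  have h : (1 + xi ^+ 2) `^ (beta / 2) <= 4 `^ (alpha + beta / 2) * (1 + xi ^+ 2) `^ (- alpha) * wt zeta.
    have -> : (1 + xi ^+ 2) `^ (beta / 2) =
        (1 + xi ^+ 2) `^ (alpha + beta / 2) * (1 + xi ^+ 2) `^ (- alpha).
      rewrite -powRD; last by rewrite (gt_eqF (bra0 xi)) implybT.
      by congr (_ `^ _); ring.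
    rewrite mulrAC ler_wpM2r ?powR_ge0// /wt -powRM//; last exact: ltW (bra0 zeta).
    apply: ge0_ler_powR; rewrite ?nnegrE ?mulr_ge0 ?(ltW (bra0 _))//.
    have : `|xi| ^+ 2 <= (2 * `|zeta|) ^+ 2 by rewrite ler_pXn2r ?nnegrE ?mulr_ge0// ltW.
    by rewrite exprMn !real_normK ?num_real//; lra.
  rewrite [leRHS](_ : _ = (4 `^ (alpha + beta / 2) * (1 + xi ^+ 2) `^ (- alpha) * wt zeta) *
     (5 * (1 + `|t|) * Num.min 1 ((1 + xi ^+ 2) * `|xi - zeta|)) * frac_kernel alpha (zeta - xi)).
    apply: ler_wpM2r => //; apply: ler_pM; rewrite ?powR_ge0 ?osc_ge0//.
      by apply: le_trans h; exact: norm_powR_le_bracket.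
    by rewrite oscC; exact: osc_le_near.
  by rewrite /min_kernel (distrC zeta xi); ring.
Qed.

End kernel.

(** * The marginals of the kernel and its weighted L^2 bound *)

Section kernel_schur.
Context {R : realType}.
Local Notation mu := (@lebesgue_measure R).

Lemma integral_shift_comb (h1 h2 : R -> R) (c1 c2 r1 r2 s : R) :
  measurable_fun [set: R] h1 -> measurable_fun [set: R] h2 ->
  (forall x, 0 <= h1 x) -> (forall x, 0 <= h2 x) -> 0 <= c1 -> 0 <= c2 ->
  (\int[mu]_x (h1 x)%:E = r1%:E)%E -> (\int[mu]_x (h2 x)%:E = r2%:E)%E ->
  (\int[mu]_x (c1 * h1 (x + s) + c2 * h2 (x + s))%:E = (c1 * r1 + c2 * r2)%:E)%E.
Proof.
move=> m1 m2 p1 p2 q1 q2 e1 e2.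
have n1 x : (0 <= (h1 x)%:E)%E by rewrite lee_fin.
have n2 x : (0 <= (h2 x)%:E)%E by rewrite lee_fin.
have M1 : measurable_fun [set: R] (EFin \o h1) by exact/measurable_EFinP.
have M2 : measurable_fun [set: R] (EFin \o h2) by exact/measurable_EFinP.
rewrite (@integral_shift _ (fun x => (c1 * h1 x + c2 * h2 x)%:E)); last 2 first.
- by apply/measurable_EFinP; apply: measurable_funD; exact: measurable_funM.
- by move=> x; rewrite lee_fin addr_ge0// mulr_ge0.
under eq_integral do rewrite EFinD !EFinM.
rewrite (@ge0_integralD _ _ _ mu _ measurableT (fun x => c1%:E * (h1 x)%:E)%E
  (fun x => c2%:E * (h2 x)%:E)%E); last 4 first.
- by move=> x _; rewrite mule_ge0// lee_fin.
- exact: measurable_funeM.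
- by move=> x _; rewrite mule_ge0// lee_fin.
- exact: measurable_funeM.
rewrite (@ge0_integralZl _ _ _ mu _ measurableT _ M1 _ (fun x _ => n1 x))//.
rewrite (@ge0_integralZl _ _ _ mu _ measurableT _ M2 _ (fun x _ => n2 x))//.
by rewrite e1 e2.
Qed.

Lemma measurable_osc_kernel_wt (alpha beta t : R) : measurable_fun [set: R * R]
    (fun z : R * R => osc_kernel alpha beta t z / wt alpha beta z.2).
Proof.
apply: measurable_funM; first exact: measurable_osc_kernel.
have -> : (fun z : R * R => (wt alpha beta z.2)^-1) =
    (fun zeta : R => (1 + zeta ^+ 2) `^ (- (alpha + beta / 2))) \o snd.
  by apply/funext => z /=; rewrite powRN.
apply: measurableT_comp => //; have h : measurable_fun [set: R] (fun x : R => 1 + x ^+ 2).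
  by apply: measurable_funD => //; exact: measurable_funX.
exact: (measurableT_comp (@measurable_powR R _) h).
Qed.

(** For fixed xi the bound [osc_kernel_far] is integrated: (1 + xi^2)^-alpha cancels the mass of the
    model kernel. For fixed zeta it is [osc_kernel_near]: the first term produces (1 + zeta^2)^(beta
    / 2 + alpha), which is the weight itself, and the second the smaller power alpha - beta. *)
Lemma integral_osc_kernel (alpha beta : R) : 0 < alpha < 1 -> 0 <= beta < alpha ->
  exists2 C : R, 0 <= C & forall t,
   (forall xi, (\int[mu]_zeta (osc_kernel alpha beta t (xi, zeta) / wt alpha beta zeta)%:E
       <= (C * (1 + `|t|))%:E)%E) /\
   (forall zeta, (\int[mu]_xi (osc_kernel alpha beta t (xi, zeta) / wt alpha beta zeta)%:E
       <= (C * (1 + `|t|))%:E)%E).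
Proof.
move=> a01 ba; have /andP[a0 a1] := a01; have /andP[b0 ba'] := ba.
have [C1 C10 i1] := integral_min_kernel a01.
have [|C2 C20 i2] := @integral_min_kernel R (alpha - beta); first by apply/andP; split; lra.
pose D : R := 5 * 4 `^ (alpha + beta / 2).
have D0 : 0 <= D by rewrite mulr_ge0 ?powR_ge0.
(* The first summand serves the integrals in xi, the other two those in zeta. *)
exists (10 * (C1 + C2) + D * C1 + 14 * C2).
  by rewrite !addr_ge0 ?mulr_ge0 ?addr_ge0.
move=> t; have t0 := normr_ge0 t.
have mK : measurable_fun [set: R * R]
    (fun z : R * R => osc_kernel alpha beta t z / wt alpha beta z.2).
  exact: measurable_osc_kernel_wt.
have K0 z : 0 <= osc_kernel alpha beta t z / wt alpha beta z.2.
  by rewrite divr_ge0 ?osc_kernel_ge0// ltW// wt_gt0.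
have bra1 (x : R) : 1 <= 1 + x ^+ 2 by rewrite lerDl sqr_ge0.
have bra0 (x : R) : 0 < 1 + x ^+ 2 by exact: lt_le_trans (bra1 x).
have g1 a : 0 < a -> forall x, 0 <= min_kernel alpha a x.
  by move=> h x; exact: min_kernel_ge0 (ltW h).
have g2 a : 0 < a -> forall x, 0 <= min_kernel (alpha - beta) a x.
  by move=> h x; exact: min_kernel_ge0 (ltW h).
have sm m a s : measurable_fun [set: R] (fun x : R => min_kernel m a (x + s)).
  by apply: (measurableT_comp (measurable_min_kernel m a)); exact: measurable_funD.
split=> [xi|zeta].
- have q1 : 0 <= (1 + `|t|) * (D * (1 + xi ^+ 2) `^ (- alpha)).
    by apply: mulr_ge0; [exact: addr_ge0|rewrite mulr_ge0// powR_ge0].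
  have q2 : 0 <= (1 + `|t|) * 14 by apply: mulr_ge0 => //; exact: addr_ge0.
  have e := integral_shift_comb (- xi) (measurable_min_kernel alpha (1 + xi ^+ 2))
    (measurable_min_kernel (alpha - beta) 1) (g1 _ (bra0 xi)) (g2 _ ltr01) q1 q2
    (i1 _ (bra0 xi)) (i2 _ ltr01).
  apply: (@le_trans _ _ (\int[mu]_x ((1 + `|t|) * (D * (1 + xi ^+ 2) `^ (- alpha))
     * min_kernel alpha (1 + xi ^+ 2) (x - xi) +
     (1 + `|t|) * 14 * min_kernel (alpha - beta) 1 (x - xi))%:E)%E).
    apply: ge0_integral_le.
    + exact: (measurable_section1 xi mK).
    + by apply: measurable_funD; apply: measurable_funM.
    + by move=> x; exact: (K0 (xi, x)).
    + move=> x; apply: le_trans (osc_kernel_far a01 ba t xi x) _.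
      by rewrite /D le_eqVlt; apply/orP; left; apply/eqP; ring.
  rewrite e powR1 mul1r lee_fin [leRHS]mulrC.
  have -> : (1 + `|t|) * (D * (1 + xi ^+ 2) `^ (- alpha)) * ((1 + xi ^+ 2) `^ alpha * C1) =
     (1 + `|t|) * (D * C1).
    by rewrite powRN; field; rewrite gt_eqF// powR_gt0.
  rewrite [leLHS](_ : _ = (1 + `|t|) * (D * C1 + 14 * C2)); last by ring.
  apply: ler_wpM2l; first exact: addr_ge0.
  have : 0 <= 10 * (C1 + C2) by rewrite mulr_ge0// addr_ge0.
  by lra.
- have w0 := wt_gt0 a01 ba zeta; have w1 := wt_ge1 a01 ba zeta.
  pose T := (1 + `|t|) * 10.
  have T0 : 0 <= T by apply: mulr_ge0 => //; exact: addr_ge0.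
  have q1 : 0 <= T * (1 + zeta ^+ 2) `^ (beta / 2) / wt alpha beta zeta.
    by rewrite divr_ge0 ?(ltW w0)// mulr_ge0// powR_ge0.
  have q2 : 0 <= T / wt alpha beta zeta by rewrite divr_ge0// ltW.
  have e := integral_shift_comb (- zeta) (measurable_min_kernel alpha (1 + zeta ^+ 2))
    (measurable_min_kernel (alpha - beta) (1 + zeta ^+ 2)) (g1 _ (bra0 zeta)) (g2 _ (bra0 zeta)) q1 q2
    (i1 _ (bra0 zeta)) (i2 _ (bra0 zeta)).
  apply: (@le_trans _ _ (\int[mu]_x (T * (1 + zeta ^+ 2) `^ (beta / 2) / wt alpha beta zeta
     * min_kernel alpha (1 + zeta ^+ 2) (x - zeta) +
     T / wt alpha beta zeta * min_kernel (alpha - beta) (1 + zeta ^+ 2) (x - zeta))%:E)%E).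
    apply: ge0_integral_le.
    + exact: (measurable_section2 zeta mK).
    + by apply: measurable_funD; apply: measurable_funM.
    + by move=> x; exact: (K0 (x, zeta)).
    + move=> x; rewrite ler_pdivrMr//; apply: le_trans (osc_kernel_near a01 ba t x zeta) _.
      rewrite -(min_kernelN alpha _ (x - zeta)) -(min_kernelN (alpha - beta) _ (x - zeta)) !opprB /T.
      by rewrite le_eqVlt; apply/orP; left; apply/eqP; field; rewrite gt_eqF.
  rewrite e lee_fin.
  have h1 : T * (1 + zeta ^+ 2) `^ (beta / 2) / wt alpha beta zeta * ((1 + zeta ^+ 2) `^ alpha * C1)
      = T * C1.
    rewrite {1}/wt powRD; last by rewrite (gt_eqF (bra0 zeta)) implybT.
    by field; rewrite !gt_eqF ?powR_gt0.
  have h2 : T / wt alpha beta zeta * ((1 + zeta ^+ 2) `^ (alpha - beta) * C2) <= T * C2.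
    rewrite -mulrA; apply: ler_wpM2l => //.
    rewrite mulrA ler_piMl// mulrC ler_pdivrMr// mul1r /wt.
    by apply: ler_powR => //; lra.
  rewrite h1; apply: (le_trans (lerD (lexx _) h2)).
  have : 0 <= D * C1 + 14 * C2 by rewrite addr_ge0 ?mulr_ge0.
  rewrite /T; nra.
Qed.

(** Schur's test for the kernel divided by the weight at zeta, acting on the function multiplied by
    it. *)
Lemma osc_schur (alpha beta : R) : 0 < alpha < 1 -> 0 <= beta < alpha ->
  exists2 C : R, 0 <= C & forall t (f : R -> R),
   measurable_fun [set: R] f -> (forall x, 0 <= f x) ->
   (\int[mu]_xi ((\int[mu]_zeta (osc_kernel alpha beta t (xi, zeta) * f zeta)%:E) *
                 (\int[mu]_zeta (osc_kernel alpha beta t (xi, zeta) * f zeta)%:E)) <=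
    ((C * (1 + `|t|)) ^+ 2)%:E * \int[mu]_x ((wt alpha beta x * f x) ^+ 2)%:E)%E.
Proof.
move=> a01 ba; have [C C0 hC] := integral_osc_kernel a01 ba.
exists C => // t f mf f0; have [hr hc] := hC t.
have CT : 0 <= C * (1 + `|t|) by rewrite mulr_ge0// addr_ge0.
have mK : measurable_fun [set: R * R]
    (fun z : R * R => osc_kernel alpha beta t z / wt alpha beta z.2).
  exact: measurable_osc_kernel_wt.
have K0 z : 0 <= osc_kernel alpha beta t z / wt alpha beta z.2.
  by rewrite divr_ge0 ?osc_kernel_ge0// ltW// wt_gt0.
have mw : measurable_fun [set: R] (fun x => wt alpha beta x * f x).
  by apply: measurable_funM => //; exact: measurable_wt.
have w0 x : 0 <= wt alpha beta x * f x by rewrite mulr_ge0// ltW// wt_gt0.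
have := schur_test mK mw K0 w0 CT CT hr hc.
rewrite -expr2; apply: le_trans.
rewrite le_eqVlt; apply/orP; left; apply/eqP; apply: eq_integral => xi _.
have e : (\int[mu]_zeta (osc_kernel alpha beta t (xi, zeta) * f zeta)%:E =
  \int[mu]_zeta (osc_kernel alpha beta t (xi, zeta) / wt alpha beta (xi, zeta).2
      * (wt alpha beta zeta * f zeta))%:E)%E.
  apply: eq_integral => zeta _ /=; congr EFin; field.
  by rewrite gt_eqF// wt_gt0.
by rewrite e.
Qed.

End kernel_schur.

(** * The function Phi *)

Section tail_kernel.
Context {R : realType}.
Local Notation mu := (@lebesgue_measure R).
Variables (alpha : R) (alpha01 : 0 < alpha < 1).

Let a0 : 0 < alpha. Proof. by case/andP: alpha01. Qed.

Definition outer (eps : R) : set R := [set eta | eps <= `|eta|].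

Lemma measurable_outer eps : measurable (outer eps).
Proof.
have m : measurable_fun [set: R] (fun x : R => `|x|) by exact: measurableT_comp.
rewrite (_ : outer eps = (fun x : R => `|x|) @^-1` `[eps, +oo[).
  by rewrite -[X in measurable X]setTI; exact: m.
by apply/seteqP; split=> x /=; rewrite in_itv/= andbT.
Qed.

(** For eps > 0 it is integrable and bounded, hence also square integrable: the L^1 norm bounds the
    convolution on L^2, the L^2 norm makes it defined at every point. *)
Definition tail_kernel (eps eta : R) : R := \1_(outer eps) eta * frac_kernel alpha eta.

Lemma tail_kernel_ge0 eps eta : 0 <= tail_kernel eps eta.
Proof. by rewrite mulr_ge0 ?frac_kernel_ge0// indicE ler0n. Qed.

Lemma measurable_tail_kernel eps : measurable_fun [set: R] (tail_kernel eps).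
Proof.
apply: measurable_funM; last exact: measurable_frac_kernel.
by apply: measurable_indic; exact: measurable_outer.
Qed.

Lemma tail_kernelN eps eta : tail_kernel eps (- eta) = tail_kernel eps eta.
Proof.
have e : (- eta \in outer eps) = (eta \in outer eps).
  by apply/idP/idP => /set_mem h; apply: mem_set; move: h; rewrite /outer/= normrN.
by rewrite /tail_kernel frac_kernelN !indicE e.
Qed.

Lemma tail_kernel_bound eps eta : 0 < eps -> tail_kernel eps eta <= (eps `^ (1 + alpha))^-1.
Proof.
move=> e0; rewrite /tail_kernel indicE.
have [/set_mem/= h|_] := boolP (eta \in outer eps); last first.
  by rewrite mul0r invr_ge0 powR_ge0.
rewrite mul1r lef_pV2 ?posrE ?powR_gt0//; last exact: lt_le_trans h.
apply: ge0_ler_powR; rewrite ?nnegrE ?(ltW e0)//.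
by rewrite addr_ge0// ltW.
Qed.

Lemma integral_tail_kernel_lty eps : 0 < eps ->
  (\int[mu]_eta (tail_kernel eps eta)%:E < +oo)%E.
Proof.
move=> e0.
rewrite (@integral_even _ _ (measurable_tail_kernel eps) (tail_kernel_ge0 eps) (tail_kernelN eps)).
suff h : (\int[mu]_(x in `]0%R, +oo[) (tail_kernel eps x)%:E <= (eps `^ (- alpha) / alpha)%:E)%E.
  by apply: le_lt_trans (leeD h h) _; rewrite -EFinD ltry.
rewrite -(integral_powR_tail a0 e0) (ge0_integral_mkcond `]0%R, +oo[)
  (ge0_integral_mkcond `[eps, +oo[); apply: ge0_integral_le.
- by apply: measurable_funM; [exact: measurable_indic|exact: measurable_tail_kernel].
- by apply: measurable_funM; [exact: measurable_indic|exact: measurable_powR].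
- by move=> x; rewrite mulr_ge0 ?tail_kernel_ge0// indicE ler0n.
move=> x; rewrite indicE; have [/set_mem/=|_] := boolP (x \in `]0%R, +oo[%classic); last first.
  by rewrite mul0r mulr_ge0 ?powR_ge0// indicE ler0n.
rewrite in_itv/= andbT mul1r => x0.
rewrite /tail_kernel !indicE.
have [/set_mem/=|_] := boolP (x \in outer eps); last first.
  by rewrite mul0r mulr_ge0 ?powR_ge0// ler0n.
rewrite /outer /= (gtr0_norm x0) => ex; rewrite mem_set/= ?in_itv/= ?ex// !mul1r.
by rewrite /frac_kernel (gtr0_norm x0) -powRN opprD addrC.
Qed.

Definition tail_mass eps : R := fine (\int[mu]_eta (tail_kernel eps eta)%:E)%E.

Lemma tail_massE eps : 0 < eps -> (\int[mu]_eta (tail_kernel eps eta)%:E = (tail_mass eps)%:E)%E.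
Proof.
move=> e0; rewrite fineK// ge0_fin_numE ?integral_tail_kernel_lty//.
by apply: integral_ge0 => x _; rewrite lee_fin tail_kernel_ge0.
Qed.

Lemma tail_mass_ge0 eps : 0 <= tail_mass eps.
Proof.
by rewrite fine_ge0// integral_ge0// => x _; rewrite lee_fin tail_kernel_ge0.
Qed.

Lemma cmeas_tail_kernel eps : cmeas (fun eta => (tail_kernel eps eta)%:C).
Proof. by apply: cmeas_real; exact: measurable_tail_kernel. Qed.

Lemma cmod_tail_kernel eps eta : cmod (tail_kernel eps eta)%:C = tail_kernel eps eta.
Proof. by rewrite cmod_real ger0_norm ?tail_kernel_ge0. Qed.

Lemma cintegrable_tail_kernel eps : 0 < eps -> cintegrable (fun eta => (tail_kernel eps eta)%:C).
Proof.
move=> e0; split; first exact: cmeas_tail_kernel.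
rewrite /nint; under eq_integral do rewrite cmod_tail_kernel.
exact: integral_tail_kernel_lty.
Qed.

Lemma inL2_tail_kernel eps : 0 < eps -> inL2 (fun eta => (tail_kernel eps eta)%:C).
Proof.
move=> e0; apply/inL2P; split; first exact: cmeas_tail_kernel.
apply/L2norm_lty; rewrite /L2sq.
have b0 : 0 <= (eps `^ (1 + alpha))^-1 by rewrite invr_ge0 powR_ge0.
have mT : measurable_fun [set: R] (fun eta => (tail_kernel eps eta)%:E).
  by apply/measurable_EFinP; exact: measurable_tail_kernel.
apply: (@le_lt_trans _ _ (\int[mu]_eta ((eps `^ (1 + alpha))^-1 * tail_kernel eps eta)%:E)%E).
  apply: ge0_integral_le.
  - by apply: measurable_cmod2; exact: cmeas_tail_kernel.
  - by apply: measurable_funM => //; exact: measurable_tail_kernel.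
  - by move=> x; exact: sqr_ge0.
  - move=> x; rewrite cmod_tail_kernel expr2 ler_wpM2r ?tail_kernel_ge0//.
    exact: tail_kernel_bound.
under eq_integral do rewrite EFinM.
have T0 x : [set: R] x -> (0 <= (tail_kernel eps x)%:E)%E by rewrite lee_fin tail_kernel_ge0.
rewrite (@ge0_integralZl _ _ _ mu _ measurableT _ mT _ T0)//.
by rewrite tail_massE// -EFinM ltry.
Qed.

End tail_kernel.

Section shift.
Context {R : realType}.
Local Notation mu := (@lebesgue_measure R).

Lemma cmeas_shift (f : R -> R[i]) (xi : R) : cmeas f -> cmeas (fun eta : R => f (xi + eta)).
Proof. by move=> mf; apply: (cmeas_comp mf); exact: measurable_funD. Qed.

Lemma L2norm_shift (f : R -> R[i]) (xi : R) : cmeas f ->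
  L2norm (fun eta : R => f (xi + eta)) = L2norm f.
Proof.
move=> mf; rewrite !L2normE; congr poweR; rewrite /L2sq.
under eq_integral do rewrite addrC.
rewrite (@integral_shift _ (fun x => (cmod (f x) ^+ 2)%:E))//.
  by apply/measurable_EFinP; exact: measurable_cmod2.
by move=> x; rewrite lee_fin sqr_ge0.
Qed.

Lemma inL2_shift (f : R -> R[i]) (xi : R) : inL2 f -> inL2 (fun eta : R => f (xi + eta)).
Proof.
move=> /inL2P[mf foo]; apply/inL2P; split; first exact: cmeas_shift.
by rewrite L2norm_shift.
Qed.

End shift.

(** * The integrand of Phi and its truncations *)

Section phi_kernel.
Context {R : realType}.
Local Notation mu := (@lebesgue_measure R).
Variables (alpha : R) (alpha01 : 0 < alpha < 1) (t : R).
Implicit Types (f : R -> R[i]).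

Definition phi_kernel f (z : R * R) : R[i] :=
  (cis (t * ((z.1 + z.2) ^+ 3 - z.1 ^+ 3)) - 1) / (`|z.2| `^ (1 + alpha))%:C * f (z.1 + z.2).

Lemma phi_kernelE f xi eta : phi_kernel f (xi, eta) =
  (frac_kernel alpha eta)%:C * ((cis (t * ((xi + eta) ^+ 3 - xi ^+ 3)) - 1) * f (xi + eta)).
Proof.
rewrite /phi_kernel /= /frac_kernel mulrA [_%:C * _]mulrC; congr (_ * _ * _).
by rewrite fmorphV.
Qed.

Lemma cmod_phi_kernel f xi eta : cmod (phi_kernel f (xi, eta)) =
  osc t xi (xi + eta) * frac_kernel alpha eta * cmod (f (xi + eta)).
Proof.
rewrite phi_kernelE !cmodM cmod_real ger0_norm ?frac_kernel_ge0//.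
by rewrite mulrA (mulrC (frac_kernel _ _)).
Qed.

Lemma cmeas_phi_kernel f : cmeas f -> cmeas (phi_kernel f).
Proof.
move=> mf; have m1 : measurable_fun [set: R * R] (@fst R R) by exact: measurable_fst.
have m2 : measurable_fun [set: R * R] (@snd R R) by exact: measurable_snd.
have m12 : measurable_fun [set: R * R] (fun z : R * R => z.1 + z.2) by exact: measurable_funD.
have -> : phi_kernel f = fun z => (frac_kernel alpha z.2)%:C *
    ((cis (t * ((z.1 + z.2) ^+ 3 - z.1 ^+ 3)) - 1) * f (z.1 + z.2)).
  by apply/funext => -[xi eta]; exact: phi_kernelE.
apply: cmeasM.
  by apply: cmeas_real; exact: (measurableT_comp (measurable_frac_kernel alpha) m2).
apply: cmeasM; last exact: (cmeas_comp mf m12).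
apply: cmeasB; last exact: cmeas_cst.
apply: cmeas_cis; apply: measurable_funM => //; apply: measurable_funB; exact: measurable_funX.
Qed.

Lemma cmeas_phi_kernel1 f xi : cmeas f -> cmeas (fun eta => phi_kernel f (xi, eta)).
Proof. by move=> /cmeas_phi_kernel mf; apply: (cmeas_comp mf); exact: pair1_measurable. Qed.

Lemma Phi_truncE f eps xi : Phi_trunc t alpha f eps xi =
  ((c_ alpha)^-1)%:C * cint (fun eta => cindic (outer eps) eta * phi_kernel f (xi, eta)).
Proof. by rewrite /Phi_trunc cintegral_indic//; exact: measurable_outer. Qed.

Lemma cindic_phi_kernel f eps xi eta :
  cindic (outer eps) eta * phi_kernel f (xi, eta) =
  (tail_kernel alpha eps eta)%:C * ((cis (t * ((xi + eta) ^+ 3 - xi ^+ 3)) - 1) * f (xi + eta)).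
Proof. by rewrite phi_kernelE mulrA /cindic -rmorphM. Qed.

Lemma cintegrable_phi_trunc f eps xi : 0 < eps -> inL2 f ->
  cintegrable (fun eta => cindic (outer eps) eta * phi_kernel f (xi, eta)).
Proof.
move=> e0 Lf; have mf := inL2_cmeas Lf.
under eq_fun do rewrite cindic_phi_kernel.
apply: inL2_mul_cintegrable; first exact: inL2_tail_kernel.
apply: (inL2_bounded (B := 2)); last exact: inL2_shift.
- apply: cmeasB; last exact: cmeas_cst.
  apply: cmeas_cis; apply: measurable_funM => //; apply: measurable_funB => //.
  by apply: measurable_funX; exact: measurable_funD.
- by move=> x; exact: cmod_cis_sub1_le2.
Qed.

Lemma cmeas_Phi_trunc f eps : cmeas f -> cmeas (Phi_trunc t alpha f eps).
Proof.
move=> mf; have -> : Phi_trunc t alpha f eps = fun xi =>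
    ((c_ alpha)^-1)%:C * cint (fun eta => cindic (outer eps) (xi, eta).2 * phi_kernel f (xi, eta)).
  by apply/funext => xi; rewrite Phi_truncE.
apply: cmeasM; first exact: cmeas_cst.
apply: (@cmeas_cint _ (fun z => cindic (outer eps) z.2 * phi_kernel f z)).
apply: cmeasM; last exact: cmeas_phi_kernel.
by apply: (cmeas_comp (cmeas_cindic (measurable_outer eps))); exact: measurable_snd.
Qed.

End phi_kernel.

Section indicator_limits.
Context {R : realType}.
Local Notation mu := (@lebesgue_measure R).

Lemma near_eq_cvgn (u v : nat -> R) (l : R) : (\forall n \near \oo, v n = u n) ->
  v n @[n --> \oo] --> l -> u n @[n --> \oo] --> l.
Proof. by move=> h; apply: cvg_trans; apply: near_eq_cvg. Qed.

Lemma cvgn0Z (a : R) (u : nat -> R) : u n @[n --> \oo] --> (0 : R) ->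
  a * u n @[n --> \oo] --> (0 : R).
Proof. by move=> u0; rewrite -(mulr0 a); apply: cvgM => //; exact: cvg_cst. Qed.

Lemma near_gt_cvgn (u : nat -> R) (l d : R) : d < l -> u n @[n --> \oo] --> l ->
  \forall n \near \oo, d < u n.
Proof. by move=> dl ul; near=> n; near: n; exact: (cvgr_gt _ ul _ dl).
Unshelve. all: by end_near. Qed.

Lemma ae_neq0 : {ae mu, forall x : R, x != 0}.
Proof.
exists [set 0]; split; first exact: measurable_set1.
  exact: lebesgue_measure_set1.
by move=> x /= /negP; rewrite negbK => /eqP.
Qed.

Lemma cvg_cint_cindic (A : nat -> set R) (B : set R) (h : R -> R[i]) :
  (forall n, measurable (A n)) -> measurable B -> cintegrable h ->
  {ae mu, forall x, \forall n \near \oo, cindic (A n) x = cindic B x} ->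
  cmod (cint (fun x => cindic (A n) x * h x) - cint (fun x => cindic B x * h x))
    @[n --> \oo] --> (0 : R).
Proof.
move=> mA mB [mh hoo] AB.
have ind_le (C : set R) x : cmod (cindic C x * h x) <= cmod (h x).
  by rewrite cmodM ler_piMl ?cmod_ge0 ?cmod_cindic_le1.
apply: (cdominated_cvg _ _ (measurable_cmod mh) hoo) => //.
- by move=> n; apply: cmeasM => //; exact: cmeas_cindic.
- by apply: cmeasM => //; exact: cmeas_cindic.
- apply: ae_imply AB => x near_eq.
  apply: cvg_near_cst.
  by apply: filterS near_eq => n ->; rewrite subrr cmod0.
- apply: (cintegrable_le _ (measurable_cmod mh) (ind_le B) hoo).
  by apply: cmeasM => //; exact: cmeas_cindic.
Qed.

Lemma cindic_outer_mul (e e' : R) x : e' <= e ->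
  cindic (outer e) x * cindic (outer e') x = cindic (outer e) x.
Proof.
move=> ee; rewrite /cindic !indicE; have [/set_mem h|_] := boolP (x \in outer e).
  by rewrite (mem_set (_ : outer e' x)) ?mulr1//; exact: le_trans h.
by rewrite mul0r.
Qed.

(** The set |x| >= e is closed, so cutoffs approaching e from below include the points |x| = e from
    the start. *)
Lemma cindic_outer_left (u : nat -> R) (e x : R) :
  (forall n, u n <= e) -> u n @[n --> \oo] --> e ->
  \forall n \near \oo, cindic (outer (u n)) x = cindic (outer e) x.
Proof.
move=> ue ucvg; rewrite /cindic; have [xe|xe] := leP e `|x|.
  apply: nearW => n; rewrite !indicE !mem_set//; exact: le_trans xe.
near=> n; rewrite !indicE !memNset//; apply/negP; rewrite /outer/= -?ltNge//.
by near: n; exact: (cvgr_gt _ ucvg _ xe).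
Unshelve. all: by end_near. Qed.

Lemma cindic_outer_0 (u : nat -> R) (x : R) : x != 0 ->
  u n @[n --> \oo] --> (0 : R) -> \forall n \near \oo, cindic (outer (u n)) x = cindic setT x.
Proof.
move=> x0 ucvg; have nx0 : 0 < `|x| by rewrite normr_gt0.
near=> n; rewrite /cindic indicT indicE mem_set//=.
by apply: ltW; near: n; exact: (cvgr_lt _ ucvg _ nx0).
Unshelve. all: by end_near. Qed.

Lemma harmonic_gt0 n : 0 < n.+1%:R^-1 :> R. Proof. by rewrite invr_gt0. Qed.

Lemma cvg_invn : n.+1%:R^-1 @[n --> \oo] --> (0 : R).
Proof. exact: cvg_harmonic. Qed.

Lemma near_invn_lt (d : R) : 0 < d -> \forall n \near \oo, n.+1%:R^-1 < d.
Proof. by move=> d0; near=> n; near: n; exact: (cvgr_lt _ cvg_invn _ d0).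
Unshelve. all: by end_near. Qed.

(** For e >= 0, the largest multiple of 1 / (j + 1) that does not exceed e: the grid points used to
    test the limit defining [Phi]. *)
Definition floor_below (e : R) (j : nat) : R := (Num.truncn (e * j.+1%:R))%:R / j.+1%:R.

Lemma floor_below_le (e : R) j : 0 <= e -> floor_below e j <= e.
Proof. by move=> e0; rewrite ler_pdivrMr// truncn_le mulr_ge0. Qed.

Lemma floor_below_cvg (e : R) : 0 <= e -> floor_below e j @[j --> \oo] --> e.
Proof.
move=> e0; apply/cvgrPdist_le => d d0.
apply: filterS (near_invn_lt d0) => j jd.
have h : e - j.+1%:R^-1 <= floor_below e j.
  rewrite /floor_below ler_pdivlMr// mulrBl mulVf//.
  by have := truncnS_gt (e * j.+1%:R); rewrite -[X in _ < X -> _]natr1; lra.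
have := floor_below_le j e0 => h2.
rewrite ger0_norm ?subr_ge0//; apply: (le_trans _ (ltW jd)).
by rewrite lerBlDr -lerBlDl.
Qed.

End indicator_limits.

(** * Existence and measurability of Phi *)

Section phi.
Context {R : realType}.
Local Notation mu := (@lebesgue_measure R).
Variables (alpha : R) (alpha01 : 0 < alpha < 1) (t : R).
Implicit Types (f : R -> R[i]).

(** The cutoffs eventually exceed e / 2, so the truncated integrands are all restrictions of one
    integrable function and dominated convergence applies. *)
Lemma Phi_trunc_left_cvg f (u : nat -> R) (e xi : R) : inL2 f -> 0 < e ->
  (forall n, u n <= e) -> u n @[n --> \oo] --> e ->
  cmod (Phi_trunc t alpha f (u n) xi - Phi_trunc t alpha f e xi) @[n --> \oo] --> (0 : R).
Proof.
move=> Lf e0 ue ucvg; have e20 : 0 < e / 2 by rewrite divr_gt0.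
have e2e : e / 2 < e by lra.
pose h eta := cindic (outer (e / 2)) eta * phi_kernel alpha t f (xi, eta).
have hi : cintegrable h := cintegrable_phi_trunc alpha01 t xi e20 Lf.
have E v : e / 2 <= v -> Phi_trunc t alpha f v xi =
    ((c_ alpha)^-1)%:C * cint (fun eta => cindic (outer v) eta * h eta).
  move=> ev; rewrite Phi_truncE; congr (_ * _); apply: eq_cint => eta.
  by rewrite /h mulrA cindic_outer_mul.
have L := @cvg_cint_cindic _ (fun n => outer (u n)) (outer e) h
  (fun n => measurable_outer _) (measurable_outer _) hi
  (ae_everywhere (fun x => cindic_outer_left x ue ucvg)).
apply: near_eq_cvgn (cvgn0Z (cmod ((c_ alpha)^-1)%:C) L).
near=> n; rewrite !E.
- by rewrite -cmodM mulrBr.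
- lra.
- by near: n; exact: (cvgr_ge _ ucvg _ e2e).
Unshelve. all: by end_near. Qed.

Lemma is_Phi_seq f xi (l : R[i]) (u : nat -> R) : is_Phi t alpha f xi l ->
  (forall n, 0 < u n) -> u n @[n --> \oo] --> (0 : R) ->
  cmod (Phi_trunc t alpha f (u n) xi - l) @[n --> \oo] --> (0 : R).
Proof. by move=> /cvg_at_rightP h u0 ucvg; exact: h. Qed.

Lemma is_Phi_unique f xi (l l' : R[i]) :
  is_Phi t alpha f xi l -> is_Phi t alpha f xi l' -> l = l'.
Proof.
move=> h h'; apply: (@cvg_cmod_unique _ (fun n => Phi_trunc t alpha f n.+1%:R^-1 xi)).
  exact: is_Phi_seq h harmonic_gt0 cvg_invn.
exact: is_Phi_seq h' harmonic_gt0 cvg_invn.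
Qed.

Lemma Phi_eq f xi l : is_Phi t alpha f xi l -> Phi t alpha f xi = l.
Proof.
rewrite /Phi => h; case: xgetP => [l' _ /= h'|no]; first exact: is_Phi_unique h' h.
by have := no l h.
Qed.

Lemma Phi_junk f xi : ~ (exists l, is_Phi t alpha f xi l) -> Phi t alpha f xi = 0.
Proof. by move=> h; rewrite /Phi; case: xgetP => // l _ hl; case: h; exists l. Qed.

(** Under absolute integrability the limit involves no cancellation: the cutoffs exhaust the line up
    to the origin. *)
Lemma is_Phi_of_integrable f xi : cintegrable (fun eta => phi_kernel alpha t f (xi, eta)) ->
  is_Phi t alpha f xi (((c_ alpha)^-1)%:C * cint (fun eta => phi_kernel alpha t f (xi, eta))).
Proof.
move=> Ki; apply/cvg_at_rightP => u [u0 ucvg].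
have L := @cvg_cint_cindic _ (fun n => outer (u n)) setT _
  (fun n => measurable_outer _) measurableT Ki
  (ae_imply (fun x x0 => cindic_outer_0 x0 ucvg) ae_neq0).
apply: near_eq_cvgn (cvgn0Z (cmod ((c_ alpha)^-1)%:C) L); apply: nearW => n.
rewrite Phi_truncE -cmodM mulrBr; congr (cmod (_ - _ * _)).
by apply: eq_cint => x; rewrite /cindic indicT mul1r.
Qed.

Lemma cmod_Phi_trunc_le f eps xi : 0 < eps -> inL2 f ->
  cintegrable (fun eta => phi_kernel alpha t f (xi, eta)) ->
  cmod (Phi_trunc t alpha f eps xi) <=
  `|(c_ alpha)^-1| * fine (nint (fun eta => phi_kernel alpha t f (xi, eta))).
Proof.
move=> e0 Lf [mK Koo]; rewrite Phi_truncE cmodM cmod_real; apply: ler_wpM2l => //.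
apply: (@cmod_cint_le _ _ _ _ _ (measurable_cmod mK)).
- by apply: cmeasM => //; apply: cmeas_cindic; exact: measurable_outer.
- by move=> x; rewrite cmodM ler_piMl ?cmod_ge0 ?cmod_cindic_le1.
- by rewrite fineK// ge0_fin_numE ?nint_ge0.
Qed.

(* As Phi_trunc is left-continuous in eps, convergence as eps -> 0 can be tested on
   the countably many eps = i / (j + 1), so the set where the limit exists is Borel. *)
Lemma cmeas_Phi f : inL2 f -> cmeas (Phi t alpha f).
Proof.
move=> Lf; have mf := inL2_cmeas Lf.
have mP eps : cmeas (Phi_trunc t alpha f eps) by exact: cmeas_Phi_trunc.
have [g mg hg] := @cmeas_ae_lim _ (fun n => Phi_trunc t alpha f n.+1%:R^-1) (fun n => mP _).
pose q (i j : nat) : R := i%:R / j.+1%:R.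
pose E := \bigcap_k \bigcup_m \bigcap_i \bigcap_j [set xi : R |
  (0 < q i j < m.+1%:R^-1) ==>
  (cmod (Phi_trunc t alpha f (q i j) xi - g xi) <= k.+1%:R^-1)].
have mE : measurable E.
  apply: bigcapT_measurable => k; apply: bigcupT_measurable => m.
  apply: bigcapT_measurable => i; apply: bigcapT_measurable => j.
  case: (0 < _ < _) => /=; last first.
    by rewrite (_ : [set _ | true] = setT)//; apply/seteqP; split.
  have mc : measurable_fun [set: R]
      (fun xi => cmod (Phi_trunc t alpha f (q i j) xi - g xi)).
    by apply: measurable_cmod; exact: cmeasB.
  have := mc measurableT `]-oo, (k.+1%:R^-1)]%classic (measurable_itv _).
  rewrite setTI; congr measurable; apply/seteqP; split=> x /=; by rewrite in_itv.
have EP xi : E xi <-> is_Phi t alpha f xi (g xi).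
  split=> [Exi|/cvgrPdist_lt h].
  - apply/cvgrPdist_le => d d0.
    have [k _ kd] := near_invn_lt d0.
    have [m _ Em] := Exi k I.
    near=> eps; rewrite sub0r normrN ger0_norm ?cmod_ge0//.
    have e0 : 0 < eps by near: eps; exact: nbhs_right_gt.
    have e1 : eps < m.+1%:R^-1 by near: eps; apply: nbhs_right_lt; exact: harmonic_gt0.
    apply: (@le_trans _ _ k.+1%:R^-1); last exact: (ltW (kd k (leqnn _))).
    (* An arbitrary eps is approached from below along the grid, where membership in [E] gives the
       bound. *)
    have dl j : floor_below eps j <= eps by exact: floor_below_le (ltW e0).
    have dc := floor_below_cvg (ltW e0).
    have L := Phi_trunc_left_cvg xi Lf e0 dl dc.
    have {}L : cmod (Phi_trunc t alpha f (floor_below eps j) xi - Phi_trunc t alpha f eps xi)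
        + k.+1%:R^-1 @[j --> \oo] --> (0 + k.+1%:R^-1 : R) by apply: cvgD => //; exact: cvg_cst.
    rewrite add0r in L; apply: (cvgr_to_ge L).
    apply: filterS (near_gt_cvgn e0 dc) => j j0.
    have := Em (Num.truncn (eps * j.+1%:R)) I j I => /=.
    rewrite /q -/(floor_below eps j) j0 (le_lt_trans (dl j) e1)/= => h.
    set P := Phi_trunc t alpha f _ xi in h *; set Q := Phi_trunc t alpha f eps xi.
    have := cmodB (P - g xi) (P - Q); rewrite (_ : P - g xi - (P - Q) = Q - g xi); last by ring.
    move=> h3; apply: (le_trans h3); rewrite addrC; exact: lerD.
  - move=> k _; have [r /= r0 hr] := h _ (harmonic_gt0 k).
    have [m _ md] := near_invn_lt r0.
    exists m => // i _ j _ /=; apply/implyP => /andP[ij0 ijm].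
    have := hr (q i j); rewrite /= !sub0r !normrN (gtr0_norm ij0).
    rewrite ger0_norm ?cmod_ge0// => h2; apply/ltW/h2 => //.
    exact: lt_trans ijm (md m (leqnn _)).
(* On [E] the limit is [g]. Elsewhere there is no limit, since [g] is the only candidate, and [Phi]
   takes its default value 0. *)
have -> : Phi t alpha f = fun xi => cindic E xi * g xi.
  apply/funext => xi; rewrite /cindic indicE.
  have [/set_mem/EP h|/negP no] := boolP (xi \in E); first by rewrite mul1r (Phi_eq h).
  rewrite mul0r; apply: Phi_junk => -[l hl]; apply: no; apply/mem_set/EP.
  have cl := is_Phi_seq hl harmonic_gt0 cvg_invn.
  have {}hg := hg xi; suff e : g xi = l by rewrite e.
  apply: (cvg_cmod_unique (hg _) cl).
  have sq (p : R[i] -> R) : (forall z, `|p z| <= cmod z) -> (forall z w, p (z - w) = p z - p w) ->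
      cvgn (fun k => p (Phi_trunc t alpha f k.+1%:R^-1 xi)).
    move=> p1 pB; apply/cvg_ex; exists (p l); apply/cvgrPdist_le => d d0.
    near=> n; rewrite distrC -pB; apply: le_trans (p1 _) _.
    by near: n; exact: (cvgr_le _ cl _ d0).
  split.
    by apply: sq => [z|z w]; [exact: cmod_Re|rewrite ReD ReN].
  by apply: sq => [z|z w]; [exact: cmod_Im|rewrite ImD ImN].
apply: cmeasM => //; exact: cmeas_cindic.
Unshelve. all: by end_near. Qed.

End phi.

(** * L^2 bounds for Phi *)

Section phi_L2.
Context {R : realType}.
Local Notation mu := (@lebesgue_measure R).
Variables (alpha : R) (alpha01 : 0 < alpha < 1).
Implicit Types (f : R -> R[i]) (t beta xi : R).

(** The quantity that Schur's test controls: its finiteness at xi yields the limit there, and its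
    size bounds that limit and every truncation. *)
Definition phi_abs t f xi : \bar R := nint (fun eta => phi_kernel alpha t f (xi, eta)).

Lemma measurable_phi_abs t f : cmeas f -> measurable_fun [set: R] (phi_abs t f).
Proof.
move=> mf; apply: (@measurable_integral2 _ (fun z => cmod (phi_kernel alpha t f z))).
  exact: measurable_cmod (cmeas_phi_kernel alpha t mf).
by move=> z; exact: cmod_ge0.
Qed.

Lemma phi_abs_ge0 t f xi : (0 <= phi_abs t f xi)%E.
Proof. exact: nint_ge0. Qed.

Lemma phi_absE beta t f xi : cmeas f ->
  ((`|xi| `^ beta)%:E * phi_abs t f xi =
   \int[mu]_zeta (osc_kernel alpha beta t (xi, zeta) * cmod (f zeta))%:E)%E.
Proof.
move=> mf; have mK := measurable_cmod (cmeas_phi_kernel1 alpha t xi mf).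
have mKE : measurable_fun [set: R] (fun eta => (cmod (phi_kernel alpha t f (xi, eta)))%:E).
  exact/measurable_EFinP.
have K0 eta : [set: R] eta -> (0 <= (cmod (phi_kernel alpha t f (xi, eta)))%:E)%E.
  by rewrite lee_fin cmod_ge0.
rewrite /phi_abs /nint -(@ge0_integralZl _ _ _ mu _ measurableT _ mKE _ K0) ?lee_fin ?powR_ge0//.
pose g zeta := (osc_kernel alpha beta t (xi, zeta) * cmod (f zeta))%:E.
have mg : measurable_fun [set: R] g.
  apply/measurable_EFinP; apply: measurable_funM; last exact: measurable_cmod.
  exact: (measurable_section1 xi (measurable_osc_kernel alpha beta t)).
have g0 zeta : (0 <= g zeta)%E by rewrite lee_fin mulr_ge0 ?osc_kernel_ge0 ?cmod_ge0.
rewrite -(integral_shift xi mg g0); apply: eq_integral => eta _.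
rewrite /g -EFinM; congr EFin; rewrite cmod_phi_kernel /osc_kernel /=.
by rewrite addrK (addrC eta) !mulrA.
Qed.

Lemma phi_abs_schur beta : 0 <= beta < alpha ->
  exists2 C : R, 0 <= C & forall t f, cmeas f ->
   (\int[mu]_xi (((`|xi| `^ beta)%:E * phi_abs t f xi) * ((`|xi| `^ beta)%:E * phi_abs t f xi)) <=
    ((C * (1 + `|t|)) ^+ 2)%:E * L2sq (fun x => ((wt alpha beta x)%:C * f x)%R))%E.
Proof.
move=> ba; have [C C0 hC] := osc_schur alpha01 ba; exists C => // t f mf.
have := hC t _ (measurable_cmod mf) (fun x => cmod_ge0 (f x)).
congr (_ <= _)%E.
  by apply: eq_integral => xi _; rewrite phi_absE.
congr (_ * _)%E; apply: eq_integral => x _; rewrite cmodM cmod_real ger0_norm//.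
by rewrite ltW// wt_gt0.
Qed.

Lemma cmeas_wt beta f : cmeas f -> cmeas (fun x => (wt alpha beta x)%:C * f x).
Proof. by move=> mf; apply: cmeasM => //; apply: cmeas_real; exact: measurable_wt. Qed.

Lemma wt0_le beta (x : R) : 0 <= beta -> wt alpha 0 x <= wt alpha beta x.
Proof.
move=> b0; apply: ler_powR; first by rewrite lerDl sqr_ge0.
by rewrite mul0r addr0 lerDl divr_ge0.
Qed.

Lemma inL2_wt0 beta f : 0 <= beta < alpha -> cmeas f -> inL2 (fun x => (wt alpha beta x)%:C * f x) ->
  inL2 (fun x => (wt alpha 0 x)%:C * f x).
Proof.
move=> /andP[b0 ba] mf Lw; have a0 : 0 <= alpha by case/andP: alpha01 => /ltW.
apply: (inL2_le _ Lw); first exact: cmeas_wt.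
move=> x; rewrite !cmodM !cmod_real !ger0_norm ?powR_ge0// ler_wpM2r ?cmod_ge0//.
exact: wt0_le.
Qed.

(** By the case beta = 0 of the Schur bound its square has finite integral. *)
Lemma phi_abs_ae_fin t f : cmeas f -> inL2 (fun x => (wt alpha 0 x)%:C * f x) ->
  {ae mu, forall xi, phi_abs t f xi \is a fin_num}.
Proof.
move=> mf /inL2_lty/L2norm_lty Lw.
have a0 : 0 < alpha by case/andP: alpha01.
have [|C C0 hC] := @phi_abs_schur 0; first by rewrite lexx.
have m2 : measurable_fun [set: R] (fun xi => phi_abs t f xi * phi_abs t f xi)%E.
  by apply: emeasurable_funM; exact: measurable_phi_abs.
have h : mu.-integrable [set: R] (fun xi => phi_abs t f xi * phi_abs t f xi)%E.
  apply/integrableP; split => //; under eq_integral do rewrite gee0_abs ?mule_ge0 ?phi_abs_ge0//.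
  have e : (\int[mu]_xi (phi_abs t f xi * phi_abs t f xi) = \int[mu]_xi
     (((`|xi| `^ 0)%:E * phi_abs t f xi) * ((`|xi| `^ 0)%:E * phi_abs t f xi)))%E.
    by apply: eq_integral => xi _; rewrite powRr0 mul1e.
  rewrite e; apply: le_lt_trans (hC t f mf) _; rewrite lte_mul_pinfty// lee_fin; exact: sqr_ge0.
have := integrable_ae measurableT h; apply: ae_imply => xi /(_ I).
have := phi_abs_ge0 t f xi; case: (phi_abs t f xi) => //=; by rewrite mulyy.
Qed.

Lemma phi_kernel_cintegrable t f xi : cmeas f -> phi_abs t f xi \is a fin_num ->
  cintegrable (fun eta => phi_kernel alpha t f (xi, eta)).
Proof.
move=> mf fin; split; first exact: cmeas_phi_kernel1.
by rewrite -ge0_fin_numE ?nint_ge0.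
Qed.

Lemma Phi_exists_ae t f : cmeas f -> inL2 (fun x => (wt alpha 0 x)%:C * f x) ->
  {ae mu, forall xi, exists l, is_Phi t alpha f xi l}.
Proof.
move=> mf Lw; apply: ae_imply (phi_abs_ae_fin t mf Lw) => xi /(phi_kernel_cintegrable mf) Ki.
by eexists; exact: is_Phi_of_integrable.
Qed.

Definition phi_bound t f xi : R := `|(c_ alpha)^-1| * fine (phi_abs t f xi).

Lemma phi_bound_ge0 t f xi : 0 <= phi_bound t f xi.
Proof. by rewrite mulr_ge0// fine_ge0// phi_abs_ge0. Qed.

Lemma measurable_phi_bound t f : cmeas f -> measurable_fun [set: R] (phi_bound t f).
Proof.
move=> mf; apply: measurable_funM => //; apply: measurableT_comp.
  exact: fine_measurable.
exact: measurable_phi_abs.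
Qed.

Lemma cmod_Phi_le t f xi : inL2 f -> phi_abs t f xi \is a fin_num ->
  cmod (Phi t alpha f xi) <= phi_bound t f xi.
Proof.
move=> Lf fin; have mf := inL2_cmeas Lf; have Ki := phi_kernel_cintegrable mf fin.
rewrite (Phi_eq (is_Phi_of_integrable Ki)) cmodM cmod_real; apply: ler_wpM2l => //.
by rewrite -lee_fin fineK//; exact: cmod_cint.
Qed.

Lemma phi_bound_L2 beta : 0 <= beta < alpha ->
  exists2 C : R, 0 <= C & forall t f, cmeas f -> inL2 (fun x => (wt alpha beta x)%:C * f x) ->
    (L2norm (fun xi => (`|xi| `^ beta * phi_bound t f xi)%R%:C) <=
     (C * (1 + `|t|))%:E * L2norm (fun x => ((wt alpha beta x)%:C * f x)%R))%E.
Proof.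
move=> ba; have [C C0 hC] := phi_abs_schur ba.
exists (`|(c_ alpha)^-1| * C); first by rewrite mulr_ge0.
move=> t f mf Lw; have q0 : 0 <= C * (1 + `|t|) by rewrite mulr_ge0// addr_ge0.
have s0 : 0 <= `|(c_ alpha)^-1| * (C * (1 + `|t|)) by rewrite mulr_ge0.
rewrite -mulrA; apply: L2norm_le => //.
have a2 : 0 <= `|(c_ alpha)^-1| ^+ 2 by exact: sqr_ge0.
have mG : measurable_fun [set: R] (fun xi => ((`|xi| `^ beta)%:E * phi_abs t f xi)%E).
  apply: emeasurable_funM; last exact: measurable_phi_abs.
  by apply/measurable_EFinP; exact: measurable_powR_norm.
have G0 xi : (0 <= (`|xi| `^ beta)%:E * phi_abs t f xi)%E.
  by rewrite mule_ge0 ?phi_abs_ge0// lee_fin powR_ge0.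
apply: (@le_trans _ _ (\int[mu]_xi ((`|(c_ alpha)^-1| ^+ 2)%:E *
   (((`|xi| `^ beta)%:E * phi_abs t f xi) * ((`|xi| `^ beta)%:E * phi_abs t f xi)))%E)%E).
  rewrite le_eqVlt; apply/orP; left; apply/eqP.
  apply: ge0_ae_eq_integral => //.
  - apply/measurable_EFinP; apply: measurable_cmod2; apply: cmeas_real.
    by apply: measurable_funM; [exact: measurable_powR_norm|exact: measurable_phi_bound].
  - by apply: measurable_funeM; exact: emeasurable_funM.
  - by move=> x _; rewrite lee_fin sqr_ge0.
  - by move=> x _; apply: mule_ge0; [rewrite lee_fin|exact: mule_ge0].
  apply: ae_imply (phi_abs_ae_fin t mf (inL2_wt0 ba mf Lw)) => xi fin _.
  rewrite -(fineK fin) -!EFinM; congr EFin.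
  rewrite cmod_real ger0_norm ?mulr_ge0 ?powR_ge0 ?phi_bound_ge0// /phi_bound; first by ring.
  by rewrite fine_ge0// phi_abs_ge0.
have mGG : measurable_fun [set: R] (fun xi => (((`|xi| `^ beta)%:E * phi_abs t f xi) *
   ((`|xi| `^ beta)%:E * phi_abs t f xi))%E) by exact: emeasurable_funM.
have e := @ge0_integralZl _ _ _ mu _ measurableT _ mGG _ (fun x _ => mule_ge0 (G0 x) (G0 x)).
cbv beta in e; rewrite e ?lee_fin//.
have a2E : (0 <= (`|(c_ alpha)^-1| ^+ 2)%:E)%E by rewrite lee_fin.
rewrite exprMn [X in (_ <= X * _)%E]EFinM -[leRHS]muleA.
exact: (lee_wpmul2l a2E (hC t f mf)).
Qed.

Lemma inL2_phi_bound beta t f : 0 <= beta < alpha -> cmeas f ->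
  inL2 (fun x => (wt alpha beta x)%:C * f x) ->
  inL2 (fun xi => (`|xi| `^ beta * phi_bound t f xi)%:C).
Proof.
move=> ba mf Lw; apply/inL2P; split.
  apply: cmeas_real; apply: measurable_funM; first exact: measurable_powR_norm.
  exact: measurable_phi_bound.
have [C C0 hC] := phi_bound_L2 ba; apply: le_lt_trans (hC t f mf Lw) _.
rewrite lte_mul_pinfty ?lee_fin ?mulr_ge0 ?addr_ge0//; exact: inL2_lty.
Qed.

Lemma cmeas_abs_weight beta f : cmeas f -> cmeas (abs_weight beta f).
Proof. by move=> mf; apply: cmeasM => //; apply: cmeas_real; exact: measurable_powR_norm. Qed.

Lemma cmod_abs_weight beta f xi : cmod (abs_weight beta f xi) = `|xi| `^ beta * cmod (f xi).
Proof. by rewrite cmodM cmod_real ger0_norm ?powR_ge0. Qed.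

Lemma ae_L2norm_le f g : cmeas f -> cmeas g -> {ae mu, forall x, cmod (f x) <= cmod (g x)} ->
  (L2norm f <= L2norm g)%E.
Proof.
move=> mf mg fg; rewrite !L2normE; apply: ge0_poweR_le; first exact: L2sq_ge0.
apply: ae_ge0_le_integral => //.
- by move=> x _; rewrite lee_fin sqr_ge0.
- by apply/measurable_EFinP; exact: measurable_cmod2.
- by move=> x _; rewrite lee_fin sqr_ge0.
- by apply/measurable_EFinP; exact: measurable_cmod2.
- by apply: ae_imply fg => x fgx _; rewrite lee_fin ler_pXn2r ?nnegrE ?cmod_ge0.
Qed.

Lemma Phi_L2 beta : 0 <= beta < alpha ->
  exists2 C : R, 0 <= C & forall t f, inL2 f -> inL2 (fun x => (wt alpha beta x)%:C * f x) ->
    (L2norm (abs_weight beta (Phi t alpha f)) <=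
     (C * (1 + `|t|))%:E * L2norm (fun x => ((wt alpha beta x)%:C * f x)%R))%E.
Proof.
move=> ba; have [C C0 hC] := phi_bound_L2 ba; exists C => // t f Lf Lw.
have mf := inL2_cmeas Lf; apply: le_trans (hC t f mf Lw).
apply: ae_L2norm_le.
- by apply: cmeas_abs_weight; exact: cmeas_Phi.
- exact: inL2_cmeas (inL2_phi_bound t ba mf Lw).
apply: ae_imply (phi_abs_ae_fin t mf (inL2_wt0 ba mf Lw)) => xi fin.
have b0 : 0 <= `|xi| `^ beta * phi_bound t f xi.
  by rewrite mulr_ge0 ?powR_ge0 ?phi_bound_ge0.
rewrite cmod_abs_weight cmod_real (ger0_norm b0).
by rewrite ler_wpM2l ?powR_ge0// cmod_Phi_le.
Qed.

Lemma inL2_abs_weight_Phi beta t f : 0 <= beta < alpha -> inL2 f ->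
  inL2 (fun x => (wt alpha beta x)%:C * f x) -> inL2 (abs_weight beta (Phi t alpha f)).
Proof.
move=> ba Lf Lw; apply/inL2P; split; first by apply: cmeas_abs_weight; exact: cmeas_Phi.
have [C C0 hC] := Phi_L2 ba; apply: le_lt_trans (hC t f Lf Lw) _.
rewrite lte_mul_pinfty ?lee_fin ?mulr_ge0 ?addr_ge0//; exact: inL2_lty.
Qed.

Lemma abs_weight0 f : abs_weight 0 f = f.
Proof. by apply/funext => x; rewrite /abs_weight powRr0 mul1r. Qed.

Lemma inL2_Phi t f : inL2 f -> inL2 (fun x => (wt alpha 0 x)%:C * f x) -> inL2 (Phi t alpha f).
Proof.
move=> Lf Lw; rewrite -(abs_weight0 (Phi t alpha f)).
by apply: inL2_abs_weight_Phi => //; rewrite lexx; case/andP: alpha01.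
Qed.

(** The truncations converge a.e. and are dominated by [phi_bound], which is square integrable and
    independent of eps. *)
Lemma Phi_trunc_cvg t f : inL2 f -> inL2 (fun x => (wt alpha 0 x)%:C * f x) ->
  L2norm (fun xi => Phi_trunc t alpha f n.+1%:R^-1 xi - Phi t alpha f xi)
    @[n --> \oo] --> (0%E : \bar R).
Proof.
move=> Lf Lw; have mf := inL2_cmeas Lf.
have fin := phi_abs_ae_fin t mf Lw.
have Lb : inL2 (fun xi => (phi_bound t f xi)%:C).
  have e : (fun xi => (phi_bound t f xi)%:C) = (fun xi => (`|xi| `^ 0 * phi_bound t f xi)%:C).
    by apply/funext => xi; rewrite powRr0 mul1r.
  by rewrite e; apply: inL2_phi_bound => //; rewrite lexx; case/andP: alpha01.
apply: (L2_dominated_ae _ _ Lb).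
- by move=> n; exact: cmeas_Phi_trunc.
- exact: cmeas_Phi.
- apply: ae_imply fin => xi fin n; rewrite cmod_real ger0_norm ?phi_bound_ge0//.
  apply: cmod_Phi_trunc_le => //.
  exact: phi_kernel_cintegrable.
- apply: ae_imply fin => xi /(phi_kernel_cintegrable mf) Ki.
  have h := is_Phi_of_integrable Ki; rewrite (Phi_eq h).
  exact: is_Phi_seq h harmonic_gt0 cvg_invn.
Qed.

End phi_L2.

(** * Truncated fractional derivatives *)

Section tail_convolution.
Context {R : realType}.
Local Notation mu := (@lebesgue_measure R).
Variables (alpha : R) (alpha01 : 0 < alpha < 1) (eps : R) (eps0 : 0 < eps).
Implicit Types (f g h : R -> R[i]).

Local Notation k := (fun eta : R => (tail_kernel alpha eps eta)%:C).
Local Notation kappa := (tail_mass alpha eps).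

Let ki : cintegrable k. Proof. exact: cintegrable_tail_kernel. Qed.
Let k2 : inL2 k. Proof. exact: inL2_tail_kernel. Qed.
Let sqrN1 : (- 1) ^+ 2 = 1 :> R. Proof. by rewrite sqrrN expr1n. Qed.

(** A convolution, the kernel being even; the sign is the one in the definition of Phi. *)
Definition tail_conv h (xi : R) : R[i] := cint (fun eta => (tail_kernel alpha eps eta)%:C * h (xi + eta)).

Lemma tail_conv_cintegrable h xi : inL2 h ->
  cintegrable (fun eta => (tail_kernel alpha eps eta)%:C * h (xi + eta)).
Proof. by move=> Lh; apply: inL2_mul_cintegrable => //; exact: inL2_shift. Qed.

Lemma cmeas_tail_conv h : cmeas h -> cmeas (tail_conv h).
Proof.
move=> mh; apply: (@cmeas_cint _ (fun z => (tail_kernel alpha eps z.2)%:C * h (z.1 + z.2))).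
apply: cmeasM; first by apply: (@cmeas_snd _ k); case: ki.
by apply: (cmeas_comp mh); apply: measurable_funD; [exact: measurable_fst|exact: measurable_snd].
Qed.

Lemma tail_convB h g xi : inL2 h -> inL2 g ->
  tail_conv (fun x => h x - g x) xi = tail_conv h xi - tail_conv g xi.
Proof.
move=> Lh Lg; rewrite /tail_conv -cintB; [|exact: tail_conv_cintegrable..].
by apply: eq_cint => eta; rewrite mulrBr.
Qed.

Lemma integral_tail_kernel_shift s :
  (\int[mu]_x (tail_kernel alpha eps (x + s))%:E = kappa%:E)%E.
Proof.
rewrite (@integral_shift _ (fun x => (tail_kernel alpha eps x)%:E)).
- by rewrite tail_massE.
- by apply/measurable_EFinP; exact: measurable_tail_kernel.
- by move=> x; rewrite lee_fin tail_kernel_ge0.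
Qed.

Lemma cmod_tail_conv_le h xi : inL2 h ->
  ((cmod (tail_conv h xi))%:E <=
   \int[mu]_zeta (tail_kernel alpha eps (zeta - xi) * cmod (h zeta))%:E)%E.
Proof.
move=> Lh; have mh := inL2_cmeas Lh.
apply: le_trans (cmod_cint (tail_conv_cintegrable xi Lh)) _.
rewrite le_eqVlt; apply/orP; left; apply/eqP; rewrite /nint.
pose G zeta := (tail_kernel alpha eps (zeta - xi) * cmod (h zeta))%:E.
have mG : measurable_fun [set: R] G.
  apply/measurable_EFinP; apply: measurable_funM; last exact: measurable_cmod.
  by apply: (measurableT_comp (measurable_tail_kernel alpha eps)); exact: measurable_funD.
have G0 zeta : (0 <= G zeta)%E by rewrite lee_fin mulr_ge0 ?tail_kernel_ge0 ?cmod_ge0.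
rewrite -(integral_shift xi mG G0); apply: eq_integral => eta _.
by rewrite /G cmodM cmod_tail_kernel addrK (addrC eta).
Qed.

(** Young's inequality, obtained from Schur's test: both marginals of the translated kernel equal
    its mass. *)
Lemma tail_conv_L2 h : inL2 h -> (L2norm (tail_conv h) <= kappa%:E * L2norm h)%E.
Proof.
move=> Lh; have mh := inL2_cmeas Lh; have kp0 := tail_mass_ge0 alpha eps.
apply: L2norm_le => //.
pose kk (z : R * R) := tail_kernel alpha eps (z.2 - z.1).
have mkk : measurable_fun [set: R * R] kk.
  apply: (measurableT_comp (measurable_tail_kernel alpha eps)).
  by apply: measurable_funB; [exact: measurable_snd|exact: measurable_fst].
have := @schur_test _ kk (fun x => cmod (h x)) kappa kappa mkk (measurable_cmod mh)
  (fun z => tail_kernel_ge0 _ _ _) (fun x => cmod_ge0 _) kp0 kp0.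
move=> /(_ _ _)/le_trans H; rewrite expr2.
apply: le_trans (H _ _ _ (lexx _)).
- apply: ge0_le_integral => //.
  + by move=> x _; rewrite lee_fin sqr_ge0.
  + by apply/measurable_EFinP; apply: measurable_cmod2; exact: cmeas_tail_conv.
  + have mf2 : measurable_fun [set: R * R] (fun z : R * R => kk z * cmod (h z.2)).
      by apply: measurable_funM => //; exact: (measurableT_comp (measurable_cmod mh) measurable_snd).
    have f0 (z : R * R) : 0 <= kk z * cmod (h z.2) by rewrite mulr_ge0 ?tail_kernel_ge0 ?cmod_ge0.
    have mi := measurable_integral2 mf2 f0.
    exact: (emeasurable_funM mi mi).
  + move=> xi _; rewrite expr2 EFinM; apply: lee_pmul; rewrite ?lee_fin ?cmod_ge0//;
      exact: cmod_tail_conv_le.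
- by move=> x; rewrite /kk /= integral_tail_kernel_shift.
- move=> y; rewrite /kk /=; under eq_integral do rewrite -tail_kernelN opprB.
  by rewrite integral_tail_kernel_shift.
Qed.

Lemma inL2_tail_conv h : inL2 h -> inL2 (tail_conv h).
Proof.
move=> Lh; apply/inL2P; split; first by apply: cmeas_tail_conv; exact: inL2_cmeas.
apply: le_lt_trans (tail_conv_L2 Lh) _.
by rewrite lte_mul_pinfty ?lee_fin ?tail_mass_ge0// inL2_lty.
Qed.

Definition tail_hat (x : R) : R[i] := hat (- 1) k x.

Lemma cmeas_tail_hat : cmeas tail_hat.
Proof. by apply: cmeas_hat; case: ki. Qed.

Lemma cmod_tail_hat_le x : cmod (tail_hat x) <= fine (nint k).
Proof. exact: cmod_hat_le. Qed.

Lemma tail_conv_hat g xi : cintegrable g ->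
  tail_conv (hat (- 1) g) xi = hat (- 1) (fun x => tail_hat x * g x) xi.
Proof.
move=> gi; have [mg _] := gi; have [mk _] := ki.
pose K (z : R * R) : R[i] := (tail_kernel alpha eps z.1)%:C * (cis (- 1 * (z.2 * (xi + z.1))) * g z.2).
have mK : cmeas K.
  apply: cmeasM; first exact: (@cmeas_fst _ k).
  apply: cmeasM; last exact: cmeas_snd.
  apply: cmeas_cis; apply: measurable_funM => //; apply: measurable_funM; first exact: measurable_snd.
  by apply: measurable_funD => //; exact: measurable_fst.
have Kab x y : cmod (K (x, y)) <= cmod (k x) * cmod (g y).
  by rewrite /K /= !cmodM cmod_cis mul1r.
transitivity (cint (fun eta => cint (fun x => K (eta, x)))).
  by apply: eq_cint => eta; rewrite /K /= cintZ//; exact: cintegrable_cis.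
rewrite (cfubini_prod mK ki gi Kab); apply: eq_cint => x.
have -> : cis (- 1 * (x * xi)) * (tail_hat x * g x) = (cis (- 1 * (x * xi)) * g x) * tail_hat x.
  by ring.
rewrite /tail_hat /hat -cintZ; last exact: (cintegrable_cis (- 1) x ki).
apply: eq_cint => eta; rewrite /K /=.
have -> : - 1 * (x * (xi + eta)) = - 1 * (x * xi) + - 1 * (eta * x) by ring.
by rewrite cisD; ring.
Qed.

Lemma inL2_tail_hat_mul g : inL2 g -> inL2 (fun x => tail_hat x * g x).
Proof.
by apply: (inL2_bounded (B := fine (nint k))); [exact: cmeas_tail_hat|exact: cmod_tail_hat_le].
Qed.

(** For integrable g this is Fubini ([tail_conv_hat]); the L^2 bound on the convolution carries it
    over from the truncations of g. *)
Lemma tail_conv_FT g h : is_FT (- 1) g h ->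
  is_FT (- 1) (fun x => tail_hat x * g x) (tail_conv h).
Proof.
move=> gh; have [Lg Lh ghc] := gh; split.
- exact: inL2_tail_hat_mul.
- exact: inL2_tail_conv.
have kp0 := tail_mass_ge0 alpha eps.
apply: (@squeeze_cvge0 _ _ _ _ _ (fun n => kappa%:E *
   L2norm (fun xi => h xi - hat (- 1) (trunc n g) xi)%R)%E).
- by move=> n; exact: L2norm_ge0.
- move=> n; have Lt := inL2_hat_trunc n sqrN1 Lg.
  apply: le_trans (tail_conv_L2 (inL2B Lh Lt)).
  rewrite le_eqVlt; apply/orP; left; apply/eqP; apply: eq_L2norm => xi.
  rewrite tail_convB// tail_conv_hat; last exact: cintegrable_trunc.
  congr (cmod (_ - _)); apply: eq_cint => x; congr (_ * _).
  by rewrite /trunc mulrCA.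
- by rewrite -(mule0 kappa%:E); apply: cvgeZl.
Qed.

Definition tail_mult (x : R) : R[i] := ((c_ alpha)^-1)%:C * (tail_hat x - kappa%:C).

(** The operator T_eps, with its difference split in two; this is possible because the truncated
    kernel has finite mass [kappa]. [tail_mult] is the corresponding multiplier. *)
Definition tail_op h (xi : R) : R[i] := ((c_ alpha)^-1)%:C * (tail_conv h xi - kappa%:C * h xi).

Lemma tail_op_FT g h : is_FT (- 1) g h ->
  is_FT (- 1) (fun x => tail_mult x * g x) (tail_op h).
Proof.
move=> gh; set c := ((c_ alpha)^-1)%:C.
have h1 := FT_lin (- kappa%:C) gh (tail_conv_FT gh).
(* Multiplication by c, written as (c - 1) times the pair plus the pair itself to fit [FT_lin]. *)
have := FT_lin (c - 1) h1 h1; congr is_FT; apply/funext => x.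
  by rewrite /tail_mult -/c; ring.
by rewrite /tail_op -/c; ring.
Qed.

(** The phase at xi + eta is the phase at xi times 1 + (exp (i t ((xi + eta)^3 - xi^3)) - 1). The 1
    reproduces the convolution, the bracket is the integrand of the truncated Phi, and the term in
    [kappa] carries only the phase at xi. *)
Lemma tail_op_twist t h xi : inL2 h ->
  tail_op (fun zeta => cis (t * zeta ^+ 3) * h zeta) xi =
  cis (t * xi ^+ 3) * (tail_op h xi + Phi_trunc t alpha h eps xi).
Proof.
move=> Lh; rewrite /tail_op Phi_truncE.
have me : cmeas (fun zeta : R => cis (t * zeta ^+ 3)).
  by apply: cmeas_cis; apply: measurable_funM => //; exact: measurable_funX.
have Leh : inL2 (fun zeta => cis (t * zeta ^+ 3) * h zeta).
  by apply: (inL2_bounded (B := 1)) => // x; rewrite cmod_cis.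
have Pi := cintegrable_phi_trunc alpha01 t xi eps0 Lh.
have Ci := tail_conv_cintegrable xi Lh.
suff -> : tail_conv (fun zeta => cis (t * zeta ^+ 3) * h zeta) xi =
    cis (t * xi ^+ 3) * (tail_conv h xi +
      cint (fun eta => cindic (outer eps) eta * phi_kernel alpha t h (xi, eta))) by ring.
rewrite /tail_conv -cintD// -cintZ; last exact: cintegrableD.
apply: eq_cint => eta; rewrite cindic_phi_kernel.
have -> : t * (xi + eta) ^+ 3 = t * xi ^+ 3 + t * ((xi + eta) ^+ 3 - xi ^+ 3) by ring.
by rewrite cisD; ring.
Qed.

(** Averaging over eta and -eta removes the sine, as the kernel is even. *)
Lemma tail_hatE x :
  tail_hat x = cint (fun eta => (cos (x * eta))%:C * (tail_kernel alpha eps eta)%:C).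
Proof.
pose F eta := cis (- 1 * (eta * x)) * (tail_kernel alpha eps eta)%:C.
have Fi : cintegrable F by exact: cintegrable_cis.
have Fni : cintegrable (fun eta => F (- eta)).
  have e : (fun eta => F (- eta)) = fun eta => cis (1 * (eta * x)) * (tail_kernel alpha eps eta)%:C.
    by apply/funext => eta; rewrite /F tail_kernelN; congr (cis _ * _); ring.
  by rewrite e; exact: cintegrable_cis.
have ci : cintegrable (fun eta => (cos (x * eta))%:C * (tail_kernel alpha eps eta)%:C).
  apply: (cintegrable_bounded (B := 1)) ki.
    by apply: cmeas_real; exact: measurable_cosM.
  by move=> eta; rewrite cmod_real norm_cos_le1.
have h : cint F + cint (fun eta => F (- eta)) =
    2 * cint (fun eta => (cos (x * eta))%:C * (tail_kernel alpha eps eta)%:C).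
  rewrite -cintD// -cintZ//; apply: eq_cint => eta; rewrite /F tail_kernelN mulrA -mulrDl.
  congr (_ * _); apply: complexP; rewrite /= ?mulrN ?mulNr ?mul1r ?opprK ?cosN ?sinN.
    by rewrite mulrC; ring.
  by rewrite mulrC; ring.
have [mF _] := Fi; rewrite (cint_opp mF) in h.
have two0 : (2 : R[i]) != 0 by rewrite pnatr_eq0.
by apply: (mulfI two0); rewrite -h mulr_natl mulr2n.
Qed.

End tail_convolution.

(** * The truncated multipliers and their limit |x|^alpha *)

Section tail_multiplier.
Context {R : realType}.
Local Notation mu := (@lebesgue_measure R).
Variables (alpha : R) (alpha01 : 0 < alpha < 1).

Definition cos_kernel (x eta : R) : R[i] := ((1 - cos (x * eta)) * frac_kernel alpha eta)%:C.

Let cos_kernel_ge0 x eta : 0 <= (1 - cos (x * eta)) * frac_kernel alpha eta.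
Proof. by rewrite mulr_ge0 ?one_sub_cos_ge0 ?frac_kernel_ge0. Qed.

Lemma nint_cos_kernel x : nint (cos_kernel x) = (`|x| `^ alpha * - c_ alpha)%:E.
Proof.
rewrite EFinM -(frac_constE alpha01) -(integral_frac_multiplier alpha01); apply: eq_integral => eta _.
by rewrite /cos_kernel cmod_real ger0_norm.
Qed.

Lemma cintegrable_cos_kernel x : cintegrable (cos_kernel x).
Proof.
split; last by rewrite nint_cos_kernel ltry.
apply: cmeas_real; apply: measurable_funM; last exact: measurable_frac_kernel.
exact: measurable_one_sub_cos.
Qed.

Lemma cint_cos_kernel x : cint (cos_kernel x) = (`|x| `^ alpha * - c_ alpha)%:C.
Proof.
have e : (\int[mu]_eta ((1 - cos (x * eta)) * frac_kernel alpha eta)%:E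
    = (`|x| `^ alpha * - c_ alpha)%:E)%E.
  by rewrite EFinM -(frac_constE alpha01) (integral_frac_multiplier alpha01).
by rewrite cint_real /Rintegral e.
Qed.

Lemma tail_multE eps x : 0 < eps -> tail_mult alpha eps x =
  ((- c_ alpha)^-1)%:C * cint (fun eta => cindic (outer eps) eta * cos_kernel x eta).
Proof.
move=> e0; have ki := cintegrable_tail_kernel alpha01 e0.
rewrite /tail_mult (tail_hatE alpha01 e0 x).
have -> : (tail_mass alpha eps)%:C = cint (fun eta => (tail_kernel alpha eps eta)%:C).
  by rewrite cint_real.
rewrite -cintB//; last first.
  apply: (cintegrable_bounded (B := 1)) ki.
    by apply: cmeas_real; exact: measurable_cosM.
  by move=> eta; rewrite cmod_real norm_cos_le1.
have -> : (fun eta => (cos (x * eta))%:C * (tail_kernel alpha eps eta)%:C - (tail_kernel alpha eps eta)%:C)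
    = (fun eta => - (cindic (outer eps) eta * cos_kernel x eta)).
  apply/funext => eta; rewrite /cindic /cos_kernel /tail_kernel -!rmorphM -rmorphB -rmorphN.
  by congr (_%:C); ring.
rewrite cintN; last first.
  apply: (cintegrable_bounded (B := 1)); last exact: cintegrable_cos_kernel.
    by apply: cmeas_cindic; exact: measurable_outer.
  by move=> eta; exact: cmod_cindic_le1.
by rewrite invrN mulrN rmorphN mulNr.
Qed.

(** The integrand (1 - cos) times the kernel is nonnegative and its full integral is -c_alpha
    |x|^alpha. The bound makes |x|^alpha u a majorant for dominated convergence in L^2. *)
Lemma cmod_tail_mult_le eps x : 0 < eps -> cmod (tail_mult alpha eps x) <= `|x| `^ alpha.
Proof.
move=> e0; rewrite tail_multE//.
have c0 : 0 < - c_ alpha by rewrite oppr_gt0; exact: c_alpha_lt0.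
have [mc _] := cintegrable_cos_kernel x.
have h : cmod (cint (fun eta => cindic (outer eps) eta * cos_kernel x eta)) <=
    `|x| `^ alpha * - c_ alpha.
  apply: (@cmod_cint_le _ _ _ _ _ (measurable_cmod mc)).
  - by apply: cmeasM => //; apply: cmeas_cindic; exact: measurable_outer.
  - by move=> eta; rewrite cmodM ler_piMl ?cmod_ge0 ?cmod_cindic_le1.
  - by rewrite -/(nint _) nint_cos_kernel.
rewrite cmodM cmod_real gtr0_norm ?invr_gt0// mulrC ler_pdivrMr//.
Qed.

Lemma tail_mult_cvg x :
  cmod (tail_mult alpha n.+1%:R^-1 x - (`|x| `^ alpha)%:C) @[n --> \oo] --> (0 : R).
Proof.
have c0 : - c_ alpha != 0 by rewrite oppr_eq0 lt_eqF// c_alpha_lt0.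
have L := @cvg_cint_cindic _ (fun n => outer n.+1%:R^-1) setT _
  (fun n => measurable_outer _) measurableT (cintegrable_cos_kernel x)
  (ae_imply (fun x x0 => cindic_outer_0 x0 cvg_invn) ae_neq0).
apply: near_eq_cvgn (cvgn0Z (cmod ((- c_ alpha)^-1)%:C) L); apply: nearW => n.
rewrite tail_multE ?harmonic_gt0// -cmodM mulrBr; congr (cmod (_ - _)).
rewrite (_ : cint _ = cint (cos_kernel x)); last first.
  by apply: eq_cint => eta; rewrite /cindic indicT mul1r.
by rewrite cint_cos_kernel -rmorphM; congr (_%:C); rewrite mulrCA mulVf// mulr1.
Qed.

End tail_multiplier.

(** * The weighted identity as a limit of truncated ones *)

Section core.
Context {R : realType}.
Local Notation mu := (@lebesgue_measure R).
Variables (alpha : R) (alpha01 : 0 < alpha < 1).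
Implicit Types (f g h u : R -> R[i]) (t : R).

Local Notation eps_ n := (n.+1%:R^-1 : R).

Lemma cvgne0Z (a : R) (v : nat -> \bar R) : v n @[n --> \oo] --> 0%E ->
  (a%:E * v n)%E @[n --> \oo] --> 0%E.
Proof. by move=> v0; rewrite -(mule0 a%:E); exact: cvgeZl. Qed.

Lemma near_eq_cvgne (u v : nat -> \bar R) (l : \bar R) : (\forall n \near \oo, v n = u n) ->
  v n @[n --> \oo] --> l -> u n @[n --> \oo] --> l.
Proof. by move=> h; apply: cvg_trans; apply: near_eq_cvg. Qed.

Lemma cmeas_tail_mult eps : 0 < eps -> cmeas (tail_mult alpha eps).
Proof.
move=> e0; apply: cmeasM; first exact: cmeas_cst.
by apply: cmeasB; [exact: cmeas_tail_hat|exact: cmeas_cst].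
Qed.

Lemma FT_norm g h : is_FT (- 1) g h -> L2norm h = ((Num.sqrt (2 * pi))%:E * L2norm g)%E.
Proof.
move=> gh; have [Lg Lh _] := gh; rewrite -L2norm_fourier//; apply: ae_eq_L2norm.
- exact: inL2_cmeas.
- by apply: inL2_cmeas; exact: inL2_fourier.
- by apply: ae_imply (fourier_eq gh) => x ->.
Qed.

Lemma FT_sub g g' h h' : is_FT (- 1) g h -> is_FT (- 1) g' h' ->
  is_FT (- 1) (fun x => g x - g' x) (fun x => h x - h' x).
Proof.
by move=> gh gh'; have := FT_lin (- 1) gh' gh; congr is_FT; apply/funext => x; rewrite mulN1r addrC.
Qed.

Lemma tail_mult_L2_cvg u : inL2 u -> inL2 (abs_weight alpha u) ->
  L2norm (fun x => tail_mult alpha (eps_ n) x * u x - abs_weight alpha u x)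
    @[n --> \oo] --> (0%E : \bar R).
Proof.
move=> Lu Lw; have mu_ := inL2_cmeas Lu.
apply: (L2_dominated _ _ Lw).
- by move=> n; apply: cmeasM => //; exact: cmeas_tail_mult.
- exact: inL2_cmeas.
- move=> n x; rewrite cmod_abs_weight cmodM ler_wpM2r ?cmod_ge0//.
  by apply: cmod_tail_mult_le => //; exact: harmonic_gt0.
- apply: ae_everywhere => x; have L := tail_mult_cvg alpha01 x.
  apply: near_eq_cvgn (cvgn0Z (cmod (u x)) L); apply: nearW => n.
  by rewrite -cmodM mulrBr /abs_weight ![u x * _]mulrC.
Qed.

(** Plancherel transports the convergence of the multipliers on u, where |x|^alpha u is square
    integrable by hypothesis. *)
Lemma tail_op_cvg u : inL2 u -> inL2 (abs_weight alpha u) ->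
  L2norm (fun xi => tail_op alpha (eps_ n) (fourier u) xi - fourier (abs_weight alpha u) xi)
    @[n --> \oo] --> (0%E : \bar R).
Proof.
move=> Lu Lw; apply: near_eq_cvgne (cvgne0Z (Num.sqrt (2 * pi)) (tail_mult_L2_cvg Lu Lw)).
apply: nearW => n.
have h := tail_op_FT alpha01 (harmonic_gt0 n) (is_FT_fourier Lu).
by rewrite -(FT_norm (FT_sub h (is_FT_fourier Lw))).
Qed.

Definition twist t f (xi : R) : R[i] := cis (t * xi ^+ 3) * f xi.

Lemma cmeas_twist_factor t : cmeas (fun xi : R => cis (t * xi ^+ 3)).
Proof. by apply: cmeas_cis; apply: measurable_funM => //; exact: measurable_funX. Qed.

Lemma inL2_twist t f : inL2 f -> inL2 (twist t f).
Proof.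
apply: (inL2_bounded (B := 1)); first exact: cmeas_twist_factor.
by move=> x; rewrite cmod_cis.
Qed.

(** The truncated multipliers applied to v = U(t) u have transforms known from [tail_op_twist].
    These converge in L^2, whereas the multipliers tend to |x|^alpha pointwise; [L2_lim_ae]
    identifies the two limits. *)
Lemma abs_weight_airy t u : inL2 u -> inL2 (abs_weight alpha u) ->
  inL2 (fun x => (wt alpha 0 x)%:C * fourier u x) ->
  {ae mu, forall x, abs_weight alpha (airy_group t u) x =
    ifourier (twist t (fun xi => fourier (abs_weight alpha u) xi + Phi t alpha (fourier u) xi)) x}.
Proof.
move=> Lu Lw Lwt; set f := fourier u; set F := fourier (abs_weight alpha u).
have Lf : inL2 f := inL2_fourier Lu; have LF : inL2 F := inL2_fourier Lw.
have LP : inL2 (Phi t alpha f) := inL2_Phi alpha01 t Lf Lwt.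
have LFP := inL2D LF LP; set S := fun xi => F xi + Phi t alpha f xi in LFP *.
have LG := inL2_twist t LFP; have Lef := inL2_twist t Lf.
have Lv := inL2_ifourier Lef; set v := ifourier (twist t f) in Lv.
have Lg := inL2_ifourier LG.
have vE : is_FT (- 1) v (twist t f) := FT_ae (is_FT_fourier Lv) Lef (ifourierK Lef).
have gE : is_FT (- 1) (ifourier (twist t S)) (twist t S) :=
  FT_ae (is_FT_fourier Lg) LG (ifourierK LG).
pose av n x := tail_mult alpha (eps_ n) x * v x.
have avE n : is_FT (- 1) (av n) (tail_op alpha (eps_ n) (twist t f)) :=
  tail_op_FT alpha01 (harmonic_gt0 n) vE.
have mP n : cmeas (Phi_trunc t alpha f (eps_ n)).
  by apply: cmeas_Phi_trunc; exact: inL2_cmeas.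
have mTf n : cmeas (tail_op alpha (eps_ n) f).
  by have [_ /inL2_cmeas] := tail_op_FT alpha01 (harmonic_gt0 n) (is_FT_fourier Lu).
(* The common phase has modulus 1 and drops out, leaving one error for the data, where the weight is
   known to be in L^2, and one for Phi. *)
have cT : L2norm (fun xi => tail_op alpha (eps_ n) (twist t f) xi - twist t S xi)
    @[n --> \oo] --> (0%E : \bar R).
  apply: (@squeeze_cvge0 _ _ _ _ _ (fun n =>
     (L2norm (fun xi => tail_op alpha (eps_ n) f xi - F xi)%R +
      L2norm (fun xi => Phi_trunc t alpha f (eps_ n) xi - Phi t alpha f xi)%R)%E)).
  - by move=> n; exact: L2norm_ge0.
  - move=> n; apply: le_trans (L2normD _ _); last 2 first.
    + by apply: cmeasB => //; exact: inL2_cmeas.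
    + by apply: cmeasB => //; exact: inL2_cmeas.
    rewrite le_eqVlt; apply/orP; left; apply/eqP; apply: eq_L2norm => xi.
    rewrite (tail_op_twist alpha01 (harmonic_gt0 n) t xi Lf) /twist -mulrBr cmodM cmod_cis mul1r.
    by rewrite /S; congr cmod; ring.
  - rewrite -(adde0 0%E); apply: cvgeD => //; first exact: tail_op_cvg.
    exact: Phi_trunc_cvg.
have ca : L2norm (fun x => av n x - ifourier (twist t S) x) @[n --> \oo] --> (0%E : \bar R).
  have s0 : 0 < Num.sqrt (2 * pi : R) by rewrite sqrtr_gt0 mulr_gt0// pi_gt0.
  apply: near_eq_cvgne (cvgne0Z (Num.sqrt (2 * pi))^-1 cT); apply: nearW => n.
  by rewrite (FT_norm (FT_sub (avE n) gE)) muleA -EFinM mulVf ?gt_eqF// mul1e.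
have mv := inL2_cmeas Lv.
have := @L2_lim_ae _ av _ (abs_weight alpha v) _ (inL2_cmeas Lg) _ ca.
move=> h; apply: ae_imply (h _ _ _) => [x -> //| n||].
- by apply: cmeasM => //; exact: cmeas_tail_mult.
- exact: cmeas_abs_weight.
- apply: ae_everywhere => x; apply: near_eq_cvgn (cvgn0Z (cmod (v x)) (tail_mult_cvg alpha01 x)).
  by apply: nearW => n; rewrite -cmodM mulrBr /abs_weight /av ![v x * _]mulrC.
Qed.

End core.

(** * The identities and the estimates *)

Section assembly.
Context {R : realType}.
Local Notation mu := (@lebesgue_measure R).
Implicit Types (f g u : R -> R[i]) (t s beta : R).

Lemma ae_inL2 f g : cmeas f -> inL2 g -> {ae mu, forall x, f x = g x} -> inL2 f.
Proof.
move=> mf Lg fg; apply/inL2P; split => //.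
by rewrite (ae_eq_L2norm mf (inL2_cmeas Lg) fg) inL2_lty.
Qed.

Lemma airy_ifourier t f : inL2 f -> airy_group t (ifourier f) = ifourier (twist t f).
Proof.
move=> Lf; apply: eq_ifourier.
- by apply: inL2_twist; apply: inL2_fourier; exact: inL2_ifourier.
- exact: inL2_twist.
- by apply: ae_imply (ifourierK Lf) => x; rewrite /twist => ->.
Qed.

Lemma inL2_abs_weight_fourierK beta f : inL2 f -> inL2 (abs_weight beta f) ->
  inL2 (abs_weight beta (fourier (ifourier f))).
Proof.
move=> Lf Lb; apply: (ae_inL2 _ Lb).
  by apply: cmeas_abs_weight; apply: inL2_cmeas; apply: inL2_fourier; exact: inL2_ifourier.
by apply: ae_imply (ifourierK Lf) => x; rewrite /abs_weight => ->.
Qed.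

Lemma frac_deriv_ifourier beta f : inL2 f -> inL2 (abs_weight beta f) ->
  frac_deriv beta (ifourier f) = ifourier (abs_weight beta f).
Proof.
move=> Lf Lb; apply: eq_ifourier => //; first exact: inL2_abs_weight_fourierK.
by apply: ae_imply (ifourierK Lf) => x; rewrite /abs_weight => ->.
Qed.

Lemma abs_weightD beta f g :
  abs_weight beta (fun x => f x + g x) = fun x => abs_weight beta f x + abs_weight beta g x.
Proof. by apply/funext => x; rewrite /abs_weight mulrDr. Qed.

Lemma abs_weight_twist beta t f : abs_weight beta (twist t f) = twist t (abs_weight beta f).
Proof. by apply/funext => x; rewrite /abs_weight /twist mulrCA. Qed.

Lemma twistD t f g : twist t (fun x => f x + g x) = fun x => twist t f x + twist t g x.
Proof. by apply/funext => x; rewrite /twist mulrDr. Qed.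

Variables (alpha : R) (alpha01 : 0 < alpha < 1).

Let a0 : 0 < alpha. Proof. by case/andP: alpha01. Qed.

Lemma wt_le beta (x : R) : 0 <= beta ->
  wt alpha beta x <= 2 `^ (alpha + beta / 2) * (1 + `|x| `^ (beta + 2 * alpha)).
Proof.
move=> b0; have p0 : 0 <= alpha + beta / 2 by rewrite addr_ge0 ?divr_ge0 ?(ltW a0).
have x2 : x ^+ 2 = `|x| ^+ 2 by rewrite real_normK ?num_real.
rewrite /wt x2; have [x1|/ltW x1] := leP `|x| 1.
  apply: (@le_trans _ _ (2 `^ (alpha + beta / 2))).
    apply: ge0_ler_powR => //; rewrite ?nnegrE ?addr_ge0 ?exprn_ge0//.
    by rewrite -[leRHS]/(1 + 1) lerD2l expr_le1.
  by rewrite ler_peMr ?powR_ge0// lerDl powR_ge0.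
apply: (@le_trans _ _ ((2 * `|x| ^+ 2) `^ (alpha + beta / 2))).
  apply: ge0_ler_powR => //; rewrite ?nnegrE ?addr_ge0 ?mulr_ge0 ?exprn_ge0//.
  by rewrite mulr_natl mulr2n lerD2r expr_ge1.
rewrite powRM ?exprn_ge0// ler_wpM2l ?powR_ge0//.
have -> : (`|x| ^+ 2) `^ (alpha + beta / 2) = `|x| `^ (beta + 2 * alpha).
  by rewrite -powR_mulrn// -powRrM; congr (_ `^ _); field.
by rewrite lerDr.
Qed.

(** Half of beta + 2 alpha is the exponent in [wt], so the first claim is the Sobolev condition
    itself; the homogeneous weight is smaller. *)
Lemma inL2_of_inH beta u : 0 <= beta -> inH (beta + 2 * alpha) u ->
  inL2 (fun x => (wt alpha beta x)%:C * fourier u x) /\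
  inL2 (abs_weight (beta + 2 * alpha) (fourier u)).
Proof.
move=> b0 [Lu LH].
have L : inL2 (fun x => (wt alpha beta x)%:C * fourier u x).
  move: LH; congr inL2; apply/funext => x; rewrite /wt; congr (_%:C * _).
  by congr (_ `^ _); field.
split; first exact: L.
have ma : cmeas (abs_weight (beta + 2 * alpha) (fourier u)).
  by apply: cmeas_abs_weight; apply: inL2_cmeas; exact: inL2_fourier.
apply: (inL2_le ma L) => x.
have w0 : 0 <= wt alpha beta x by exact: powR_ge0.
have sE : (beta + 2 * alpha) / 2 = alpha + beta / 2 by field.
have s0 : 0 <= beta + 2 * alpha by rewrite addr_ge0// mulr_ge0// ltW.
have := norm_powR_le_bracket x s0; rewrite sE -/(wt alpha beta x) => h.
rewrite cmod_abs_weight cmodM cmod_real (ger0_norm w0).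
exact: (ler_wpM2r (cmod_ge0 _) h).
Qed.

(** The bracket is compared with 1 + |x|^(beta + 2 alpha), and Minkowski's inequality splits the sum
    into the two terms of the estimates to be proved. *)
Lemma L2norm_wt_le beta f : 0 <= beta -> cmeas f ->
  (L2norm (fun x => ((wt alpha beta x)%:C * f x)%R) <=
   (2 `^ (alpha + beta / 2))%:E * (L2norm f + L2norm (abs_weight (beta + 2 * alpha) f)))%E.
Proof.
move=> b0 mf; have ma := cmeas_abs_weight (beta + 2 * alpha) mf.
have c0 : 0 <= 2 `^ (alpha + beta / 2) :> R by exact: powR_ge0.
have c0E : (0 <= (2 `^ (alpha + beta / 2) : R)%:E)%E by rewrite lee_fin.
apply: le_trans (lee_wpmul2l c0E (L2normD mf ma)).
have := @L2normZ _ (2 `^ (alpha + beta / 2))%:C _ (cmeasD mf ma).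
rewrite cmod_real ger0_norm// => <-; apply: L2norm_mono.
- exact: cmeas_wt.
- by apply: cmeasM; [exact: cmeas_cst|exact: cmeasD].
move=> x; have -> : f x + abs_weight (beta + 2 * alpha) f x = (1 + `|x| `^ (beta + 2 * alpha))%:C * f x.
  by rewrite /abs_weight; set y := _ `^ _; rewrite rmorphD rmorph1 mulrDl mul1r.
have w0 : 0 <= wt alpha beta x by exact: powR_ge0.
have w1 := wt_le x b0; rewrite mulrA -rmorphM !cmodM !cmod_real.
by rewrite (ger0_norm w0) (ger0_norm (le_trans w0 w1)) ler_wpM2r ?cmod_ge0.
Qed.

(** The bound on the Fourier side, carried to the physical side by Plancherel; beta = 0 is the
    estimate of part (i). *)
Lemma Phi_estimate beta : 0 <= beta < alpha -> exists2 C : R, 0 <= C &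
  forall u t, inH (beta + 2 * alpha) u ->
   (L2norm (ifourier (abs_weight beta (Phi t alpha (fourier u)))) <=
    (C * (1 + `|t|))%:E * (L2norm u + L2norm (frac_deriv (beta + 2 * alpha) u)))%E.
Proof.
move=> ba; have /andP[b0 _] := ba; have [C C0 hC] := Phi_L2 alpha01 ba.
pose K : R := 2 `^ (alpha + beta / 2); have K0 : 0 <= K by exact: powR_ge0.
exists (C * K); first exact: mulr_ge0.
move=> u t Hu; have [Lu _] := Hu; have [Lw La] := inL2_of_inH b0 Hu.
have Lf := inL2_fourier Lu; have LP := inL2_abs_weight_Phi alpha01 t ba Lf Lw.
have s0 : 0 < Num.sqrt (2 * pi : R) by rewrite sqrtr_gt0 mulr_gt0// pi_gt0.
have CT : 0 <= C * (1 + `|t|) by rewrite mulr_ge0// addr_ge0.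
have CTE : (0 <= (C * (1 + `|t|))%:E)%E by rewrite lee_fin.
have h := le_trans (hC t _ Lf Lw) (lee_wpmul2l CTE (L2norm_wt_le b0 (inL2_cmeas Lf))).
rewrite (L2norm_ifourier LP) (L2norm_fourier Lu) (L2norm_ifourier La) in h.
rewrite -muleDr ?ge0_adde_def ?inE ?L2norm_ge0// in h.
(* Plancherel has put one factor sqrt (2 pi) on each side; both are divided out. *)
have h' := lee_wpmul2l (_ : 0 <= ((Num.sqrt (2 * pi : R))^-1)%:E)%E h.
have si0 : (0 <= ((Num.sqrt (2 * pi : R))^-1)%:E)%E by rewrite lee_fin invr_ge0 ltW.
have := h' si0; rewrite muleA -EFinM mulVf ?gt_eqF// mul1e => /le_trans; apply.
rewrite !muleA -!EFinM le_eqVlt; apply/orP; left; apply/eqP; congr (_%:E * _)%E.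
by rewrite -/K; field; rewrite gt_eqF.
Qed.

End assembly.

(** * The two parts of the theorem *)

Section main_parts.
Context {R : realType}.
Local Notation mu := (@lebesgue_measure R).
Variables (alpha : R) (alpha01 : 0 < alpha < 1).
Implicit Types (u : R -> R[i]) (t beta : R).

Lemma inL2_wt_of_inH u : inH (2 * alpha) u -> inL2 (fun x => (wt alpha 0 x)%:C * fourier u x).
Proof. by move=> Hu; have [|//] := @inL2_of_inH _ _ alpha01 0 u (lexx _) _; rewrite add0r. Qed.

Lemma Phi_defined_of_inH t u : inH (2 * alpha) u ->
  Phi_defined t alpha (fourier u).
Proof.
move=> Hu; have [Lu _] := Hu; have Lw := inL2_wt_of_inH Hu; have Lf := inL2_fourier Lu.
by split; [apply: Phi_exists_ae => //; exact: inL2_cmeas|exact: inL2_Phi].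
Qed.

Lemma weighted_airy_identity t u : inZ (2 * alpha) alpha u ->
  {ae mu, forall x, abs_weight alpha (airy_group t u) x =
    airy_group t (abs_weight alpha u) x + airy_group t (ifourier (Phi t alpha (fourier u))) x}.
Proof.
move=> [Hu Lw]; have [Lu _] := Hu; have [_ LP] := Phi_defined_of_inH t Hu.
have h := abs_weight_airy alpha01 t Lu Lw (inL2_wt_of_inH Hu).
rewrite (airy_ifourier _ LP) twistD in h *.
have LF := inL2_fourier Lw.
by apply: ae_imply2 h (ifourierD (inL2_twist t LF) (inL2_twist t LP)) => x -> ->.
Qed.

(** The transform of |x|^alpha U(t) u is the phase times the sum of two functions. Weighted by
    |xi|^beta, the first is square integrable by the hypothesis on |x|^alpha u, the second by the
    Schur bound for this beta, so the derivative of the left side is well defined. *)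
Lemma frac_deriv_weighted_airy_identity t beta u : inZ (2 * alpha) alpha u -> 0 < beta < alpha ->
  frac_deriv_inL2 beta (abs_weight alpha u) -> inH (beta + 2 * alpha) u ->
  let P := ifourier (Phi t alpha (fourier u)) in
  [/\ frac_deriv_inL2 beta (abs_weight alpha (airy_group t u)),
      frac_deriv_inL2 beta P &
      {ae mu, forall x, frac_deriv beta (abs_weight alpha (airy_group t u)) x =
         airy_group t (frac_deriv beta (abs_weight alpha u)) x
         + airy_group t (frac_deriv beta P) x}].
Proof.
move=> [Hu Lw] /andP[b0 ba] [_ LA] Hb P; have [Lu _] := Hu.
have bb : 0 <= beta < alpha by rewrite ltW.
have [_ LP] := Phi_defined_of_inH t Hu; have [Lwb _] := inL2_of_inH alpha01 (ltW b0) Hb.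
have LF := inL2_fourier Lw; have LB := inL2_abs_weight_Phi alpha01 t bb (inL2_fourier Lu) Lwb.
have LS := inL2_twist t (inL2D LF LP).
set S := twist t _ in LS.
have LAB := inL2D (inL2_twist t LA) (inL2_twist t LB).
have SE : abs_weight beta S = fun x => twist t (abs_weight beta (fourier (abs_weight alpha u))) x
    + twist t (abs_weight beta (Phi t alpha (fourier u))) x.
  by rewrite /S abs_weight_twist abs_weightD twistD.
have gE : {ae mu, forall x, abs_weight alpha (airy_group t u) x = ifourier S x}.
  exact: (abs_weight_airy alpha01 t Lu Lw (inL2_wt_of_inH Hu)).
have LSb : inL2 (abs_weight beta S) by rewrite SE.
have Lg : inL2 (abs_weight alpha (airy_group t u)).
  apply: (ae_inL2 _ (inL2_ifourier LS) gE).
  apply: cmeas_abs_weight; apply: inL2_cmeas; apply: inL2_ifourier.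
  by apply: inL2_twist; exact: inL2_fourier.
(* The a.e. identity of part (i) becomes an equality of transforms, so the derivative can be
   computed on the right side. *)
have fE := eq_fourier Lg (inL2_ifourier LS) gE.
split.
- split; first exact: Lg.
  by rewrite fE; exact: (inL2_abs_weight_fourierK LS LSb).
- split; first exact: (inL2_ifourier LP).
  exact: (inL2_abs_weight_fourierK LP LB).
have e1 : frac_deriv beta (abs_weight alpha (airy_group t u)) = ifourier (abs_weight beta S).
  by rewrite -(frac_deriv_ifourier LS LSb) /frac_deriv fE.
have e2 : airy_group t (frac_deriv beta (abs_weight alpha u)) =
    ifourier (twist t (abs_weight beta (fourier (abs_weight alpha u)))) := airy_ifourier t LA.
have e3 : airy_group t (frac_deriv beta P) =
    ifourier (twist t (abs_weight beta (Phi t alpha (fourier u)))).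
  exact: (etrans (congr1 (airy_group t) (frac_deriv_ifourier LP LB)) (airy_ifourier t LB)).
apply: (ae_imply _ (ifourierD (inL2_twist t LA) (inL2_twist t LB))) => x h.
apply: etrans (congr1 (fun f => f x) e1) _.
apply: etrans (congr1 (fun f => ifourier f x) SE) _.
apply: (etrans h); apply/esym.
exact: (congr2 +%R (congr1 (fun f => f x) e2) (congr1 (fun f => f x) e3)).
Qed.

End main_parts.

Theorem theorem1 (R : realType) (alpha : R) (halpha : 0 < alpha < 1) :
  (exists c : R, forall u0 : R -> R[i],
     inZ (2 * alpha) alpha u0 ->
     forall t : R,
       let Phi_check := ifourier (Phi t alpha (fourier u0)) in
       [/\ Phi_defined t alpha (fourier u0),
           {ae @lebesgue_measure R, forall x : R,
              abs_weight alpha (airy_group t u0) x =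
              airy_group t (abs_weight alpha u0) x + airy_group t Phi_check x}
         & (L2norm Phi_check <=
            (c * (1 + `|t|))%:E *
            (L2norm u0 + L2norm (frac_deriv (2 * alpha) u0)))%E])
  /\
  (forall beta : R, 0 < beta < alpha ->
   exists c : R, forall u0 : R -> R[i],
     inZ (2 * alpha) alpha u0 ->
     frac_deriv_inL2 beta (abs_weight alpha u0) ->
     inH (beta + 2 * alpha) u0 ->
     forall t : R,
       let Phi_check := ifourier (Phi t alpha (fourier u0)) in
       [/\ Phi_defined t alpha (fourier u0),
           frac_deriv_inL2 beta (abs_weight alpha (airy_group t u0)),
           frac_deriv_inL2 beta Phi_check,
           {ae @lebesgue_measure R, forall x : R,
              frac_deriv beta (abs_weight alpha (airy_group t u0)) x =
              airy_group t (frac_deriv beta (abs_weight alpha u0)) x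
              + airy_group t (frac_deriv beta Phi_check) x}
         & (L2norm (frac_deriv beta Phi_check) <=
            (c * (1 + `|t|))%:E *
            (L2norm u0 + L2norm (frac_deriv (beta + 2 * alpha) u0)))%E]).
Proof.
split.
(* At beta = 0 the weight |xi|^beta is identically 1, also at the origin, and disappears by
   [abs_weight0]. *)
- have [|C C0 hC] := @Phi_estimate _ _ halpha 0.
    by rewrite lexx; case/andP: halpha.
  exists C => u0 Zu t P; have [Hu _] := Zu; split.
  + exact: Phi_defined_of_inH.
  + exact: weighted_airy_identity.
  + have := hC u0 t; rewrite add0r abs_weight0; exact.
- move=> beta hb; have /andP[b0 ba] := hb.
  have [|C C0 hC] := @Phi_estimate _ _ halpha beta; first by rewrite ltW.
  exists C => u0 Zu Db Hb t P; have [Hu _] := Zu.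
  have [h1 h2 h3] := frac_deriv_weighted_airy_identity halpha t Zu hb Db Hb.
  split; [exact: (Phi_defined_of_inH halpha t Hu)|exact: h1|exact: h2|exact: h3|].
  have bb : 0 <= beta < alpha by rewrite ltW.
  have [_ LP] := Phi_defined_of_inH halpha t Hu; have [Lwb _] := inL2_of_inH halpha (ltW b0) Hb.
  have [Lu _] := Hu.
  have LB := inL2_abs_weight_Phi halpha t bb (inL2_fourier Lu) Lwb.
  by rewrite /P (frac_deriv_ifourier LP LB); exact: hC.
Qed.
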